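(* Let $\mathfrak g=\mathfrak{sp}_{2n}$ over $\mathbb C$, let $\mathfrak l=\mathfrak{sp}_{2a}\times\prod_{i=1}^k\mathfrak{gl}_{b_i}$ be a Levi subalgebra with $a\ge 0$, $k\ge 1$, $b_1\ge\dots\ge b_k\ge 1$, $a+b_1+\dots+b_k=n$, and let $\mathbb O_e=\mathrm{Ind}_{\mathfrak l}^{\mathfrak g}(\{0\})$. Then the weak flatness condition holds for $\mathbb O_e$, i.e. $I_e=\mathrm{gr}\, I_x$ (the natural map $\mathbb C[\overline{\mathbb O}_e\cap\mathfrak h]\to\mathbb C[\mathfrak h]/\mathrm{gr}\,I_x$ is an isomorphism), if and only if $a=0$. Moreover, when $a=0$, one has the explicit description $\mathbb C[\overline{\mathbb O}_e\cap\mathfrak h]=\mathbb C[y_1,\dots,y_n]/T_\lambda$, where $\lambda=(\lambda_0\ge\lambda_1\ge\dots\ge\lambda_m)$ is the transpose of the partition $(b_1,b_1,\dots,b_k,b_k)$ of $2n$ and $T_\lambda$ is the ideal generated by all the polynomials $e_p(y_i^2 : i\in L)$ with $L\subset\{1,\dots,n\}$, $l=|L|\ge 1$, $1\le p\le l$ and $2p\ge 2l-d_l(\lambda)+1$, with $d_l(\lambda)=\lambda_{n-l}+\lambda_{n-l+1}+\dots+\lambda_m$ (equal to $0$ if $n-l>m$).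
   Context: $\mathrm{Ind}_{\mathfrak l}^{\mathfrak g}(\{0\})$ is the Lusztig–Spaltenstein induction of the zero orbit: the nilpotent $G$-orbit in $\mathfrak g$ (here $G=Sp_{2n}$) that meets the nilradical of a parabolic subalgebra with Levi $\mathfrak l$ in a dense open subset. $\mathfrak h\subset\mathfrak l$ is a Cartan subalgebra of $\mathfrak g$, $W$ is the Weyl group of $\mathfrak g$, and $y_1,\dots,y_n$ are the standard coordinates on $\mathfrak h$, on which $W$ acts by signed permutations. $\overline{\mathbb O}_e\cap\mathfrak h$ is the scheme-theoretic intersection in $\mathfrak g$ ($\overline{\mathbb O}_e$ with reduced structure), and $I_e\subset\mathbb C[\mathfrak h]$ is its defining ideal. $x$ is a generic element of the center of $\mathfrak l$, i.e. its centralizer in $\mathfrak g$ is exactly $\mathfrak l$. $I_x\subset\mathbb C[\mathfrak h]$ is the ideal of polynomials vanishing on the finite set $W.x$, and $\mathrm{gr}\,I_x$ is the ideal generated by top-degree homogeneous components of elements of $I_x$ (it does not depend on the choice of generic $x$). Here $e_p$ denotes the $p$-th elementary symmetric polynomial. *)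

(* Defs.v *)
From HB Require Import structures.
From mathcomp Require Import all_boot all_order all_algebra all_fingroup.
From mathcomp Require Import classical_sets reals complex.
From mathcomp Require Import mpoly.

Set Implicit Arguments.
Unset Strict Implicit.
Unset Printing Implicit Defensive.

Import GRing.Theory.
Local Open Scope classical_set_scope.
Local Open Scope ring_scope.

Section LieAlgebra.
Context {F : fieldType} {N : nat}.
Implicit Types (X Y : 'M[F]_N) (U V P B L : {vspace 'M[F]_N}).

Definition lie X Y : 'M[F]_N := X *m Y - Y *m X.

(* By bilinearity, the span of the brackets of basis vectors is [U, V]. *)
Definition lie_span U V : {vspace 'M[F]_N} :=
  <<[seq lie u v | u <- vbasis U, v <- vbasis V]>>%VS.

Definition subalgebra U : Prop := {in U &, forall X Y, lie X Y \in U}.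

Definition lie_ideal P U : Prop :=
  (U <= P)%VS /\ {in P & U, forall X Y, lie X Y \in U}.

Definition lie_solvable U : Prop :=
  exists m, iter m (fun D => lie_span D D) U = 0%VS.

Definition lie_nilpotent U : Prop := exists m, iter m (lie_span U) U = 0%VS.

Definition borel (g B : {vspace 'M[F]_N}) : Prop :=
  [/\ (B <= g)%VS, subalgebra B, lie_solvable B
    & forall B' : {vspace 'M[F]_N}, (B <= B')%VS -> (B' <= g)%VS ->
        subalgebra B' -> lie_solvable B' -> B' = B].

Definition parabolic (g P : {vspace 'M[F]_N}) : Prop :=
  [/\ (P <= g)%VS, subalgebra P & exists2 B, borel g B & (B <= P)%VS].

(* The largest nilpotent ideal.  For a parabolic subalgebra P of a semisimple
   Lie algebra this is the Lie algebra of the unipotent radical, because the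
   center of a Levi factor acts on it diagonalizably and faithfully. *)
Definition nilradical P U : Prop :=
  [/\ lie_ideal P U, lie_nilpotent U
    & forall V, lie_ideal P V -> lie_nilpotent V -> (V <= U)%VS].

(* P is a parabolic subalgebra of g with Levi factor L and nilradical U. *)
Definition parabolic_with_levi (g P L U : {vspace 'M[F]_N}) : Prop :=
  [/\ parabolic g P, nilradical P U, subalgebra L
    & (L + U)%VS = P /\ (L :&: U)%VS = 0%VS].

Definition generic_central (g L : {vspace 'M[F]_N}) X : Prop :=
  [/\ X \in L, {in L, forall Y, lie X Y = 0}
    & {in g, forall Y, lie X Y = 0 <-> Y \in L}].

End LieAlgebra.

Section Zariski.
Context {F : fieldType} {N : nat}.
Implicit Types (S : set 'M[F]_N) (f : {mpoly F[N * N]}).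

Definition mxeval f (X : 'M[F]_N) : F := f.@[mxvec X 0].

Definition vanishing_ideal S : set {mpoly F[N * N]} :=
  [set f | forall X, S X -> mxeval f X = 0].

Definition zero_locus (I : set {mpoly F[N * N]}) : set 'M[F]_N :=
  [set X | forall f, I f -> mxeval f X = 0].

Definition zariski_closure S : set 'M[F]_N := zero_locus (vanishing_ideal S).

Definition meets_in_dense_open S (U : {vspace 'M[F]_N}) : Prop :=
  (exists I, [set` U] `&` S = [set` U] `\` zero_locus I) /\
  [set` U] `<=` zariski_closure ([set` U] `&` S).

End Zariski.

Section Symplectic.
Context {F : fieldType} {n : nat}.
Implicit Types X : 'M[F]_(n + n).

Definition sympJ : 'M[F]_(n + n) := block_mx 0 1%:M (- 1%:M) 0.

Definition sp_defect X : 'M[F]_(n + n) := X^T *m sympJ + sympJ *m X.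

Fact sp_defect_is_linear : linear sp_defect.
Proof.
move=> c X Y; rewrite /sp_defect linearP /= mulmxDl mulmxDr -scalemxAl.
by rewrite -scalemxAr scalerDr addrACA.
Qed.

HB.instance Definition _ :=
  GRing.isLinear.Build F 'M[F]_(n + n) 'M[F]_(n + n) _ sp_defect
    sp_defect_is_linear.

Definition sp : {vspace 'M[F]_(n + n)} := lker (linfun sp_defect).

Lemma mem_sp X : (X \in sp) = (X^T *m sympJ + sympJ *m X == 0).
Proof. by rewrite memv_ker lfunE. Qed.

Definition Sp : set 'M[F]_(n + n) := [set g | g^T *m sympJ *m g = sympJ].

Definition Sp_orbit X : set 'M[F]_(n + n) :=
  [set Y | exists2 g, Sp g & Y = g *m X *m invmx g].

Definition nilpotent_orbit (O : set 'M[F]_(n + n)) : Prop :=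
  exists X, [/\ X \in sp, exists m, X ^+ m = 0 & O = Sp_orbit X].

(* O is the orbit induced from the zero orbit of L. *)
Definition induced_zero_orbit (L : {vspace 'M[F]_(n + n)})
    (O : set 'M[F]_(n + n)) : Prop :=
  nilpotent_orbit O /\
  exists P U, parabolic_with_levi sp P L U /\ meets_in_dense_open O U.

End Symplectic.

Section Levi.
Context {F : fieldType} (n a : nat) (b : seq nat).

(* For n = a + sum b, the 2n basis vectors of F^(2n), with dual pairs
   (i, n + i), are distributed over the summands of
     F^(2a) (+) sum_j (F^(b_j) (+) dual of F^(b_j)).
   The summand F^(2a) has label (0, false); for j >= 1, (j, false) is F^(b_j)
   and (j, true) is its dual. *)
Definition levi_label (i : 'I_(n + n)) : nat * bool :=
  match split i with
  | inl j => (reshape_index (a :: b) j, false)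
  | inr j => let r := reshape_index (a :: b) j in (r, r != 0%N)
  end.

Definition off_levi (X : 'M[F]_(n + n)) : 'M[F]_(n + n) :=
  \matrix_(i, j) if levi_label i == levi_label j then 0 else X i j.

Fact off_levi_is_linear : linear off_levi.
Proof.
move=> c X Y; apply/matrixP=> i j; rewrite !mxE.
by case: ifP; rewrite ?mulr0 ?addr0.
Qed.

HB.instance Definition _ :=
  GRing.isLinear.Build F 'M[F]_(n + n) 'M[F]_(n + n) _ off_levi
    off_levi_is_linear.

(* The elements of sp_2n preserving each of these summands: this is
   sp_2a x gl_(b_1) x ... x gl_(b_k). *)
Definition levi : {vspace 'M[F]_(n + n)} := (sp :&: lker (linfun off_levi))%VS.

Lemma mem_levi X :
  X \in levi <->
  X \in sp /\ forall i j, levi_label i != levi_label j -> X i j = 0.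
Proof.
rewrite memv_cap [X in _ && X]memv_ker lfunE /=; split.
  case/andP=> -> /eqP XP; split=> // i j /negPf nij.
  by move/matrixP/(_ i j): XP; rewrite !mxE nij.
case=> -> XP; apply/eqP/matrixP=> i j; rewrite !mxE.
by case: eqP => // /eqP /XP.
Qed.

End Levi.

(* The point of the diagonal Cartan subalgebra h with coordinates y. *)
Definition cartan_mx {R : pzRingType} {n : nat} (y : 'rV[R]_n) :
  'M[R]_(n + n) := diag_mx (row_mx y (- y)).

Section Ideals.
Context {F : fieldType} {n : nat}.
Implicit Types f : {mpoly F[n]}.

Definition ideal_gen (S : set {mpoly F[n]}) : set {mpoly F[n]} :=
  [set f | exists s : seq ({mpoly F[n]} * {mpoly F[n]}),
     (forall cg, cg \in s -> S cg.2) /\ f = \sum_(cg <- s) cg.1 * cg.2].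

Definition top_component f : {mpoly F[n]} :=
  pihomog mdeg (msize f).-1 f.

Definition gr_ideal (I : set {mpoly F[n]}) : set {mpoly F[n]} :=
  ideal_gen (top_component @` I).

Definition weyl_orbit (x : 'rV[F]_n) : set 'rV[F]_n :=
  [set y | exists (s : 'S_n) (e : {ffun 'I_n -> bool}),
     y = \row_i ((-1) ^+ e i * x 0 (s i))].

Definition orbit_ideal (x : 'rV[F]_n) : set {mpoly F[n]} :=
  [set f | forall y, weyl_orbit x y -> f.@[y 0] = 0].

Definition restrict_to_cartan (f : {mpoly F[(n + n) * (n + n)]}) :
    {mpoly F[n]} :=
  f \mPo [tuple mxvec (cartan_mx (\row_i 'X_i)) 0 j | j < (n + n) * (n + n)].

(* The ideal in C[h] of the scheme-theoretic intersection of h with the reduced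
   closure of O, i.e. the image of the ideal of the closure.  All ideals are
   taken in the coordinate ring of the matrix space containing g; since g is a
   closed subscheme containing both, the intersection is the same. *)
Definition closure_cartan_ideal (O : set 'M[F]_(n + n)) : set {mpoly F[n]} :=
  restrict_to_cartan @` vanishing_ideal (zariski_closure O).

End Ideals.

Definition conj_part (s : seq nat) : seq nat :=
  mkseq (fun j => count (fun m => j < m)%N s) (\max_(m <- s) m).

Definition double_parts (b : seq nat) : seq nat :=
  flatten [seq [:: m; m] | m <- b].

Definition dpart (n l : nat) (lam : seq nat) : nat := sumn (drop (n - l) lam).

Section Tanisaki.
Context {F : fieldType} {n : nat}.

(* e_p in the squares of the variables indexed by L *)
Definition esym_sq (L : {set 'I_n}) (p : nat) : {mpoly F[n]} :=
  mesym #|L| F p \mPo [tuple 'X_(enum_val i) ^+ 2 | i < #|L|].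

Definition tanisaki_ideal (lam : seq nat) : set {mpoly F[n]} :=
  ideal_gen [set f | exists (L : {set 'I_n}) (p : nat),
    [/\ (1 <= #|L|)%N, (1 <= p <= #|L|)%N,
        (2 * #|L| + 1 <= 2 * p + dpart n #|L| lam)%N & f = esym_sq L p]].

End Tanisaki.

(* Main.v *)
(* Up to the vanishing ideal, O may be replaced by the Sp-conjugates of the
   nilradical u of P, and u consists of the X in sp with X_pq <> 0 only for
   ht p < ht q, for an odd height function ht that separates the labels of l.

   Case a = 0.  Let T be the Tanisaki ideal, I the ideal of the intersection of
   the closure of O with h, and K the ideal of the f such that, for every filling
   of the Young diagram of b by the variables, the column-antisymmetrization of
   any multiple of f has no staircase monomial prod_i y_i^(2 rank(i) + 1), where
   rank is the position in the column.  Then T = I = gr I_x = K: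
   - T <= gr I_x: on W.x the polynomial prod_(i in L) (t - y_i^2) is divisible by
     prod_j (t - x_j^2)^(b_j - (n - |L|)), and reduction modulo the latter yields
     a lower-order correction of e_p.
   - T <= I: the Pfaffian of J (t - X^2) on the rows and columns L and L* is
     divisible by t^(sum_j (b_j - (n - |L|))) on the conjugates of u, since it is
     so, with t - x_j^2 instead of t, on the conjugates of x + u.
   - gr I_x <= K: a polynomial vanishing at all signed column permutations of a
     point of W.x has no staircase coefficient in top degree, by a Vandermonde
     determinant.
   - I <= K: diag y + C is conjugate to an element of u, where C is a cyclic shift
     in each column and y is any signed column permutation of square roots of the
     roots of unity; now argue as for gr I_x, as f(diag y + C) and f(diag y) have
     the same top-degree part.
   - K <= T: induction on the number of variables, removing a cell of the diagram.

   Case a > 0.  Let S consist of the coordinates in the gl factors together with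
   one coordinate of sp_2a.  Each point of W.x has fewer than |S| nonzero
   coordinates, so the monomial y_S is in gr I_x.  But diag(eps_S) + C is conjugate
   to an element of u for a fixed C and all sign vectors eps, so that no f in I has
   the term y_S as its component of degree |S|. *)

Require Import Defs.
From mathcomp Require Import all_boot all_order all_algebra all_fingroup.
From mathcomp Require Import classical_sets boolp reals complex.
From mathcomp Require Import mpoly separable cyclotomic.
From mathcomp Require Import zify ring.
From HB Require Import structures.

Set Implicit Arguments.
Unset Strict Implicit.
Unset Printing Implicit Defensive.

Import Order.TTheory GRing.Theory Num.Theory.
Local Open Scope ring_scope.

(** * The symplectic Lie algebra *)

(** The ideal K is introduced because it is cut out by linear functionals: an inclusion into K
    becomes a statement about polynomials vanishing at finitely many points, and no dimension count
    enters. The exponents 2 rank + 1 are those of the monomials of prod y_i prod (y_i^2 - y_j^2),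
    the alternating polynomial of a group of signed permutations, here taken for each column. The
    inclusion K <= T has to produce elements of T; it works with the powers of the last variable v.
    Modulo T, an element f of K is moved into y_v^(2t) times a polynomial, for growing t. The
    coefficients of y_v^(2t) and y_v^(2t+1) are orthogonal for the diagram with a cell removed from
    a row that has at most t strictly longer rows and more than t rows at least as long (itself
    included). By induction they lie in the smaller Tanisaki ideal, and y_v^(2t) times that ideal
    lies in T up to multiples of y_v^(2t+2). The process ends because y_v^(2r) is in T for r the
    number of nonempty rows. *)

Section Star.
Variable n : nat.
Implicit Types (p q : 'I_(n + n)) (i : 'I_n).

Definition star p : 'I_(n + n) :=
  match split p with inl i => rshift n i | inr i => lshift n i end.

Lemma star_l i : star (lshift n i) = rshift n i.
Proof. by rewrite /star -[lshift n i]/(unsplit (inl i)) unsplitK. Qed.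

Lemma star_r i : star (rshift n i) = lshift n i.
Proof. by rewrite /star -[rshift n i]/(unsplit (inr i)) unsplitK. Qed.

Lemma starK : involutive star.
Proof. by move=> p; case: (split_ordP p) => i ->; rewrite ?(star_l, star_r). Qed.

Lemma star_inj : injective star.
Proof. exact: inv_inj starK. Qed.

Lemma star_neq p : star p != p.
Proof.
by case: (split_ordP p) => i ->; rewrite ?(star_l, star_r) ?eq_rlshift ?eq_lrshift.
Qed.

Lemma eq_star p q : (star p == q) = (p == star q).
Proof. by rewrite -(inj_eq star_inj) starK. Qed.

Variable F : comNzRingType.

Definition sg p : F := if split p is inl _ then 1 else -1.

Lemma sg_l i : sg (lshift n i) = 1.
Proof. by rewrite /sg -[lshift n i]/(unsplit (inl i)) unsplitK. Qed.

Lemma sg_r i : sg (rshift n i) = -1.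
Proof. by rewrite /sg -[rshift n i]/(unsplit (inr i)) unsplitK. Qed.

Lemma sg_star p : sg (star p) = - sg p.
Proof.
by case: (split_ordP p) => i ->; rewrite ?(star_l, star_r) ?sg_l ?sg_r ?opprK.
Qed.

Lemma sgM p : sg p * sg p = 1.
Proof. by case: (split_ordP p) => i ->; rewrite ?sg_l ?sg_r ?mulrNN mulr1. Qed.

End Star.
Arguments star {n}.
Arguments sg {n F}.

Section Symp.
Variables (F : fieldType) (n : nat).
Implicit Types (p q : 'I_(n + n)) (i : 'I_n) (X Y g : 'M[F]_(n + n)).
Local Notation J := (@sympJ F n).

Lemma sympJE p q : J p q = sg p * (q == star p)%:R.
Proof.
rewrite /sympJ; case: (split_ordP p) => i ->; case: (split_ordP q) => j ->;
  rewrite ?(star_l, star_r) ?sg_l ?sg_r ?eq_rlshift ?eq_lrshift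
    ?eq_lshift ?eq_rshift ?mulr0 ?mul1r ?mulN1r.
- by rewrite block_mxEul mxE.
- by rewrite block_mxEur mxE eq_sym.
- by rewrite block_mxEdl !mxE eq_sym.
- by rewrite block_mxEdr mxE.
Qed.

Lemma mulJmx m (X : 'M[F]_(n + n, m)) p (q : 'I_m) : (J *m X) p q = sg p * X (star p) q.
Proof.
rewrite mxE (bigD1 (star p)) //= sympJE eqxx mulr1 big1 ?addr0 // => t /negPf nt.
by rewrite sympJE nt mulr0 mul0r.
Qed.

Lemma mulmxJ m (X : 'M[F]_(m, n + n)) (p : 'I_m) q : (X *m J) p q = - sg q * X p (star q).
Proof.
rewrite mxE (bigD1 (star q)) //= sympJE starK eqxx mulr1 big1 ?addr0.
  by rewrite sg_star mulrC.
move=> t nt; rewrite sympJE eq_sym eq_star (negPf nt) !mulr0 //.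
Qed.

Lemma sympJJ : J *m J = - 1%:M.
Proof.
apply/matrixP => p q; rewrite mulJmx sympJE starK sg_star !mxE mulrA mulrN sgM.
by rewrite mulN1r eq_sym.
Qed.

Lemma trmx_sympJ : J^T = - J.
Proof.
apply/matrixP => p q; rewrite [LHS]mxE [RHS]mxE !sympJE [q == _]eq_sym eq_star.
by case: eqP => [->|_]; rewrite ?mulr0 ?oppr0 // sg_star mulNr opprK.
Qed.

Lemma spP X : reflect (forall p q, X (star q) (star p) = - (sg p * sg q) * X p q)
  (X \in sp).
Proof.
rewrite mem_sp; apply: (iffP eqP) => [/matrixP XP p q|XP].
  have := XP (star p) q; rewrite [LHS]mxE mulmxJ mulJmx starK sg_star !mxE.
  move/(congr1 ( *%R (- sg q))); rewrite mulr0 mulrDr mulrA mulrNN sgM mul1r.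
  by move/eqP; rewrite addr_eq0 => /eqP ->; ring.
apply/matrixP => p q; rewrite [LHS]mxE mulmxJ mulJmx !mxE.
have := XP (star p) q; rewrite starK sg_star => ->.
transitivity ((1 - sg q * sg q) * (sg p * X (star p) q)); first by ring.
by rewrite sgM subrr mul0r.
Qed.

Lemma Sp_unit g : Sp g -> g \in unitmx.
Proof.
move=> gS; have : (- J *m g^T *m J) *m g = 1%:M.
  by rewrite -!mulmxA [g^T *m _]mulmxA gS mulNmx sympJJ opprK.
by case/mulmx1_unit.
Qed.

Lemma Sp_inv g : Sp g -> Sp (invmx g).
Proof.
move=> gS; have gu := Sp_unit gS.
rewrite /Sp /= -{1}gS !mulmxA -trmx_mul mulmxV // trmx1 mul1mx.
by rewrite -mulmxA mulmxV // mulmx1.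
Qed.

Lemma Sp_mul g h : Sp g -> Sp h -> Sp (g *m h).
Proof.
rewrite /Sp /= => gS hS.
by rewrite trmx_mul -!mulmxA [J *m _]mulmxA [g^T *m _]mulmxA (mulmxA g^T) gS mulmxA.
Qed.

Lemma Sp1 : Sp (1%:M : 'M[F]_(n + n)).
Proof. by rewrite /Sp /= trmx1 mul1mx mulmx1. Qed.

Lemma Sp_tr g : Sp g -> Sp g^T.
Proof.
move=> gS; rewrite /Sp /= trmxK.
have gu := Sp_unit gS.
have e : (- J *m g^T *m J) *m g = 1%:M.
  by rewrite -!mulmxA [g^T *m _]mulmxA gS mulNmx sympJJ opprK.
have : g *m (- J *m g^T *m J) = 1%:M by rewrite -(mulmx1C e).
rewrite !mulmxA mulmxN => /(congr1 (fun M => M *m J)).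
by rewrite mul1mx !mulNmx -mulmxA sympJJ mulmxN mulmx1 opprK.
Qed.

Lemma invmxM (A B : 'M[F]_(n + n)) : A \in unitmx -> B \in unitmx ->
  invmx (A *m B) = invmx B *m invmx A.
Proof.
move=> Au Bu; have ABu : A *m B \in unitmx by rewrite unitmx_mul Au.
apply: (can_inj (mulKmx ABu)); rewrite mulmxV // !mulmxA.
by rewrite mulmxK // mulmxV.
Qed.

Lemma conj_sp g X : Sp g -> X \in sp -> g *m X *m invmx g \in sp.
Proof.
move=> gS; rewrite !mem_sp => /eqP XP.
have gu := Sp_unit gS; have giS := Sp_inv gS.
have e1 : J *m g = (invmx g)^T *m J.
  by rewrite -{2}gS -!mulmxA [X in _ = X]mulmxA -trmx_mul mulmxV // trmx1 mul1mx.
have e2 : J *m invmx g = g^T *m J.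
  by rewrite -{1}gS -!mulmxA mulmxV // mulmx1.
rewrite mulmxA [J *m (g *m X)]mulmxA e1 !trmx_mul !mulmxA -[_ *m g^T *m J]mulmxA -e2.
rewrite mulmxA -mulmxDl.
by rewrite -!mulmxA -mulmxDr XP mulmx0 mul0mx.
Qed.

End Symp.

(** In a vector of the left kernel take a nonzero entry of least [rho]: in the corresponding column
    of the product only the diagonal term survives. *)
Lemma ranked_triangular_unit (F : fieldType) m (rho : 'I_m -> int) (M : 'M[F]_m) :
    (forall p, M p p != 0) ->
    (forall p q, M p q != 0 -> p != q -> rho p < rho q) ->
  M \in unitmx.
Proof.
move=> Md Mt; rewrite -row_free_unit -kermx_eq0; apply/eqP/eqP/rowV0P => v.
move=> /sub_kermxP vM; apply/eqP/negPn/negP => v0.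
have /existsP[p0 p0P] : [exists p, v 0 p != 0].
  apply: contraNT v0 => /existsPn v0; apply/eqP/rowP => p.
  by rewrite mxE; apply/eqP; rewrite -[_ == _]negbK v0.
case: (@arg_minP _ _ _ p0 (fun p => v 0 p != 0) rho p0P) => p vp pmin.
have := congr1 (fun A : 'rV_m => A 0 p) vM; rewrite !mxE (bigD1 p) //= big1.
  by rewrite addr0 => /eqP; rewrite mulf_eq0 (negPf vp) (negPf (Md p)).
move=> q qp; case: (eqVneq (M q p) 0) => [->|Mqp]; first by rewrite mulr0.
case: (eqVneq (v 0 q) 0) => [->|vq]; first by rewrite mul0r.
by have := pmin q vq; rewrite leNgt (Mt _ _ Mqp qp).
Qed.

(** * Triangular subalgebras of sp and their Sp-saturation *)

Section Upper.
Variables (F : fieldType) (n : nat).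
Implicit Types (p q : 'I_(n + n)) (X Y g : 'M[F]_(n + n)).

Section Pattern.
Variable R : rel 'I_(n + n).

Definition off_pattern X := \matrix_(i, j) if R i j then 0 else X i j.

Fact off_pattern_is_linear : linear off_pattern.
Proof.
move=> c X Y; apply/matrixP=> i j; rewrite !mxE.
by case: ifP; rewrite ?mulr0 ?addr0.
Qed.

HB.instance Definition _ :=
  GRing.isLinear.Build F 'M[F]_(n + n) 'M[F]_(n + n) _ off_pattern
    off_pattern_is_linear.

Definition sp_pattern : {vspace 'M[F]_(n + n)} :=
  (sp :&: lker (linfun off_pattern))%VS.

Lemma mem_sp_pattern X :
  X \in sp_pattern <-> X \in sp /\ forall i j, X i j != 0 -> R i j.
Proof.
rewrite memv_cap [X in _ && X]memv_ker lfunE /=; split.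
  case/andP=> -> /eqP XP; split=> // i j; apply: contra_neqT => /negPf nij.
  by move/matrixP/(_ i j): XP; rewrite !mxE nij.
case=> -> XP; apply/eqP/matrixP=> i j; rewrite !mxE.
by case: ifPn => // nij; apply/eqP; apply: contraNT nij => /XP.
Qed.

End Pattern.

Definition upper (rho : 'I_(n + n) -> int) : {vspace 'M[F]_(n + n)} :=
  sp_pattern (fun p q => rho p < rho q).

Lemma mem_upper rho X :
  X \in upper rho <-> X \in sp /\ forall p q, X p q != 0 -> rho p < rho q.
Proof. exact: mem_sp_pattern. Qed.

Definition upper_conj rho : set 'M[F]_(n + n) :=
  [set Y | exists g X, [/\ Sp g, X \in upper rho & Y = g *m X *m invmx g]].

Lemma upper_conjJ rho g Y : Sp g -> upper_conj rho Y ->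
  upper_conj rho (g *m Y *m invmx g).
Proof.
move=> gS [h [X [hS XU ->]]]; exists (g *m h), X; split => //; first exact: Sp_mul.
by rewrite invmxM ?Sp_unit // !mulmxA.
Qed.

(** A Weyl group element lifted to Sp: the permutation matrix respects the pairing by [star], and
    the signs [c], needed on the second half only, repair its effect on the signs in J. *)
Lemma signed_perm (theta : 'I_(n + n) -> 'I_(n + n)) :
    injective theta -> {morph theta : p / star p} ->
  exists g, exists2 c : 'I_(n + n) -> F, Sp g &
    (forall p, c p * c p = 1) /\
    forall X p q, (g *m X *m invmx g) p q = c p * c q * X (theta p) (theta q).
Proof.
move=> ti ts.
pose c p : F := if split p is inr i then sg (theta (lshift n i)) else 1.
have cc p : c p * c p = 1.
  by rewrite /c; case: split => [_|i]; rewrite ?mulr1 ?sgM.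
have cl i : c (lshift n i) = 1.
  by rewrite /c -[lshift n i]/(unsplit (inl i)) unsplitK.
have cr i : c (rshift n i) = sg (theta (lshift n i)).
  by rewrite /c -[rshift n i]/(unsplit (inr i)) unsplitK.
have cs p : c p * c (star p) * sg (theta p) = sg p.
  case: (split_ordP p) => i ->; rewrite ?(star_l, star_r) cl cr.
    by rewrite mul1r sgM sg_l.
  by rewrite mulr1 -star_l ts sg_star mulrN sgM sg_star sg_l.
pose g : 'M[F]_(n + n) := \matrix_(p, q) (c p * (q == theta p)%:R).
have gl m (X : 'M_(n + n, m)) p (q : 'I_m) : (g *m X) p q = c p * X (theta p) q.
  rewrite mxE (bigD1 (theta p)) //= !mxE eqxx mulr1 big1 ?addr0 // => t /negPf nt.
  by rewrite !mxE nt mulr0 mul0r.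
have gr m (X : 'M_(m, n + n)) (p : 'I_m) q : (X *m g^T) p q = c q * X p (theta q).
  rewrite mxE (bigD1 (theta q)) //= !mxE eqxx mulr1 mulrC big1 ?addr0 // => t /negPf nt.
  by rewrite !mxE nt !mulr0.
have gtg : g *m g^T = 1%:M.
  apply/matrixP => p q; rewrite gl !mxE (inj_eq ti).
  by case: eqP => [->|]; rewrite ?mulr1 ?cc // !mulr0.
have gu : g \in unitmx by case: (mulmx1_unit gtg).
have gi : invmx g = g^T.
  by apply: (can_inj (mulKmx gu)); rewrite mulmxV // gtg.
exists g, c; last first.
  by split=> // X p q; rewrite gi gr gl mulrCA mulrA.
rewrite -[g]trmxK; apply: Sp_tr; rewrite /Sp /= trmxK.
apply/matrixP => p q; rewrite gr gl !sympJE -ts (inj_eq ti) mulrA mulrA.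
case: eqP => [->|]; last by rewrite !mulr0.
by rewrite !mulr1 [c _ * c p]mulrC cs.
Qed.

(** Heights can thus be transported by the Weyl group; this is how they are later made negative or
    nonpositive on the first half of the basis. *)
Lemma upper_conj_perm rho (theta : 'I_(n + n) -> 'I_(n + n)) :
    injective theta -> {morph theta : p / star p} ->
  forall X, upper_conj (rho \o theta) X -> upper_conj rho X.
Proof.
move=> ti ts _ [h [X [hS /mem_upper[Xsp XU] ->]]].
have [g [c gS [cc gE]]] := signed_perm ti ts.
have gu := Sp_unit gS.
apply: upper_conjJ => //; exists g, (invmx g *m X *m g); split => //; last first.
  by rewrite !mulmxA mulmxV // mul1mx mulmxK.
apply/mem_upper; split.
  by rewrite -{2}[g]invmxK; apply: conj_sp => //; apply: Sp_inv.
move=> p q; have thV := f_invF ti.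
rewrite -(thV p) -(thV q) => Znz; apply: XU.
have -> : X = g *m (invmx g *m X *m g) *m invmx g.
  by rewrite !mulmxA mulmxV // mul1mx mulmxK.
rewrite gE.
rewrite !mulf_neq0 //; apply/eqP => c0; [have := cc (invF ti p)|have := cc (invF ti q)];
  by rewrite c0 mul0r => /esym/eqP; rewrite oner_eq0.
Qed.

End Upper.

(** * Reduction of the induced orbit to a triangular model *)

Section Lie.
Variables (F : fieldType) (N : nat).
Implicit Types (X Y : 'M[F]_N) (U V W : {vspace 'M[F]_N}).

Lemma lieDl X X' Y : lie (X + X') Y = lie X Y + lie X' Y.
Proof. by rewrite /lie mulmxDl mulmxDr opprD addrACA. Qed.

Lemma lieDr X Y Y' : lie X (Y + Y') = lie X Y + lie X Y'.
Proof. by rewrite /lie mulmxDl mulmxDr opprD addrACA. Qed.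

Lemma lieZl c X Y : lie (c *: X) Y = c *: lie X Y.
Proof. by rewrite /lie -scalemxAl -scalemxAr scalerBr. Qed.

Lemma lieZr c X Y : lie X (c *: Y) = c *: lie X Y.
Proof. by rewrite /lie -scalemxAl -scalemxAr scalerBr. Qed.

Lemma lieC X Y : lie X Y = - lie Y X.
Proof. by rewrite /lie opprB. Qed.

Lemma lie_suml I (r : seq I) (c : I -> 'M[F]_N) Y :
  lie (\sum_(i <- r) c i) Y = \sum_(i <- r) lie (c i) Y.
Proof.
elim: r => [|i r IH]; last by rewrite !big_cons lieDl IH.
by rewrite !big_nil /lie mul0mx mulmx0 subr0.
Qed.

Lemma lie_sumr I (r : seq I) (c : I -> 'M[F]_N) Y :
  lie Y (\sum_(i <- r) c i) = \sum_(i <- r) lie Y (c i).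
Proof. by rewrite lieC lie_suml -sumrN; apply: eq_bigr => i _; rewrite -lieC. Qed.

Lemma lie_span_sub U V W :
  {in U & V, forall u v, lie u v \in W} -> (lie_span U V <= W)%VS.
Proof.
move=> UVW; apply/span_subvP => _ /allpairsP[[u v] /= [uU vV ->]].
by apply: UVW; apply: vbasis_mem.
Qed.

Lemma mem_lie_span U V : {in U & V, forall u v, lie u v \in lie_span U V}.
Proof.
move=> u v uU vV; rewrite (coord_vbasis uU) (coord_vbasis vV).
rewrite lie_suml; apply: memv_suml => i _; rewrite lie_sumr.
apply: memv_suml => j _; rewrite lieZl lieZr; do 2!apply: memvZ.
by apply/memv_span/allpairs_f; apply: memt_nth.
Qed.

Lemma lie_spanS U V U' V' : (U <= U')%VS -> (V <= V')%VS ->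
  (lie_span U V <= lie_span U' V')%VS.
Proof.
move=> /subvP sU /subvP sV; apply: lie_span_sub => u v uU vV.
by apply: mem_lie_span; [apply: sU | apply: sV].
Qed.

Definition derived m U := iter m (fun D => lie_span D D) U.

Lemma derivedS m U V : (U <= V)%VS -> (derived m U <= derived m V)%VS.
Proof. by move=> UV; elim: m => //= m IH; apply: lie_spanS. Qed.

Lemma derived_sub m U : subalgebra U -> (derived m U <= U)%VS.
Proof.
move=> Ua; elim: m => //= m IH; apply: subv_trans (lie_spanS IH IH) _.
exact: lie_span_sub.
Qed.

(** Serves to enlarge a Borel subalgebra by a subalgebra [V] that it normalizes: modulo [V], the
    derived series does not change. *)
Lemma derived_addv m B V : subalgebra B -> {in B & V, forall X Y, lie X Y \in V} ->
  subalgebra V -> (derived m (B + V) <= derived m B + V)%VS.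
Proof.
move=> Ba BV Va; elim: m => //= m IH; apply: subv_trans (lie_spanS IH IH) _.
have /subvP dB := derived_sub m Ba.
apply: lie_span_sub => _ _ /memv_addP[b bB [v vV ->]] /memv_addP[c cB [w wV ->]].
rewrite lieDl !lieDr -addrA memv_add ?mem_lie_span //.
apply: memvD; first by apply: BV => //; apply: dB.
by apply: memvD; [rewrite lieC memvN; apply: BV => //; apply: dB | apply: Va].
Qed.

Definition hadamard (w : 'I_N -> 'I_N -> F) X : 'M[F]_N := \matrix_(p, q) (w p q * X p q).

(** Lagrange interpolation: [U] is stable under every polynomial in the diagonal operator with
    eigenvalues [w], in particular under the projection to an eigenspace. *)
Lemma hadamard_component U w omega :
    (forall X, X \in U -> hadamard w X \in U) ->
  forall X, X \in U -> (\matrix_(p, q) if w p q == omega then X p q else 0) \in U.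
Proof.
move=> wU X XU.
have polyU (P : {poly F}) : hadamard (fun p q => P.[w p q]) X \in U.
  elim/poly_ind: P => [|P c IH].
    rewrite (_ : hadamard _ _ = 0) ?mem0v //.
    by apply/matrixP => p q; rewrite !mxE horner0 mul0r.
  rewrite (_ : hadamard _ _ = hadamard w (hadamard (fun p q => P.[w p q]) X) + c *: X).
    by rewrite memvD ?memvZ ?wU.
  by apply/matrixP => p q; rewrite !mxE !hornerE /=; ring.
pose vs := [seq v <- [seq w pq.1 pq.2 | pq : 'I_N * 'I_N] | v != omega].
pose P := \prod_(v <- vs) ('X - v%:P).
have Po : P.[omega] != 0.
  rewrite horner_prod prodf_seq_neq0; apply/allP => v; rewrite mem_filter hornerXsubC.
  by case/andP => vo _; rewrite subr_eq0 eq_sym.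
rewrite (_ : matrix_of_fun _ _ =
  P.[omega]^-1 *: hadamard (fun p q => P.[w p q]) X) ?memvZ //.
apply/matrixP => p q; rewrite !mxE; case: eqP => [->|/eqP wo].
  by rewrite mulrA mulVf ?mul1r.
rewrite (_ : P.[w p q] = 0) ?mul0r ?mulr0 //.
rewrite horner_prod; apply/eqP; rewrite prodf_seq_eq0; apply/hasP.
exists (w p q); last by rewrite hornerXsubC subrr eqxx.
by rewrite mem_filter wo; apply/mapP; exists (p, q); rewrite ?mem_enum.
Qed.

Lemma hadamard_components U (T : eqType) (ts : seq T) (w : T -> 'I_N -> 'I_N -> F) p0 q0 :
    (forall t X, X \in U -> hadamard (w t) X \in U) ->
  forall X, X \in U -> (\matrix_(p, q)
    if all (fun t => w t p q == w t p0 q0) ts then X p q else 0) \in U.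
Proof.
move=> wU X XU; elim: ts => [|t ts IH] /=.
  by rewrite (_ : matrix_of_fun _ _ = X) //; apply/matrixP => p q; rewrite mxE.
have h := hadamard_component (w t p0 q0) (wU t) IH.
refine (eq_rect _ (fun Z => is_true (Z \in U)) h _ _); apply/matrixP => p q; rewrite !mxE.
by case: ifP.
Qed.

End Lie.

Section Label.
Variables (n a : nat) (b : seq nat).
Implicit Types p q : 'I_(n + n).
Local Notation lab := (@levi_label n a b).

Definition dual_label (l : nat * bool) : nat * bool := (l.1, (l.1 != 0)%N && ~~ l.2).

Lemma levi_label_l i : lab (lshift n i) = (reshape_index (a :: b) i, false).
Proof. by rewrite /levi_label -[lshift n i]/(unsplit (inl i)) unsplitK. Qed.

Lemma levi_label_r i : lab (rshift n i) =
  (reshape_index (a :: b) i, reshape_index (a :: b) i != 0%N).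
Proof. by rewrite /levi_label -[rshift n i]/(unsplit (inr i)) unsplitK. Qed.

Lemma levi_label_star p : lab (star p) = dual_label (lab p).
Proof.
case: (split_ordP p) => i ->;
  rewrite ?(star_l, star_r) ?(levi_label_l, levi_label_r) /dual_label /= ?andbT //.
by rewrite andbN.
Qed.

(** An integer that separates the labels and is odd under [star]; it breaks ties in the height
    below. *)
Definition signed_label (l : nat * bool) : int := if l.2 then - (l.1)%:Z else l.1%:Z.

Lemma signed_label_star p : signed_label (lab (star p)) = - signed_label (lab p).
Proof.
rewrite levi_label_star /signed_label /dual_label /=.
case: (split_ordP p) => i ->; rewrite ?(levi_label_l, levi_label_r) /=;
  by case: (reshape_index _ _) => //= m; rewrite opprK.
Qed.

Lemma signed_label_inj p q : signed_label (lab p) = signed_label (lab q) -> lab p = lab q.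
Proof.
rewrite /signed_label; case: (split_ordP p) => i ->; case: (split_ordP q) => j ->;
  rewrite ?(levi_label_l, levi_label_r) /=;
  case: (reshape_index _ i) => [|r]; case: (reshape_index _ j) => [|s] //=; try lia.
- by case=> ->.
- by move/oppr_inj => [->].
Qed.

End Label.

Section RootComponents.
Variables (F : numFieldType) (n a : nat) (b : seq nat).
Implicit Types (p q r s t : 'I_(n + n)) (X Y : 'M[F]_(n + n)).
Local Notation lab := (@levi_label n a b).
Local Notation L := (@levi F n a b).
Local Notation sp := (@sp F n).

Lemma two_neq0 : (2 : F) != 0. Proof. by rewrite pnatr_eq0. Qed.

(** The eigenvalue on the basis vector [p] of the diagonal element of sp with entry 1 at [t] and -1
    at [star t]. *)
Definition wt t p : F := (p == t)%:R - (p == star t)%:R.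

Lemma wt_star t p : wt t (star p) = - wt t p.
Proof. by rewrite /wt opprB !eq_star starK. Qed.

Lemma wt_self t : wt t t = 1.
Proof. by rewrite /wt eqxx eq_sym (negPf (star_neq t)) subr0. Qed.

Lemma wt_inj p q : (forall t, wt t p = wt t q) -> p = q.
Proof.
move=> /(_ p); rewrite wt_self /wt; case: eqP => [-> //|_]; case: eqP => _ /eqP.
  by rewrite sub0r -subr_eq0 opprK -[1]/(1%:R) -natrD pnatr_eq0.
by rewrite subr0 oner_eq0.
Qed.

(** The root spaces of sp are lines: a root determines its index pair up to the symmetry of matrices
    in sp about the [star] pairing. *)
Lemma wt_diff p q p0 q0 : p0 != q0 ->
    (forall t, wt t p - wt t q = wt t p0 - wt t q0) ->
  (p, q) = (p0, q0) \/ (p, q) = (star q0, star p0).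
Proof.
move=> pq0 W; have := W p0; rewrite wt_self.
case: (eqVneq p p0) => [pp0|pp0].
  left; congr (_, _) => //; apply: wt_inj => t; have := W t.
  by rewrite pp0 => /addrI/oppr_inj.
case: (eqVneq q (star p0)) => [qp0|qp0].
  right; congr (_, _) => //; apply: wt_inj => t; have := W t.
  by rewrite qp0 wt_star opprK [RHS]addrC => /addIr ->; rewrite wt_star.
(* At [t = p0] the left side is now at most 0 and the right side at least 1. *)
rewrite /wt (negPf pp0) (negPf qp0) [q0 == p0]eq_sym (negPf pq0) !sub0r subr0 opprK.
move=> e; suff : (1 + (q0 == star p0) + (p == star p0) + (q == p0))%:R == 0 :> F.
  by rewrite pnatr_eq0.
by rewrite !natrD -e; apply/eqP; ring.
Qed.

Definition odd_diag (d : 'I_(n + n) -> F) : 'M[F]_(n + n) := diag_mx (\row_p d p).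

Lemma odd_diag_levi d : (forall p, d (star p) = - d p) -> odd_diag d \in L.
Proof.
move=> dS; apply/mem_levi; split.
  apply/spP => p q; rewrite !mxE (inj_eq (@star_inj n)) eq_sym.
  case: eqP => [->|_]; last by rewrite !mulr0n mulr0.
  by rewrite !mulr1n dS sgM mulN1r.
by move=> p q; rewrite !mxE; case: (eqVneq p q) => [->|]; rewrite ?eqxx ?mulr0n.
Qed.

Lemma lie_odd_diag d X : lie (odd_diag d) X = hadamard (fun p q => d p - d q) X.
Proof.
apply/matrixP => p q; rewrite /lie !mxE (bigD1 p) //= !mxE eqxx mulr1n big1 ?addr0.
  rewrite (bigD1 q) //= !mxE eqxx mulr1n big1 ?addr0; first by ring.
  by move=> t /negPf tq; rewrite !mxE tq mulr0n mulr0.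
by move=> t /negPf tp; rewrite !mxE eq_sym tp mulr0n mul0r.
Qed.

(* The second sum contributes only when [p = star r], and then with the same
   sign as the first one. *)
Lemma bracket_entry X Y p q r : X \in sp -> Y \in sp ->
    p != q -> q != r ->  p != r ->
    (forall s t, X s t != 0 -> (s, t) = (p, q) \/ (s, t) = (star q, star p)) ->
    (forall s t, Y s t != 0 -> (s, t) = (q, r) \/ (s, t) = (star r, star q)) ->
    X p q != 0 -> Y q r != 0 ->
  lie X Y p r != 0.
Proof.
move=> /spP Xs /spP Ys pq qr pr XS YS Xpq Yqr.
have -> : lie X Y p r = X p q * Y q r - Y p (star q) * X (star q) r.
  rewrite /lie !mxE; congr (_ - _).
    rewrite (bigD1 q) //= big1 ?addr0 // => t tq.
    case: (eqVneq (X p t) 0) => [->|/XS[[e]|[-> e]]]; first by rewrite mul0r.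
      by rewrite e eqxx in tq.
    by rewrite e starK eqxx in tq.
  rewrite (bigD1 (star q)) //= big1 ?addr0 // => t tq.
  case: (eqVneq (Y p t) 0) => [->|/YS[[e]|[_ e]]]; first by rewrite mul0r.
    by rewrite e eqxx in pq.
  by rewrite e eqxx in tq.
case: (eqVneq p (star r)) => [e|pr'].
  have rE : r = star p by rewrite e starK.
  have -> : X (star q) r = - (sg p * sg q) * X p q by rewrite {1}rE Xs.
  have -> : Y p (star q) = - (sg q * sg r) * Y q r by rewrite {1}e Ys.
  have -> : sg r = - sg p :> F by rewrite rE sg_star.
  rewrite [X in X != 0](_ : _ = X p q * Y q r * (1 + (sg q * sg q) * (sg p * sg p))).
    by rewrite !sgM mulr1 !mulf_neq0 // two_neq0.
  by ring.
have -> : Y p (star q) = 0.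
  apply/eqP; apply: contraNT pr' => /YS[[e]|[-> //]].
  by rewrite e eqxx in pq.
by rewrite mul0r subr0 mulf_neq0.
Qed.

(** A root vector of sp. For [q = star p], a long root, the two terms coincide and add up to twice a
    matrix unit. *)
Definition root_mx p q : 'M[F]_(n + n) :=
  delta_mx p q - (sg p * sg q) *: delta_mx (star q) (star p).

Lemma root_mx_sp p q : root_mx p q \in sp.
Proof.
apply/spP => s t; rewrite !mxE !eq_star !starK [(t == _) && _]andbC [(t == q) && _]andbC.
have e1 : (s == p) && (t == q) -> sg s * sg t = sg p * sg q :> F.
  by case/andP => /eqP-> /eqP->.
have e2 : (s == star q) && (t == star p) -> sg s * sg t = sg p * sg q :> F.
  by case/andP => /eqP-> /eqP->; rewrite !sg_star; ring.
have cc : (sg p * sg q) * (sg p * sg q) = 1 :> F.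
  by rewrite mulrACA !sgM mulr1.
case: (boolP (_ && _)) e2 => [_ /(_ isT)|_ _]; case: (boolP (_ && _)) e1 => [_ /(_ isT)|_ _] //=.
- by move=> _ ->; rewrite mulr1 mulNr mulrBr mulr1 cc opprB.
- by move=> ->; rewrite mulr0 mulr1 !sub0r mulrN mulNr opprK cc subr0.
- by move=> ->; rewrite mulr0 mulr1 !subr0 sub0r mulr1.
- by rewrite !mulr0 subr0 mulr0.
Qed.

Lemma root_mx_neq0 p q : p != q -> root_mx p q p q != 0.
Proof.
move=> pq; rewrite !mxE !eqxx /=.
case: (eqVneq q (star p)) => [->|_]; last by rewrite andbF mulr0 subr0 oner_eq0.
by rewrite starK eqxx sg_star mulrN sgM mulNr opprK mulr1 two_neq0.
Qed.

Lemma root_mx_supp p q s t : root_mx p q s t != 0 ->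
  (s, t) = (p, q) \/ (s, t) = (star q, star p).
Proof.
rewrite !mxE; case: (boolP ((s == p) && _)) => [/andP[/eqP-> /eqP->]|_]; first by left.
case: (boolP (_ && _)) => [/andP[/eqP-> /eqP->]|_]; first by right.
by rewrite mulr0 subr0 eqxx.
Qed.

Lemma root_mx_levi p q : lab p = lab q -> root_mx p q \in L.
Proof.
move=> pq; apply/mem_levi; split; first exact: root_mx_sp.
move=> s t st; apply/eqP; apply: contraNT st => /root_mx_supp[[-> ->]|[-> ->]].
  by rewrite pq.
by rewrite !levi_label_star pq.
Qed.

End RootComponents.

(** * Nilradicals of parabolic subalgebras with Levi factor l *)

Section Nilradical.
Variables (F : numFieldType) (n a : nat) (b : seq nat).
Implicit Types (p q r s t : 'I_(n + n)) (X Y : 'M[F]_(n + n)).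
Local Notation lab := (@levi_label n a b).
Local Notation L := (@levi F n a b).
Local Notation sp := (@sp F n).

Variables (P U : {vspace 'M[F]_(n + n)}).
Hypotheses (P_sp : (P <= sp)%VS) (U_ideal : lie_ideal P U).
Hypotheses (LUP : (L + U)%VS = P) (LU0 : (L :&: U)%VS = 0%VS).

Let L_P X : X \in L -> X \in P.
Proof. by move=> XL; rewrite -LUP -[X]addr0 memv_add ?mem0v. Qed.

Let U_P X : X \in U -> X \in P.
Proof. by apply: subvP; case: U_ideal. Qed.

Let U_sp X : X \in U -> X \in sp.
Proof. by move=> /U_P; apply: subvP. Qed.

Let LU X : X \in L -> X \in U -> X = 0.
Proof. by move=> XL XU; apply/eqP; rewrite -memv0 -LU0 memv_cap XL. Qed.

(** The diagonal Cartan subalgebra lies in [L], hence in [P], and [U] is an ideal of [P]; so [U]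
    contains the weight components of its elements. *)
Lemma nilradical_component p0 q0 X : X \in U ->
  (\matrix_(p, q) if all (fun t => wt F t p - wt F t q == wt F t p0 - wt F t q0)
     (enum 'I_(n + n)) then X p q else 0) \in U.
Proof.
apply: (@hadamard_components _ _ U _ _ (fun t p q => wt F t p - wt F t q)).
move=> t Y YU; rewrite -lie_odd_diag; case: U_ideal => _; apply=> //.
by apply/L_P/odd_diag_levi => p; rewrite wt_star.
Qed.

Lemma nilradical_root p q X : X \in U -> p != q -> X p q != 0 ->
  exists2 Y, Y \in U & Y p q != 0 /\
    forall s t, Y s t != 0 -> (s, t) = (p, q) \/ (s, t) = (star q, star p).
Proof.
move=> XU pq Xpq; eexists; first exact: (nilradical_component p q XU).
split; first by rewrite mxE; case: allP => // -[].
move=> s t; rewrite mxE; case: allP => [W _|]; last by rewrite eqxx.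
by apply: (wt_diff (F := F) pq) => u; apply/eqP/W; rewrite mem_enum.
Qed.

(** An entry inside a block would put a nonzero weight component of [U] into [L]: a root vector of
    [L] if [p != q], a diagonal matrix if [p = q]. *)
Lemma nilradical_off_levi p q X : X \in U -> lab p = lab q -> X p q = 0.
Proof.
move=> XU lpq; apply/eqP/negPn/negP => Xpq.
case: (eqVneq p q) => [e|pq]; last first.
  have [Y YU [Ypq YS]] := nilradical_root XU pq Xpq.
  suff Y0 : Y = 0 by rewrite Y0 mxE eqxx in Ypq.
  apply: LU => //; apply/mem_levi; split; first exact: U_sp.
  move=> s t st; apply/eqP; apply: contraNT st => /YS[[-> ->]|[-> ->]].
    by rewrite lpq.
  by rewrite !levi_label_star lpq.
move: Xpq; rewrite -{q lpq}e => Xpp.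
have := nilradical_component p p XU; set Y := matrix_of_fun _ _ => YU.
have Yoff s t : s != t -> Y s t = 0.
  move=> /eqP st; rewrite mxE; case: allP => // W; case: st.
  apply: (@wt_inj F) => u; apply/eqP; rewrite -subr_eq0.
  by rewrite (eqP (W u _)) ?mem_enum // subrr.
suff Y0 : Y = 0.
  move/matrixP/(_ p p): Y0; rewrite mxE; case: allP => [_|[]]; last by [].
  by rewrite mxE; apply/eqP.
apply: LU => //; apply/mem_levi; split; first exact: U_sp.
by move=> s t st; apply: Yoff; apply: contraNneq st => ->.
Qed.

(** The support of [U]. It is shown to be a strict order on the indices, compatible with the labels
    and reversed by [star]. *)
Definition nil_rel p q : bool := `[< exists2 X, X \in U & X p q != 0 >].

Lemma nil_relP p q : reflect (exists2 X, X \in U & X p q != 0) (nil_rel p q).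
Proof. exact: asboolP. Qed.

Lemma nil_rel_label p q : nil_rel p q -> lab p != lab q.
Proof.
case/nil_relP => X XU; apply: contra => /eqP lpq.
by rewrite (nilradical_off_levi XU lpq).
Qed.

Lemma nil_rel_neq p q : nil_rel p q -> p != q.
Proof. by move/nil_rel_label; apply: contra => /eqP->. Qed.

Lemma nil_rel_root p q : nil_rel p q ->
  exists2 Y, Y \in U & Y p q != 0 /\
    forall s t, Y s t != 0 -> (s, t) = (p, q) \/ (s, t) = (star q, star p).
Proof.
by move=> pq; have /nil_relP[X XU Xpq] := pq; apply: nilradical_root XU _ Xpq; apply: nil_rel_neq.
Qed.

Lemma nil_rel_star p q : nil_rel p q -> nil_rel (star q) (star p).
Proof.
case/nil_relP => X XU Xpq; apply/nil_relP; exists X => //.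
have /spP -> := U_sp XU; rewrite mulf_neq0 // oppr_eq0.
by apply/eqP => e; have := congr1 (fun z => z * z) e;
  rewrite mulrACA !sgM mulr0 mulr1 => /eqP; rewrite oner_eq0.
Qed.

(** The bracket of two opposite root vectors would be an element of [U] with a nonzero diagonal
    entry. *)
Lemma nil_rel_antisym p q : nil_rel p q -> nil_rel q p -> False.
Proof.
move=> pq qp; have [X XU [Xpq XS]] := nil_rel_root pq.
have [Y YU [Yqp YS]] := nil_rel_root qp.
have pq' := nil_rel_neq pq.
have ZU : lie X Y \in U by case: U_ideal => _; apply=> //; apply: U_P.
have := nilradical_off_levi ZU (erefl (lab p)); rewrite /lie !mxE (bigD1 q) //=.
rewrite big1 => [|t tq]; last first.
  case: (eqVneq (X p t) 0) => [->|/XS[[e]|[-> e]]]; first by rewrite mul0r.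
    by rewrite e eqxx in tq.
  by rewrite e starK eqxx in tq.
rewrite big1 => [|t _]; last first.
  case: (eqVneq (Y p t) 0) => [->|/YS[[e]|[/eqP e]]]; first by rewrite mul0r.
    by rewrite e eqxx in pq'.
  by rewrite eq_sym (negPf (star_neq p)) in e.
by rewrite subr0 addr0 => /eqP; apply/negP/mulf_neq0.
Qed.

Lemma nil_rel_trans p q r : nil_rel p q -> nil_rel q r -> nil_rel p r.
Proof.
move=> pq qr; have [X XU [Xpq XS]] := nil_rel_root pq.
have [Y YU [Yqr YS]] := nil_rel_root qr.
case: (eqVneq p r) => [pr|pr]; first by case: (nil_rel_antisym pq); rewrite pr.
apply/nil_relP; exists (lie X Y); first by case: U_ideal => _; apply=> //; apply: U_P.
by apply: (bracket_entry (q := q) _ _ _ _ _ XS YS) => //; rewrite ?U_sp ?nil_rel_neq.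
Qed.

(** Bracketing with a root vector of [L] moves an index within its label. *)
Lemma nil_rel_labell p p' q : lab p = lab p' -> nil_rel p q -> nil_rel p' q.
Proof.
move=> pp' pq; have [X XU [Xpq XS]] := nil_rel_root pq.
case: (eqVneq p' p) => [->//|p'p].
have p'q : p' != q.
  by have := nil_rel_label pq; rewrite pp'; apply: contra => /eqP->.
apply/nil_relP; exists (lie (root_mx F p' p) X).
  by case: U_ideal => _; apply=> //; apply/L_P/root_mx_levi.
apply: (bracket_entry (q := p) _ _ _ _ _ _ XS) => //;
  [exact: root_mx_sp | exact: U_sp | exact: nil_rel_neq | exact: root_mx_supp
  | exact: root_mx_neq0].
Qed.

Lemma nil_rel_labelr p q q' : lab q = lab q' -> nil_rel p q -> nil_rel p q'.
Proof.
move=> qq' /nil_rel_star pq; rewrite -[p]starK -[q']starK; apply: nil_rel_star.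
by apply: nil_rel_labell pq; rewrite !levi_label_star qq'.
Qed.

(** Predecessors minus successors: strictly increasing for the order, constant on labels, and odd
    because [star] reverses the order. *)
Definition height0 p : int :=
  #|[set q | nil_rel q p]|%:Z - #|[set q | nil_rel p q]|%:Z.

Lemma height0_star p : height0 (star p) = - height0 p.
Proof.
rewrite /height0 opprB; congr (Posz _ - Posz _);
  rewrite -(card_preimset _ (@star_inj n)); apply: eq_card => q; rewrite !finset.in_set;
  apply/idP/idP => /nil_rel_star; rewrite ?starK //.
Qed.

Lemma height0_label p q : lab p = lab q -> height0 p = height0 q.
Proof.
move=> pq; rewrite /height0; congr (Posz _ - Posz _); apply: eq_card => r; rewrite !finset.in_set.
  by apply/idP/idP; apply: nil_rel_labelr; rewrite pq.
by apply/idP/idP; apply: nil_rel_labell; rewrite pq.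
Qed.

Lemma height0_lt p q : nil_rel p q -> height0 p < height0 q.
Proof.
move=> pq; rewrite /height0.
have lt1 : (#|[set r | nil_rel r p]| < #|[set r | nil_rel r q]|)%N.
  apply/proper_card/properP; split.
    by apply/fintype.subsetP => r; rewrite !finset.in_set => rp; apply: nil_rel_trans pq.
  by exists p; rewrite !finset.in_set //; apply/negP => /nil_rel_neq; rewrite eqxx.
have le2 : (#|[set r | nil_rel q r]| <= #|[set r | nil_rel p r]|)%N.
  apply/subset_leq_card/fintype.subsetP => r; rewrite !finset.in_set; exact: (nil_rel_trans pq).
lia.
Qed.

(** The second summand separates labels with equal [height0]. The factor exceeds twice its absolute
    value, so strict inequalities between values of [height0] persist. *)
Definition height p : int :=
  2 * (\max_q (lab q).1).+1%:Z * height0 p + signed_label (lab p).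

Lemma height_star p : height (star p) = - height p.
Proof. by rewrite /height height0_star signed_label_star; ring. Qed.

Lemma signed_label_bound p : `|signed_label (lab p)| <= (\max_q (lab q).1)%:Z.
Proof.
rewrite (_ : `|_| = (lab p).1%:Z); last by rewrite /signed_label; case: ifP => _; lia.
by rewrite lez_nat; apply: (leq_bigmax (F := fun q => (lab q).1)).
Qed.

Lemma height_label p q : (height p = height q) <-> (lab p = lab q).
Proof.
split=> [|e]; last by rewrite /height (height0_label e) e.
have := signed_label_bound p; have := signed_label_bound q.
rewrite /height; set m := bigop _ _ _ => lq lp e; apply: signed_label_inj.
have [e0|ne] := eqVneq (height0 p) (height0 q).
  by move: e; rewrite e0; apply: addrI.
exfalso; move: lq lp e ne; move: (height0 p) (height0 q) (signed_label _) (signed_label _).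
move=> x y u v lq lp e /eqP ne.
have d : 2 * m.+1%:Z * (x - y) = v - u by rewrite mulrBr; lia.
by have [xy|xy] : x - y >= 1 \/ x - y <= -1; [lia | nia | nia].
Qed.

Lemma height_lt p q : nil_rel p q -> height p < height q.
Proof.
move=> pq; have := height0_lt pq.
have := signed_label_bound p; have := signed_label_bound q.
rewrite /height; set m := bigop _ _ _.
move: (height0 p) (height0 q) (signed_label _) (signed_label _) => x y u v; nia.
Qed.

Lemma nilradical_upper : (U <= upper F height)%VS.
Proof.
apply/subvP => X XU; apply/mem_upper; split; first exact: U_sp.
by move=> p q Xpq; apply/height_lt/nil_relP; exists X.
Qed.

Lemma lie_sp X Y : X \in sp -> Y \in sp -> lie X Y \in sp.
Proof.
rewrite !mem_sp !addr_eq0 => /eqP Xs /eqP Ys.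
have e (A B : 'M_(n + n)) : A^T *m sympJ = - (sympJ *m A) ->
    B^T *m sympJ = - (sympJ *m B) -> (A *m B)^T *m sympJ = sympJ *m B *m A.
  by move=> As Bs; rewrite trmx_mul -[LHS]mulmxA As mulmxN mulmxA Bs mulNmx opprK.
by rewrite /lie linearB /= mulmxBl !e // mulmxBr !mulmxA opprB.
Qed.

Lemma levi_upper X Y : X \in L -> Y \in upper F height -> lie X Y \in upper F height.
Proof.
move=> /mem_levi[Xs XL] /mem_upper[Ys YU]; apply/mem_upper; split; first exact: lie_sp.
have hX p q : X p q != 0 -> height p = height q.
  by move=> Xpq; apply/height_label/eqP; apply: contraNT Xpq => /XL->.
move=> p q; apply: contra_neqT => npq; rewrite !mxE !big1 ?subr0 // => t _.
  case: (eqVneq (Y p t) 0) => [->|Ypt]; first by rewrite mul0r.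
  case: (eqVneq (X t q) 0) => [->|Xtq]; first by rewrite mulr0.
  by case/negP: npq; rewrite -(hX _ _ Xtq); apply: YU.
case: (eqVneq (X p t) 0) => [->|Xpt]; first by rewrite mul0r.
case: (eqVneq (Y t q) 0) => [->|Ytq]; first by rewrite mulr0.
by case/negP: npq; rewrite (hX _ _ Xpt); apply: YU.
Qed.

(** This filtration by height gap shows that the derived series of [upper F height] reaches 0. *)
Definition layer (d : nat) : {vspace 'M[F]_(n + n)} :=
  sp_pattern F (fun p q => height p + d%:Z <= height q).

Lemma lie_layer d e X Y : X \in layer d -> Y \in layer e -> lie X Y \in layer (d + e).
Proof.
move=> /mem_sp_pattern[Xs XU] /mem_sp_pattern[Ys YU]; apply/mem_sp_pattern.
split; first exact: lie_sp.
move=> p q; apply: contra_neqT => npq; rewrite !mxE !big1 ?subr0 // => t _.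
  case: (eqVneq (Y p t) 0) => [->|Ypt]; first by rewrite mul0r.
  case: (eqVneq (X t q) 0) => [->|Xtq]; first by rewrite mulr0.
  by case/negP: npq; have := XU _ _ Xtq; have := YU _ _ Ypt; lia.
case: (eqVneq (X p t) 0) => [->|Xpt]; first by rewrite mul0r.
case: (eqVneq (Y t q) 0) => [->|Ytq]; first by rewrite mulr0.
by case/negP: npq; have := XU _ _ Xpt; have := YU _ _ Ytq; lia.
Qed.

Lemma layerS d e : (d <= e)%N -> (layer e <= layer d)%VS.
Proof.
move=> de; apply/subvP => X /mem_sp_pattern[Xs XU]; apply/mem_sp_pattern.
by split=> // p q /XU; lia.
Qed.

Lemma upper_layer : upper F height = layer 1.
Proof.
apply/vspaceP => X; apply/idP/idP => [/mem_upper[Xs XU]|/mem_sp_pattern[Xs XU]].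
  by apply/mem_sp_pattern; split=> // p q /XU; lia.
by apply/mem_upper; split=> // p q /XU; lia.
Qed.

Lemma derived_layer m : (derived m (layer 1) <= layer m.+1)%VS.
Proof.
elim: m => [|m IH] /=; first exact: subvv.
apply: subv_trans (lie_spanS IH IH) _.
apply: lie_span_sub => X Y XU YU; apply: subvP (lie_layer XU YU).
by apply: layerS; lia.
Qed.

Lemma layer_eq0 : exists d, layer d = 0%VS.
Proof.
pose M : int := \sum_p `|height p|.
have hM p : `|height p| <= M.
  by rewrite /M (bigD1 p) //= lerDl sumr_ge0.
exists (absz (2 * M + 1)); apply/eqP; rewrite -subv0; apply/subvP => X.
move=> /mem_sp_pattern[_ XU]; rewrite memv0; apply/eqP/matrixP => p q.
rewrite mxE; apply/eqP; apply: contraT => /XU; have := hM p; have := hM q; lia.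
Qed.

Hypothesis (P_borel : exists2 B, borel sp B & (B <= P)%VS).

(** [U] lies in the triangular algebra N of [height], which [P] normalizes. So B + N is a solvable
    subalgebra, it equals B by maximality, and N lies in P = L + U. The [L] component of an element
    of N is again in N; but elements of [L] only connect indices of equal height, so it is 0. *)
Lemma nilradicalE : U = upper F height.
Proof.
have [B [B_sp B_alg [m B_solv] B_max] BP] := P_borel.
have UN := nilradical_upper.
have PN X Y : X \in P -> Y \in upper F height -> lie X Y \in upper F height.
  rewrite -LUP => /memv_addP[l lL [u uU ->]] YN; rewrite lieDl; apply: memvD; first exact: levi_upper.
  rewrite upper_layer; apply: (subvP (layerS (isT : 1 <= 2)%N)).
  by apply: (lie_layer (d := 1) (e := 1)); rewrite -upper_layer // (subvP UN).
have BN : {in B & upper F height, forall X Y, lie X Y \in upper F height}.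
  by move=> X Y /(subvP BP); apply: PN.
have N_alg : subalgebra (upper F height).
  move=> X Y; rewrite upper_layer => XN YN; apply: (subvP (layerS (isT : 1 <= 2)%N)).
  exact: (lie_layer XN YN).
have BNB : (B + upper F height)%VS = B.
  apply: B_max; first exact: addvSl.
  - rewrite subv_add B_sp; apply/subvP => X /mem_upper[] //.
  - move=> _ _ /memv_addP[x xB [u uN ->]] /memv_addP[y yB [v vN ->]].
    rewrite lieDl !lieDr -addrA memv_add ?B_alg //.
    apply: memvD; first exact: BN.
    by apply: memvD; [rewrite lieC memvN; apply: BN | apply: N_alg].
  - have [d ld0] := layer_eq0; exists (d + m)%N; rewrite iterD.
    apply/eqP; rewrite -subv0 -ld0.
    apply: subv_trans (derivedS d (derived_addv m B_alg BN N_alg)) _.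
    rewrite [derived m B]B_solv add0v upper_layer.
    by apply: subv_trans (derived_layer d) _; apply: layerS.
apply/vspaceP => X; apply/idP/idP => [/(subvP UN)//|XN].
have : X \in P by apply: (subvP BP); rewrite -BNB (subvP (addvSr _ _)).
rewrite -LUP => /memv_addP[l lL [u uU Xlu]].
have /mem_upper[_ lN] : l \in upper F height.
  have -> : l = X - u by rewrite Xlu addrK.
  by apply: memvB => //; apply: (subvP UN).
have /mem_levi[_ lD] := lL.
suff l0 : l = 0 by rewrite Xlu l0 add0r.
apply/matrixP => p q; rewrite mxE; apply/eqP; apply: contraT => lpq.
have := lN p q lpq; rewrite (_ : height p = height q) ?ltxx //.
by apply/height_label/eqP; apply: contraNT lpq => /lD->.
Qed.

End Nilradical.

Section Polynomials.
Variables (F : numFieldType).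

Definition mxpoly_comp N m (f : {mpoly F[N * N]}) (M : 'M[{mpoly F[m]}]_N) :
    {mpoly F[m]} := f \mPo [tuple mxvec M 0 j | j < N * N].

Lemma meval_mxpoly_comp N m f (M : 'M[{mpoly F[m]}]_N) (v : 'I_m -> F) :
  (mxpoly_comp f M).@[v] = mxeval f (map_mx (meval v) M).
Proof.
rewrite comp_mpoly_meval; apply: meval_eq => j; rewrite tnth_mktuple.
by case/mxvec_indexP: j => i j; rewrite !mxvecE mxE.
Qed.

Definition generic_mx N : 'M[{mpoly F[N * N]}]_N := \matrix_(i, j) 'X_(mxvec_index i j).

Lemma meval_generic_mx N (X : 'M[F]_N) : map_mx (meval (mxvec X 0)) (generic_mx N) = X.
Proof. by apply/matrixP => i j; rewrite !mxE mevalXU mxvecE. Qed.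

Lemma mxeval_conj N (f : {mpoly F[N * N]}) (g h : 'M[F]_N) :
  exists f', forall X, mxeval f' X = mxeval f (g *m X *m h).
Proof.
exists (mxpoly_comp f (map_mx (@mpolyC _ F) g *m generic_mx N *m map_mx (@mpolyC _ F) h)).
move=> X; rewrite {1}/mxeval meval_mxpoly_comp !map_mxM /= meval_generic_mx.
by rewrite -!map_mx_comp !map_mx_id // => x; rewrite /= mevalC.
Qed.

End Polynomials.

Section Induced.
Variables (F : numFieldType) (n a : nat) (b : seq nat).

(** Density of the orbit in [U] carries the vanishing from [O] to the saturation of [U]; for the
    converse a single point of [O] in [U] suffices, since [O] is one orbit. *)
Lemma induced_zero_orbit_upper (O : set 'M[F]_(n + n)) :
    induced_zero_orbit (levi n a b) O ->
  exists ht : 'I_(n + n) -> int, [/\ forall p, ht (star p) = - ht p,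
    forall p q, ht p = ht q <-> levi_label a b p = levi_label a b q &
    forall f, (forall X, O X -> mxeval f X = 0) <->
              (forall X, upper_conj ht X -> mxeval f X = 0)].
Proof.
move=> [[X0 [X0s _ OE]] [P [U [[[P_sp P_alg P_borel] [U_ideal _ _] _ [LUP LU0]]]]]] [_ Ud].
exists (height a b U); split; [exact: height_star P_sp U_ideal | exact: height_label P_sp U_ideal LUP LU0 | ].
have UE : U = upper F (height a b U) by apply: nilradicalE P_borel.
move=> f; split=> fO.
  move=> _ [g [X [gS XU ->]]].
  have [f' f'E] := mxeval_conj f g (invmx g); rewrite -f'E.
  apply: (Ud X); first by rewrite /= UE.
  move=> Y [_ OY]; rewrite f'E; apply: fO; move: OY; rewrite OE => -[h hS ->].
  exists (g *m h); first exact: Sp_mul.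
  by rewrite invmxM ?Sp_unit // !mulmxA.
(* Otherwise the constant 1 would vanish on the dense part, hence at 0. *)
have [Y UY OY] : exists2 Y, Y \in U & O Y.
  apply: contrapT => nY; have := Ud 0 (mem0v _) 1; rewrite /mxeval meval1.
  have h : (vanishing_ideal ([set` U] `&` O)%classic 1).
    by move=> Y [UY OY]; case: nY; exists Y.
  by move=> /(_ h)/eqP; rewrite oner_eq0.
move=> X OX; apply: fO; move: OX OY; rewrite OE => -[g gS ->] [h hS YE].
exists (g *m invmx h), Y; split; first by apply: Sp_mul => //; apply: Sp_inv.
  by rewrite -UE.
have hu := Sp_unit hS; have gu := Sp_unit gS.
rewrite YE invmxM ?unitmx_inv // invmxK !mulmxA mulmxKV // -!mulmxA.
by rewrite [invmx h *m (h *m _)]mulmxA mulVmx // mul1mx.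
Qed.

End Induced.

(** * Tanisaki ideals *)

Section IdealGen.
Variables (F : fieldType) (n : nat) (S : set {mpoly F[n]}).
Implicit Types f g : {mpoly F[n]}.

Lemma ideal_gen0 : ideal_gen S 0.
Proof. by exists [::]; rewrite big_nil. Qed.

Lemma ideal_genD f g : ideal_gen S f -> ideal_gen S g -> ideal_gen S (f + g).
Proof.
move=> [s [sS ->]] [t [tS ->]]; exists (s ++ t); rewrite big_cat; split=> // x.
by rewrite mem_cat => /orP[/sS|/tS].
Qed.

Lemma ideal_genM c f : ideal_gen S f -> ideal_gen S (c * f).
Proof.
move=> [s [sS ->]]; exists [seq (c * x.1, x.2) | x <- s]; split.
  by move=> _ /mapP[x /sS xS ->].
by rewrite big_map mulr_sumr; apply: eq_bigr => x _; rewrite mulrA.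
Qed.

Lemma ideal_gen_mem f : S f -> ideal_gen S f.
Proof.
move=> Sf; exists [:: (1, f)]; rewrite big_seq1 mul1r; split=> // x.
by rewrite inE => /eqP->.
Qed.

Lemma ideal_genB f g : ideal_gen S f -> ideal_gen S g -> ideal_gen S (f - g).
Proof. by move=> Sf Sg; rewrite -mulN1r; apply/ideal_genD/ideal_genM. Qed.

(* An ideal is given here by its closure properties, as a predicate. *)
Lemma ideal_gen_ind (P : {mpoly F[n]} -> Prop) :
    P 0 -> (forall f g, P f -> P g -> P (f + g)) -> (forall c f, S f -> P (c * f)) ->
  forall f, ideal_gen S f -> P f.
Proof.
move=> P0 PD PM f [s [sS ->]].
rewrite big_seq; elim/big_rec: _ => // x g /sS xS; apply: PD; exact: PM.
Qed.

End IdealGen.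

Section Esym.
Variables (F : numFieldType) (n : nat).
Implicit Types (L : {set 'I_n}) (v i : 'I_n).

Definition sqX i : {mpoly F[n]} := 'X_i ^+ 2.

Definition sq_poly L : {poly {mpoly F[n]}} := \prod_(i in L) ('X - (sqX i)%:P).

(** Being 0 for p > |L|, it satisfies the Pascal rule [esqS] for all p. *)
Definition esq L p : {mpoly F[n]} :=
  if (p <= #|L|)%N then (-1) ^+ p * (sq_poly L)`_(#|L| - p) else 0.

Lemma sq_poly_monic L : sq_poly L \is monic.
Proof. by apply: monic_prod => i _; apply: monicXsubC. Qed.

Lemma size_sq_poly L : size (sq_poly L) = #|L|.+1.
Proof. by rewrite /sq_poly -big_enum /= size_prod_XsubC cardE. Qed.

Lemma esym_sqE L p : (p <= #|L|)%N -> esym_sq L p = esq L p.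
Proof.
move=> pl; rewrite /esq pl.
set cs := [tuple 'X_(enum_val i) ^+ 2 : {mpoly F[n]} | i < #|L|].
have -> : sq_poly L = \prod_(c <- cs) ('X - c%:P).
  rewrite big_tuple /sq_poly big_enum_val; apply: eq_bigr => i _.
  by rewrite tnth_mktuple.
have lt_pl : (p < #|L|.+1)%N by [].
have := mroots_coeff cs (Ordinal lt_pl); rewrite /= => ->.
rewrite mulrA -exprMn mulrNN mulr1 expr1n mul1r /esym_sq /mesym !rmorph_sum /=.
apply: eq_bigr => h _; rewrite !rmorph_prod /=; apply: eq_bigr => i _.
by rewrite comp_mpolyXU mevalXU (tnth_nth 0).
Qed.

Lemma esq_gt L p : (#|L| < p)%N -> esq L p = 0.
Proof. by move=> lp; rewrite /esq leqNgt lp. Qed.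

Lemma esq0 L : esq L 0 = 1.
Proof.
rewrite /esq subn0 expr0 mul1r; have /monicP := sq_poly_monic L.
by rewrite lead_coefE size_sq_poly.
Qed.

Lemma esqS L v p : v \notin L -> esq (v |: L) p.+1 = esq L p.+1 + sqX v * esq L p.
Proof.
move=> vL; rewrite /esq cardsU1 vL add1n ltnS.
have -> : sq_poly (v |: L) = ('X - (sqX v)%:P) * sq_poly L.
  by rewrite /sq_poly big_setU1.
case: (leqP p #|L|) => pl; last by rewrite leqNgt ltnS (ltnW pl) /= mulr0 addr0.
rewrite subSS mulrBl coefB coefXM coefCM subn_eq0.
case: (ltnP p #|L|) => pl'; last first.
  by rewrite sub0r exprS add0r; ring.
rewrite -subnS mulrBr exprS; ring.
Qed.

Lemma esq_coef L q : (q <= #|L|)%N ->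
  (sq_poly L)`_q = (-1) ^+ (#|L| - q) * esq L (#|L| - q).
Proof.
move=> ql; rewrite /esq leq_subr subKn // mulrA -exprMn mulrNN mulr1 expr1n.
by rewrite mul1r.
Qed.

Lemma finset_ind (T : finType) (P : {set T} -> Prop) :
  P finset.set0 -> (forall (v : T) (A : {set T}), v \notin A -> P A -> P (v |: A)) -> forall A, P A.
Proof.
move=> P0 PU A; have [m] := ubnP #|A|; elim: m A => // m IH A.
case: (set_0Vmem A) => [-> //|[v vA]]; rewrite ltnS -(finset.setD1K vA) => Am.
apply: PU; first by rewrite !inE eqxx.
by apply: IH; rewrite cardsU1 !inE eqxx in Am.
Qed.

Lemma sqX_homog i : sqX i \is 2.-homog.
Proof.
have h : ('X_i : {mpoly F[n]}) \is 1.-homog by rewrite dhomogX /= mdeg1.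
exact: (dhomogMn 2 h).
Qed.

Lemma esq_homog L p : esq L p \is (2 * p).-homog.
Proof.
elim/finset_ind: L p => [|v L vL IH] [|p]; rewrite ?esq0 ?muln0 ?dhomog1 //.
  by rewrite esq_gt ?cards0 // dhomog0.
rewrite esqS //; apply: dhomogD; first exact: IH.
by rewrite mulnS; apply: dhomogM; [apply: sqX_homog | apply: IH].
Qed.

End Esym.

Section TanisakiIdeal.
Variables (F : numFieldType) (n k : nat).
Implicit Types (L : {set 'I_n}) (v i : 'I_n) (b : 'I_k -> nat) (f g : {mpoly F[n]}).

(* Half of the number [dpart] of the statement: the sum of the parts of the
   transpose of [b] with index at least [N - l]. *)
Definition excess N b l := (\sum_j (b j - (N - l)))%N.

Definition below N : {set 'I_n} := [set i : 'I_n | (i < N)%N].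

Lemma mem_below N i : (i \in below N) = (i < N)%N.
Proof. by rewrite finset.in_set. Qed.

Lemma card_below N : (N <= n)%N -> #|below N| = N.
Proof.
move=> Nn; rewrite -sum1dep_card -(big_ord_widen n (fun _ => 1%N) Nn).
by rewrite sum1_card card_ord.
Qed.

Lemma below_le N L : (N <= n)%N -> L \subset below N -> (#|L| <= N)%N.
Proof. by move=> Nn /subset_leq_card; rewrite card_below. Qed.

(** Only the first N of the n variables occur, so that the induction on N stays in one polynomial
    ring. Indices p > |L| contribute only 0. *)
Definition tan_gen N b : set {mpoly F[n]} :=
  [set f | exists L p, [/\ L \subset below N, (1 <= p)%N,
     (#|L| < p + excess N b #|L|)%N & f = esq F L p]].

Definition tan_ideal N b := ideal_gen (tan_gen N b).

Lemma excess_le N b l : (\sum_j b j)%N = N -> (l <= N)%N -> (excess N b l <= l)%N.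
Proof.
move=> bN lN; case: (ltnP 0 (excess N b l)) => [|/leq_trans->//].
rewrite /excess => /lt0n_neq0; rewrite sum_nat_eq0 => /forallPn[j].
rewrite implyTb => bj.
have : (\sum_j (b j - (N - l)) + (N - l) <= \sum_j b j)%N.
  rewrite (bigD1 j) //= [leqRHS](bigD1 j) //= addnAC leq_add ?subnK //.
    by rewrite ltnW // -subn_gt0 lt0n.
  by apply: leq_sum => i _; apply: leq_subr.
by rewrite bN; lia.
Qed.

Lemma esq_tan N b L p : L \subset below N -> (\sum_j b j)%N = N -> (N <= n)%N ->
  (#|L| < p + excess N b #|L|)%N -> tan_ideal N b (esq F L p).
Proof.
move=> LN bN Nn lt; apply: ideal_gen_mem; exists L, p; split=> //.
by have := excess_le bN (below_le Nn LN); lia.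
Qed.

(** Induction on [r] by y_v^2 e_p(L) = e_(p+1)(L + v) - e_(p+1)(L): the first term is a generator,
    the second has a larger index and needs one factor y_v^2 less. *)
Lemma tan_power N b L v r p : L \subset below N -> (N <= n)%N -> (\sum_j b j)%N = N ->
    v \in below N -> v \notin L ->
    (#|L|.+1 < p.+1 + excess N b #|L|.+1)%N ->
    (#|L| < p + r + excess N b #|L|)%N ->
  tan_ideal N b (sqX F v ^+ r * esq F L p).
Proof.
move=> LN Nn bN vN vL; have vLN : v |: L \subset below N by rewrite finset.subUset finset.sub1set vN.
elim: r p => [|r IH] p lt1 lt2; first by rewrite mul1r; apply: esq_tan => //; lia.
have -> : sqX F v ^+ r.+1 * esq F L p =
   sqX F v ^+ r * esq F (v |: L) p.+1 - sqX F v ^+ r * esq F L p.+1.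
  by rewrite esqS // exprS; ring.
apply: ideal_genB; last by apply: IH; lia.
by apply/ideal_genM/esq_tan => //; rewrite cardsU1 vL.
Qed.

Lemma excessS N b l : (l < N)%N ->
  excess N b l.+1 = (excess N b l + #|[set j | (N - l.+1 < b j)%N]|)%N.
Proof.
move=> lN; rewrite /excess -sum1dep_card [X in (_ + X)%N]big_mkcond -big_split /=.
by apply: eq_bigr => j _; case: ltnP; lia.
Qed.

(** With all the other variables as [L] and p = 0, the number of factors y_v^2 needed is the growth
    of the excess from N to N + 1, which is the number of nonempty rows. *)
Lemma sqX_tan N b v : (N.+1 <= n)%N -> (\sum_j b j)%N = N.+1 -> v = N :> nat ->
  tan_ideal N.+1 b (sqX F v ^+ #|[set j | (0 < b j)%N]|).
Proof.
move=> Nn bN vN; rewrite -[X in tan_ideal _ _ X]mulr1 -(esq0 F (below N)).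
have cN := card_below (ltnW Nn).
have eN : excess N.+1 b N.+1 = N.+1.
  by rewrite /excess subnn -[RHS]bN; apply: eq_bigr => j _; rewrite subn0.
apply: tan_power; rewrite ?mem_below ?vN ?ltnn ?cN ?eN //.
  by apply/fintype.subsetP => i; rewrite !mem_below; lia.
have := excessS b (ltnSn N); rewrite eN subnn; lia.
Qed.

(** The Tanisaki side of the removal of a cell from row [j]. If that cell is counted in the excess,
    e_p(L + v) = e_p(L) + y_v^2 e_(p-1)(L) is a generator for [b]. Otherwise the two excesses agree,
    and at most t factors y_v^2 carry e_p(L) into the ideal. *)
Lemma tan_step N b b' j v t f : (N.+1 <= n)%N -> (\sum_j b j)%N = N.+1 -> v = N :> nat ->
    b j = (b' j).+1 -> (forall i : 'I_k, i != j -> b i = b' i) ->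
    (#|[set i | (b j < b i)%N]| <= t)%N -> tan_ideal N b' f ->
  exists q, tan_ideal N.+1 b (sqX F v ^+ t * f - sqX F v ^+ t.+1 * q).
Proof.
move=> Nn bN vN bj bi ht.
move: f; apply: ideal_gen_ind => [|f g [q fq] [r gr]|c _ [L [p [LN p1 lt ->]]]].
- by exists 0; rewrite !mulr0 subrr; apply: ideal_gen0.
- exists (q + r); rewrite !mulrDr opprD addrACA; exact: ideal_genD.
have lN := below_le (ltnW Nn) LN.
have vL : v \notin L.
  by apply/negP => /(fintype.subsetP LN); rewrite mem_below vN ltnn.
have LN1 : L \subset below N.+1.
  apply: fintype.subset_trans LN _.
  by apply/fintype.subsetP => i; rewrite !mem_below; lia.
have vN1 : v \in below N.+1 by rewrite mem_below vN.
have ex : excess N.+1 b #|L|.+1 = (excess N b' #|L| + (N - #|L| < b j))%N.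
  rewrite /excess subSS (bigD1 j) //= [in RHS](bigD1 j) //= addnAC; congr (_ + _)%N.
    by rewrite bj; case: ltnP; lia.
  by apply: eq_bigr => i ij; rewrite bi.
suff [q hq] : exists q, tan_ideal N.+1 b
    (sqX F v ^+ t * esq F L p - sqX F v ^+ t.+1 * q).
  exists (c * q); have := ideal_genM c hq; congr (ideal_gen _ _); ring.
case: (ltnP (N - #|L|) (b j)) ex => [lt_b|le_b] ex.
  case: p p1 lt => // p _ lt; exists (- esq F L p).
  have -> : sqX F v ^+ t * esq F L p.+1 - sqX F v ^+ t.+1 * - esq F L p =
     sqX F v ^+ t * esq F (v |: L) p.+1 by rewrite esqS // exprS; ring.
  apply/ideal_genM/esq_tan => //; first by rewrite finset.subUset finset.sub1set vN1.
  by rewrite cardsU1 vL ex; lia.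
exists 0; rewrite mulr0 subr0.
have exS := excessS b (lN : (#|L| < N.+1)%N).
(* Here b j <= N - l with l = |L|, so the rows longer than N - l are among the at most t rows longer
   than row j. *)
have le_r : (#|[set i | (N.+1 - #|L|.+1 < b i)%N]| <= t)%N.
  apply: leq_trans ht; apply/subset_leq_card/fintype.subsetP => i.
  by rewrite !finset.in_set subSS; lia.
rewrite -(subnK le_r) exprD -mulrA; apply: ideal_genM.
by apply: tan_power => //; lia.
Qed.

End TanisakiIdeal.

(** * The ideal orthogonal to the staircase functionals *)

Lemma inj_lt_surj (T : finType) (C : {set T}) (f : T -> nat) (r : nat) :
    {in C &, injective f} -> {in C, forall u, (f u < #|C|)%N} ->
  (r < #|C|)%N -> exists2 u, u \in C & f u = r.
Proof.
move=> fi fC rC.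
have fu : uniq (map f (enum C)).
  by rewrite map_inj_in_uniq ?enum_uniq // => u v; rewrite !mem_enum; apply: fi.
have fs : {subset map f (enum C) <= iota 0 #|C|}.
  by move=> _ /mapP[u uC ->]; rewrite mem_iota add0n /= fC // -mem_enum.
have [|_ /(_ r)] := uniq_min_size fu fs; first by rewrite size_iota size_map -cardE.
by rewrite mem_iota add0n rC /= => /mapP[u]; rewrite mem_enum => uC ->; exists u.
Qed.

Section Staircase.
Variables (n N : nat) (col : 'I_n -> nat).
Implicit Types (i j u v : 'I_n) (s t : 'S_n) (m : 'X_{1..n}).

Definition crank u := #|[set v : 'I_n | (v < u)%N && (col v == col u)]|.

Definition stair u := if (u < N)%N then (2 * crank u).+1 else 0%N.

Definition colperm s := perm_on (below n N) s && [forall i, col (s i) == col i].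

Lemma colpermP s : reflect
  ((forall i, (N <= i)%N -> s i = i) /\ (forall i, col (s i) = col i)) (colperm s).
Proof.
apply: (iffP andP) => -[sN sc]; split.
- by move=> i Ni; apply: (out_perm sN); rewrite mem_below -leqNgt.
- by move=> i; apply/eqP; move/forallP: sc.
- apply/fintype.subsetP => i; rewrite inE mem_below ltnNge => si.
  by apply: contraNN si => /sN ->.
- by apply/forallP => i; rewrite sc.
Qed.

Lemma colperm_lt s i : colperm s -> (s i < N)%N = (i < N)%N.
Proof. by case/andP => sN _; have := perm_closed i sN; rewrite !mem_below. Qed.

Lemma colpermM s t : colperm s -> colperm t -> colperm (s * t)%g.
Proof.
move=> /colpermP[s1 s2] /colpermP[t1 t2]; apply/colpermP; split=> i => [Ni|].
  by rewrite permM s1 ?t1.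
by rewrite permM t2 s2.
Qed.

Lemma colpermV s : colperm s -> colperm s^-1%g.
Proof.
move=> /colpermP[s1 s2]; apply/colpermP; split=> i => [Ni|].
  by rewrite -{1}(s1 i Ni) permK.
by rewrite -s2 permKV.
Qed.

Lemma colpermMl s t : colperm s -> colperm (s * t)%g = colperm t.
Proof.
move=> sG; apply/idP/idP => [stG|]; last exact: colpermM.
by rewrite -[t](mulKg s); apply: colpermM => //; apply: colpermV.
Qed.

Lemma colperm1 : colperm 1%g.
Proof. by apply/colpermP; split=> i; rewrite perm1. Qed.

Lemma colperm_tperm i j : (i < N)%N -> (j < N)%N -> col i = col j -> colperm (tperm i j).
Proof.
move=> iN jN cij; apply/colpermP; split=> u => [Nu|].
  by rewrite tpermD //; apply: contraTneq Nu => <-; rewrite -ltnNge.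
by case: tpermP => // ->.
Qed.

Lemma crank_lt u v : col u = col v -> (u < v)%N -> (crank u < crank v)%N.
Proof.
move=> cuv uv; apply/proper_card/properP; split.
  apply/fintype.subsetP => w; rewrite !finset.in_set cuv => /andP[wu ->].
  by rewrite (ltn_trans wu uv).
by exists u; rewrite !finset.in_set ?uv ?cuv ?ltnn ?eqxx.
Qed.

Lemma crank_inj u v : col u = col v -> crank u = crank v -> u = v.
Proof.
move=> cuv ruv; apply/val_inj/eqP; case: (ltngtP u v) => // lt.
  by have := crank_lt cuv lt; rewrite ruv ltnn.
by have := crank_lt (esym cuv) lt; rewrite ruv ltnn.
Qed.

Definition column (c : nat) : {set 'I_n} := [set j : 'I_n | (j < N)%N && (col j == c)].

Lemma crank_column u : (u < N)%N -> (crank u < #|column (col u)|)%N.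
Proof.
move=> uN; apply/proper_card/properP; split.
  apply/fintype.subsetP => w; rewrite !finset.in_set => /andP[wu ->].
  by rewrite (ltn_trans wu uN).
by exists u; rewrite !finset.in_set ?uN ?ltnn ?eqxx.
Qed.

Lemma crank_surj c r : (r < #|column c|)%N -> exists2 u, u \in column c & crank u = r.
Proof.
apply: inj_lt_surj => [u v|u]; rewrite !finset.in_set.
  by move=> /andP[_ /eqP uc] /andP[_ /eqP vc]; apply: crank_inj; rewrite uc vc.
by case/andP=> uN /eqP <-; apply: crank_column.
Qed.

(** The values in a column are distinct and odd, so m_i is at least 2 r + 1, where r is the rank of
    m_i in its column. The ranks have the same total as the positions, so the bound on the sum
    forces equality everywhere. *)
Lemma staircase (m : 'I_n -> nat) :
    (forall i, (N <= i)%N -> m i = 0%N) -> (forall i, (i < N)%N -> odd (m i)) ->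
    (forall i j, (i < N)%N -> (j < N)%N -> col i = col j -> m i = m j -> i = j) ->
    (\sum_i m i <= \sum_i stair i)%N ->
  exists2 t, colperm t & forall i, m i = stair (t i).
Proof.
move=> m0 modd minj mle.
pose lt i j := [&& (i < N)%N, (j < N)%N, col i == col j & (m i < m j)%N].
pose mr i := #|[set j | lt j i]|.
have mr_le i : (i < N)%N -> (2 * mr i < m i)%N.
  move=> iN; have m_gt0 : (0 < m i)%N by apply: odd_gt0; apply: modd.
  suff : (mr i <= (m i)./2)%N.
    by have := odd_double_half (m i); rewrite modd //; lia.
  rewrite /mr; set A := [set j | _].
  rewrite cardE -(size_map (fun j => (m j)./2)) -[leqRHS](size_iota 0).
  have AE j : j \in enum A -> [/\ (j < N)%N, col j = col i & (m j < m i)%N].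
    by rewrite mem_enum finset.in_set => /and4P[? ? /eqP ? ?].
  apply: uniq_leq_size.
    rewrite map_inj_in_uniq ?enum_uniq // => u v /AE[uN uc _] /AE[vN vc _] uv.
    apply: minj; rewrite ?uc ?vc //.
    by rewrite -(odd_double_half (m u)) -(odd_double_half (m v)) uv !modd.
  move=> _ /mapP[j /AE[jN _ ji] ->]; rewrite mem_iota add0n /=.
  have := odd_double_half (m i); have := odd_double_half (m j); rewrite !modd //.
  by lia.
have cr_lt i : (i < N)%N -> crank i = (\sum_(j : 'I_n | [&& (j < N)%N, col j == col i & (j < i)%N]) 1)%N.
  move=> iN; rewrite /crank -sum1dep_card; apply: eq_bigl => j.
  case: (ltnP j i) => ji; rewrite ?andbF // andbT /=.
  by rewrite (ltn_trans ji iN).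
(* Doubled, both sums count the ordered pairs of distinct variables in a common column. *)
have sum_mr : (\sum_(i : 'I_n | (i < N)%N) mr i = \sum_(i : 'I_n | (i < N)%N) crank i)%N.
  have dbl_inj A B : (A + A = B + B)%N -> A = B by lia.
  apply: dbl_inj.
  transitivity (\sum_(i < n | (i < N)%N)
     \sum_(j < n | [&& (j < N)%N, col j == col i & j != i]) 1)%N.
    transitivity (\sum_(i < n | (i < N)%N) \sum_(j < n | (j < N)%N)
      ((col j == col i) && (m j < m i)) +
       \sum_(i < n | (i < N)%N) \sum_(j < n | (j < N)%N)
      ((col i == col j) && (m i < m j)))%N.
      congr (_ + _)%N; last rewrite exchange_big; apply: eq_bigr => i iN;
        rewrite /mr -sum1dep_card big_mkcond [RHS]big_mkcond /=; apply: eq_bigr => j _;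
        by rewrite /lt iN; case: (j < N)%N => //=; case: (_ && _).
    rewrite -big_split; apply: eq_bigr => i iN; rewrite -big_split /=.
    rewrite big_mkcond [RHS]big_mkcond; apply: eq_bigr => j _.
    case: (ltnP j N) => //= jN; rewrite [col i == _]eq_sym.
    case: eqP => //= cji; have [->|ji] := eqVneq j i; first by rewrite ltnn.
    case: ltngtP => // mij; case/eqP: ji; exact: minj.
  apply: esym; transitivity (\sum_(i < n | (i < N)%N) \sum_(j < n | (j < N)%N)
      ((col j == col i) && (j < i)) +
       \sum_(i < n | (i < N)%N) \sum_(j < n | (j < N)%N)
      ((col i == col j) && (i < j)))%N.
    congr (_ + _)%N; last rewrite exchange_big; apply: eq_bigr => i iN;
      rewrite cr_lt // big_mkcond [RHS]big_mkcond /=; apply: eq_bigr => j _;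
      by case: (j < N)%N => //=; case: (_ && _).
  rewrite -big_split; apply: eq_bigr => i iN; rewrite -big_split /=.
  rewrite big_mkcond [RHS]big_mkcond; apply: eq_bigr => j _.
  case: (ltnP j N) => //= jN; rewrite [col i == _]eq_sym.
  case: eqP => //= cji; have [->|ji] := eqVneq j i; first by rewrite ltnn.
  by case: ltngtP => // /val_inj mij; case/eqP: ji.
have mE i : (i < N)%N -> m i = (2 * mr i).+1.
  move=> iN; apply/eqP; rewrite eq_sym eqn_leq mr_le //= leqNgt; apply/negP => lt_i.
  move: mle; rewrite leqNgt => /negP; apply.
  rewrite (bigID (fun i : 'I_n => i < N)%N) /= [X in (_ + X)%N]big1 ?addn0; last first.
    by move=> j /negPf jN; rewrite /stair jN.
  rewrite [ltnRHS](bigID (fun i : 'I_n => i < N)%N) /=.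
  apply: leq_trans (leq_addr _ _).
  have -> : (\sum_(j < n | (j < N)%N) stair j = \sum_(j < n | (j < N)%N) (2 * mr j).+1)%N.
    rewrite (eq_bigr (fun j : 'I_n => 1 + 2 * crank j)%N); last first.
      by move=> j jN; rewrite /stair jN.
    rewrite [RHS](eq_bigr (fun j : 'I_n => 1 + 2 * mr j)%N) //.
    by rewrite !big_split /= sum_mr.
  rewrite (bigD1 i) //= [ltnRHS](bigD1 i) //= -addSn leq_add // leq_sum // => j.
  by case/andP => jN _; apply: mr_le.
have mr_col i : (i < N)%N -> (mr i < #|column (col i)|)%N.
  move=> iN; apply/proper_card/properP; split.
    by apply/fintype.subsetP => j; rewrite !finset.in_set => /and4P[-> _ -> _].
  by exists i; rewrite !finset.in_set ?iN ?eqxx // /lt ltnn !andbF.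
pose tf i := if (i < N)%N then odflt i [pick u in column (col i) | crank u == mr i] else i.
have tfP i : (i < N)%N -> [/\ (tf i < N)%N, col (tf i) = col i & crank (tf i) = mr i].
  move=> iN; rewrite /tf iN; case: pickP => [u|none] /=.
    by rewrite finset.in_set => /andP[/andP[? /eqP ?] /eqP].
  have [u uc ur] := crank_surj (mr_col i iN).
  by have := none u; rewrite uc ur eqxx.
have tfN i : (N <= i)%N -> tf i = i by rewrite /tf leqNgt => /negPf->.
have tf_inj : injective tf.
  move=> i j; case: (ltnP i N) => iN; case: (ltnP j N) => jN.
  - have [_ ci ri] := tfP i iN; have [_ cj rj] := tfP j jN => e.
    apply: minj => //; first by rewrite -ci e cj.
    by rewrite !mE // -ri -rj e.
  - by rewrite [tf j]tfN // => e; have [] := tfP i iN; rewrite e ltnNge jN.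
  - by rewrite [tf i]tfN // => e; have [] := tfP j jN; rewrite -e ltnNge iN.
  - by rewrite !tfN.
exists (perm tf_inj).
  apply/colpermP; split=> i => [Ni|]; rewrite permE; first exact: tfN.
  by case: (ltnP i N) => iN; [have [] := tfP i iN | rewrite tfN].
move=> i; rewrite permE; case: (ltnP i N) => iN.
  by have [tN _ tr] := tfP i iN; rewrite /stair tN tr mE.
by rewrite tfN // /stair ltnNge iN m0.
Qed.

Lemma stair_inj s t : colperm s -> colperm t ->
  (forall i, stair (s i) = stair (t i)) -> s = t.
Proof.
move=> sG tG e; apply/permP => i; have := e i.
have /colpermP[sN sc] := sG; have /colpermP[tN tc] := tG.
case: (ltnP i N) => iN; last by rewrite sN ?tN.
rewrite /stair !colperm_lt // iN => -[/eqP]; rewrite eqn_pmul2l // => /eqP.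
by apply: crank_inj; rewrite sc tc.
Qed.

End Staircase.

Section Functional.
Variables (F : numFieldType) (n N : nat) (col : 'I_n -> nat).
Implicit Types (i j u v : 'I_n) (s t : 'S_n) (m : 'X_{1..n}) (f g h : {mpoly F[n]}).
Local Notation stair := (stair N col).
Local Notation colperm := (colperm N col).

Definition stair_mnm s : 'X_{1..n} := [multinom stair (s i) | i < n].

Definition alt_coef h : F := \sum_(s | colperm s) (-1) ^+ s * h@_(stair_mnm s).

Fact alt_coef_is_linear : scalar alt_coef.
Proof.
move=> c f g; rewrite /alt_coef mulr_sumr -big_split; apply: eq_bigr => s _ /=.
by rewrite mcoeffD mcoeffZ mulrDr mulrCA.
Qed.

HB.instance Definition _ :=
  GRing.isLinear.Build F {mpoly F[n]} F _ alt_coef alt_coef_is_linear.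

Definition stair_deg := (\sum_i stair i)%N.

Lemma mdeg_stair s : mdeg (stair_mnm s) = stair_deg.
Proof.
rewrite mdegE /stair_deg [RHS](reindex_inj (@perm_inj _ s)); apply: eq_bigr => i _.
by rewrite mnmE.
Qed.

Lemma alt_coef_deg h : (forall m, mdeg m = stair_deg -> h@_m = 0) -> alt_coef h = 0.
Proof. by move=> h0; rewrite /alt_coef big1 // => s _; rewrite h0 ?mulr0 ?mdeg_stair. Qed.

Variable x : 'I_n -> F.
Hypotheses (x_out : forall i, (N <= i)%N -> x i = 0).
Hypotheses (x_neq0 : forall i, (i < N)%N -> x i != 0).
Hypotheses (x_inj : forall i j, (i < N)%N -> (j < N)%N -> col i = col j ->
  x i ^+ 2 = x j ^+ 2 -> i = j).

Definition alt_power (m : 'I_n -> nat) : F :=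
  \sum_(s | colperm s) (-1) ^+ s * \prod_i x (s i) ^+ m i.

Lemma alt_power_stair t : colperm t ->
  alt_power (fun i => stair (t i)) = (-1) ^+ t * alt_power stair.
Proof.
move=> tG; rewrite /alt_power [LHS](reindex_inj (mulgI t)) /=.
rewrite mulr_sumr; apply: eq_big => [s|s sG].
  exact: colpermMl.
rewrite odd_permM signr_addb -mulrA; congr (_ * (_ * _)).
rewrite [RHS](reindex_inj (@perm_inj _ t)); apply: eq_bigr => i _.
by rewrite permM.
Qed.

(* [alt_power stair] is a determinant: a product of Vandermonde determinants in
   the squares, one for each column. *)
Lemma alt_power_neq0 : alt_power stair != 0.
Proof.
pose M : 'M[F]_n := \matrix_(i, j) if (i < N)%N && (j < N)%N
  then (if col i == col j then x j ^+ stair i else 0) else (i == j)%:R.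
have -> : alt_power stair = \det M.
  rewrite /alt_power /determinant [RHS](bigID colperm) /= [X in _ = _ + X]big1 ?addr0.
    apply: eq_bigr => s sG; congr (_ * _); apply: eq_bigr => i _; rewrite mxE (colperm_lt i sG).
    have /colpermP[sN sc] := sG; case: (ltnP i N) => iN /=; first by rewrite sc eqxx.
    by rewrite sN // eqxx /stair ltnNge iN expr0.
  move=> s; apply: contraNeq; rewrite mulf_eq0 negb_or => /andP[_ /prodf_neq0 sM].
  have sM' i : M i (s i) != 0 by apply: sM.
  have out i : (N <= i)%N -> s i = i.
    move=> iN; have := sM' i; rewrite mxE ltnNge iN /=.
    by case: (eqVneq i (s i)) => [<- //|_]; rewrite eqxx.
  apply/colpermP; split=> // i; case: (ltnP i N) => iN; last by rewrite out.
  have siN : (s i < N)%N.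
    rewrite ltnNge; apply/negP => Nsi; have /perm_inj e := out _ Nsi.
    by rewrite e leqNgt iN in Nsi.
  by have := sM' i; rewrite mxE iN siN /=; case: (eqVneq (col i)) => [-> //|_]; rewrite eqxx.
rewrite -unitfE -unitmxE -row_free_unit -kermx_eq0; apply/eqP/eqP/rowV0P => v.
move=> /sub_kermxP vM; apply/rowP => u; rewrite [RHS]mxE.
have vMj j : \sum_i v 0 i * M i j = 0.
  by have := congr1 (fun A : 'rV_n => A 0 j) vM; rewrite !mxE.
case: (ltnP u N) => uN; last first.
  have := vMj u; rewrite (bigD1 u) //= big1 ?addr0 => [|i iu].
    by rewrite mxE ltnNge uN /= eqxx mulr1.
  by rewrite mxE [(u < N)%N]ltnNge uN andbF (negPf iu) mulr0.
pose C := column N col (col u).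
have CP i : reflect ((i < N)%N /\ col i = col u) (i \in C).
  by rewrite finset.in_set; apply: (iffP andP) => -[? /eqP]; split=> //; apply/eqP.
(* A left kernel vector of [M] yields, for each column, a polynomial of degree less than the length
   of the column that vanishes at the distinct squares x_j^2; the odd exponents only contribute the
   nonzero factor x_j. *)
pose p : {poly F} := \sum_(i in C) v 0 i *: 'X^(crank col i).
have p_coef i : i \in C -> p`_(crank col i) = v 0 i.
  move=> iC; rewrite /p coef_sum (bigD1 i) //= big1 ?addr0 ?coefZ ?coefXn ?eqxx ?mulr1 //.
  move=> j /andP[jC ji]; rewrite coefZ coefXn; case: eqP => [e|]; last by rewrite mulr0.
  case/eqP: ji; have /CP[_ cj] := jC; have /CP[_ ci] := iC.
  by apply: (@crank_inj _ col); rewrite ?cj ?ci.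
have sz_p : (size p <= #|C|)%N.
  apply: leq_trans (size_sum _ _ _) _; apply/bigmax_leqP => i iC.
  apply: leq_trans (size_scale_leq _ _) _; rewrite size_polyXn.
  by have /CP[iN ci] := iC; rewrite /C -ci; apply: crank_column.
suff p0 : p = 0 by rewrite -p_coef ?p0 ?coef0 //; apply/CP.
apply/eqP; apply: contraLR sz_p => p0; rewrite -ltnNge.
rewrite cardE -(size_map (fun j => x j ^+ 2)); apply: max_poly_roots => //.
  apply/allP => y /mapP[j]; rewrite mem_enum => jC ->; have /CP[jN cj] := jC.
  have := vMj j; rewrite (bigID (mem C)) /= [X in _ + X = _]big1 ?addr0 => [|i iC].
    rewrite /root => e; apply/eqP; apply: (mulfI (x_neq0 jN)); rewrite mulr0 -e.
    rewrite /p horner_sum mulr_sumr; apply: eq_bigr => i iC; have /CP[iN ci] := iC.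
    rewrite mxE iN jN ci cj eqxx /= hornerZ hornerXn /stair iN [x j ^+ (2 * _).+1]exprS exprM.
    by rewrite mulrCA.
  rewrite mxE jN andbT; case: (ltnP i N) => iN; last first.
    by case: eqP => [e|_]; rewrite ?mulr0 //; move: iN; rewrite e leqNgt jN.
  case: eqP => [ci|_]; rewrite ?mulr0 //; case/negP: iC; apply/CP; split=> //.
  by rewrite ci.
rewrite map_inj_in_uniq ?enum_uniq // => i j; rewrite !mem_enum.
by move=> /CP[iN ci] /CP[jN cj]; apply: x_inj; rewrite ?ci ?cj.
Qed.

Lemma alt_power_eq0 (m : 'I_n -> nat) i j : (i < N)%N -> (j < N)%N -> col i = col j ->
  i != j -> m i = m j -> alt_power m = 0.
Proof.
move=> iN jN cij ij mij; have tG := colperm_tperm iN jN cij.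
have e : alt_power m = - alt_power m.
  rewrite {1}/alt_power [LHS](reindex_inj (mulgI (tperm i j))) /=.
  rewrite /alt_power -sumrN; apply: eq_big => [s|s sG].
    exact: colpermMl.
  rewrite odd_permM odd_tperm ij signr_addb -mulrA mulN1r; congr (- (_ * _)).
  rewrite [RHS](reindex_inj (@perm_inj _ (tperm i j))); apply: eq_bigr => u _.
  rewrite permM; congr (_ ^+ _); by case: tpermP => // ->.
have : alt_power m *+ 2 == 0 by rewrite mulr2n {1}e addNr.
by rewrite -mulr_natr mulf_eq0 pnatr_eq0 orbF => /eqP.
Qed.

Definition signed_point (e : {ffun 'I_n -> bool}) s : 'I_n -> F :=
  fun i => (-1) ^+ e i * x (s i).

(** The sign character is applied to the first N coordinates only; at the others the point is 0 for
    every column permutation, and summing over their signs just gives powers of 2. *)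
Definition alt_eval h : F := \sum_(s | colperm s) (-1) ^+ s *
  \sum_(e : {ffun 'I_n -> bool}) (\prod_(i < n) (if (i < N)%N then (-1) ^+ e i else 1)) *
     h.@[signed_point e s].

(** The sum over signs requires odd exponents in the first N variables, the alternation kills equal
    exponents in a column, and up to degree [stair_deg] only the column permutations of the
    staircase are left. *)
Lemma alt_eval_monomial m : (mdeg m <= stair_deg)%N ->
  alt_eval 'X_[m] = 2 ^+ n * alt_power stair * alt_coef 'X_[m].
Proof.
move=> mD.
(* The sum over all sign vectors factors into a sum of two terms for each variable. *)
pose c (i : 'I_n) : F := \sum_(e : bool) (if (i < N)%N then (-1) ^+ e else 1) * ((-1) ^+ e) ^+ m i.
have cE i : c i = if (i < N)%N == odd (m i) then 2 else 0.
  rewrite /c big_bool /= !expr0 !expr1 !expr1n -signr_odd.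
  by case: (i < N)%N; case: (odd _); rewrite /= ?expr1 ?expr0 ?mulrNN ?mulr1 ?mulN1r ?mul1r
    ?addNr //.
have aE : alt_eval 'X_[m] = (\prod_i c i) * alt_power m.
  rewrite /alt_eval /alt_power mulr_sumr; apply: eq_bigr => s _.
  rewrite mulrCA; congr (_ * _); rewrite -big_split /= /c.
  transitivity (\prod_(i < n) \sum_(e : bool) (if (i < N)%N then (-1) ^+ e else 1) *
     ((-1) ^+ e * x (s i)) ^+ m i).
    rewrite bigA_distr_bigA; apply: eq_bigr => e _; rewrite mevalX -big_split.
    by apply: eq_bigr.
  by apply: eq_bigr => i _; rewrite mulr_suml; apply: eq_bigr => e _; rewrite exprMn mulrA.
have [/existsP[t /andP[tG /eqP mt]]|none] := boolP [exists t, colperm t && (m == stair_mnm t)].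
  have mE i : m i = stair (t i) by rewrite mt mnmE.
  have -> : alt_coef 'X_[m] = (-1) ^+ t.
    rewrite /alt_coef (bigD1 t) //= big1 ?addr0 => [|s /andP[sG st]].
      by rewrite mcoeffX mt eqxx mulr1.
    rewrite mcoeffX; case: eqP => [e|]; last by rewrite mulr0.
    case/eqP: st; apply: (stair_inj sG tG) => i; move: e; rewrite mt => /mnmP/(_ i).
    by rewrite !mnmE.
  rewrite aE; have -> : alt_power m = (-1) ^+ t * alt_power stair.
    by rewrite -alt_power_stair //; apply: eq_bigr => s _; congr (_ * _); apply: eq_bigr => i _;
      rewrite mE.
  rewrite (eq_bigr (fun=> 2)); last first.
    move=> i _; rewrite cE mE /stair (colperm_lt i tG); case: ltnP => //= _.
    by rewrite mul2n odd_double.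
  rewrite prodr_const card_ord -!mulrA; congr (_ * _); exact: mulrC.
have -> : alt_coef 'X_[m] = 0.
  rewrite /alt_coef big1 // => s sG; rewrite mcoeffX; case: eqP => [e|]; last by rewrite mulr0.
  by case/existsP: none; exists s; rewrite sG e eqxx.
rewrite mulr0 aE; apply/eqP; apply: contraR none; rewrite mulf_eq0 negb_or => /andP[cn0 an0].
have modd i : (i < N)%N == odd (m i).
  apply: contraNT cn0 => im; apply/prodf_eq0; exists i => //.
  by rewrite cE (negPf im).
have [i iN|i iN|i j iN jN cij mij||t tG mt] := @staircase n N col m.
- apply/eqP; apply: contraNT an0; rewrite -lt0n => m_gt0; apply/eqP.
  rewrite /alt_power big1 // => s /colpermP[sN _]; rewrite (bigD1 i) //= sN // x_out //.
  by rewrite expr0n eqn0Ngt m_gt0 mul0r mulr0.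
- by rewrite -(eqP (modd i)).
- apply/eqP; apply: contraNT an0 => ij; apply/eqP.
  exact: (alt_power_eq0 iN jN cij ij mij).
- by rewrite -mdegE.
apply/existsP; exists t; rewrite tG; apply/eqP/mnmP => i; by rewrite mnmE.
Qed.

(** Up to degree [stair_deg], [alt_eval] is a nonzero multiple of [alt_coef]; a coefficient in top
    degree is thus read off from the values at finitely many points. *)
Theorem alt_coef_vanish h : (msize h <= stair_deg.+1)%N ->
    (forall s e, colperm s -> h.@[signed_point e s] = 0) -> alt_coef h = 0.
Proof.
move=> hD h0.
have : alt_eval h = 0.
  by rewrite /alt_eval big1 // => s sG; rewrite big1 ?mulr0 // => e _; rewrite h0 ?mulr0.
have -> : alt_eval h = \sum_(m <- msupp h) h@_m * alt_eval 'X_[m].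
  rewrite {1}[h]mpolyE /alt_eval; under [RHS]eq_bigr do rewrite mulr_sumr.
  rewrite [RHS]exchange_big; apply: eq_bigr => s _ /=.
  under [RHS]eq_bigr do rewrite mulrCA mulr_sumr.
  rewrite -mulr_sumr [in RHS]exchange_big; congr (_ * _); apply: eq_bigr => e _ /=.
  rewrite raddf_sum mulr_sumr; apply: eq_bigr => m _ /=.
  by rewrite mevalZ mulrCA.
rewrite big_seq (eq_bigr (fun m => 2 ^+ n * alt_power stair * alt_coef (h@_m *: 'X_[m]))).
  rewrite -mulr_sumr -linear_sum -big_seq -mpolyE => /eqP.
  by rewrite !mulf_eq0 expf_eq0 pnatr_eq0 andbF (negPf alt_power_neq0) => /eqP.
move=> m mh; rewrite alt_eval_monomial; first by rewrite linearZ /=; ring.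
by rewrite -ltnS (leq_trans _ hD) // msize_mdeg_lt.
Qed.

End Functional.

(** * Lower-order corrections of the Tanisaki generators *)

Section Lift.
Variables (F : numFieldType) (n k N : nat) (b : 'I_k -> nat) (X : 'I_k -> F).
Implicit Types (L : {set 'I_n}) (i : 'I_n) (j : 'I_k).

Definition root_poly l : {poly F} := \prod_j ('X - (X j)%:P) ^+ (b j - (N - l)).

Lemma size_root_poly l : size (root_poly l) = (excess N b l).+1.
Proof.
rewrite /root_poly /excess; elim/big_rec2: _ => [|j m p _ sp]; first by rewrite size_poly1.
rewrite size_monicM ?monic_exp ?monicXsubC //; last by rewrite -size_poly_eq0 sp.
by rewrite sp size_exp_XsubC addSn addnS.
Qed.

(** At most N - |L| variables of row [j] lie outside [L], so the factor of X_j occurs at least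
    [b j - (N - #|L|)] times. *)
Lemma root_poly_dvd L (c : 'I_n -> F) (lab : 'I_n -> 'I_k) :
    (N <= n)%N -> L \subset below n N -> (forall i, i \in L -> c i = X (lab i)) ->
    (forall j, (b j <= #|[set i in below n N | lab i == j]|)%N) ->
  root_poly #|L| %| \prod_(i in L) ('X - (c i)%:P).
Proof.
move=> Nn LN cE blab.
rewrite (partition_big lab xpredT) //=; apply: (big_ind2 (fun p q : {poly F} => p %| q)) => //.
  by move=> p1 q1 p2 q2; apply: dvdp_mul.
move=> j _; rewrite (eq_bigr (fun=> 'X - (X j)%:P)); last first.
  by move=> i /andP[iL /eqP <-]; rewrite cE.
rewrite prodr_const; apply: dvdp_exp2l.
have -> : (N - #|L|)%N = #|below n N :\: L|.
  by rewrite finset.cardsD (finset.setIidPr LN) card_below.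
rewrite leq_subLR; apply: leq_trans (blab j) _.
rewrite -(cardsID L [set i in below n N | lab i == j]) addnC; apply: leq_add.
  by apply/subset_leq_card/fintype.subsetP => i; rewrite !finset.inE => /andP[-> /andP[-> _]].
by apply/subset_leq_card/fintype.subsetP => i; rewrite !finset.inE => /andP[/andP[_ e] iL];
  change ((i \in L) && (lab i == j)); rewrite iL e.
Qed.

Lemma msize_homog d (f : {mpoly F[n]}) : f \is d.-homog -> (msize f <= d.+1)%N.
Proof.
move=> fh; have [->|f0] := eqVneq f 0; first by rewrite msize0.
have := dhomog_uniq f0 fh (dhomog_msize fh).
by rewrite [msize f]mpolySpred // => ->.
Qed.

Lemma sq_poly_coef_msize L (i : nat) : (i <= #|L|)%N ->
  (msize (sq_poly F L)`_i <= (2 * (#|L| - i)).+1)%N.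
Proof.
move=> il; rewrite esq_coef // -[(-1) ^+ _]signr_odd.
apply: leq_trans (msize_homog (esq_homog F L (#|L| - i))).
by case: odd; rewrite ?expr1 ?expr0 ?mulN1r ?mul1r ?msizeN.
Qed.

(** Let Q be [root_poly], of degree d = excess. The remainder modulo Q of prod (t - y_i^2) is 0. Its
    coefficient of index l - p < d is that of the product itself plus a combination of the
    coefficients of index i >= d, whose degree 2 (l - i) is less than 2 p. The scalars [r] depend on
    [X] but not on the point [y]. *)
Lemma esq_lift L p : (N <= n)%N -> L \subset below n N -> (\sum_j b j)%N = N ->
    (#|L| < p + excess N b #|L|)%N ->
  exists g, (msize g <= 2 * p)%N /\
    forall (y : 'I_n -> F) (lab : 'I_n -> 'I_k),
      (forall i, (i < N)%N -> y i ^+ 2 = X (lab i)) ->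
      (forall j, (b j <= #|[set i in below n N | lab i == j]|)%N) ->
    (esq F L p + g).@[y] = 0.
Proof.
move=> Nn LN bN lt; set l := #|L| in lt *; set d := excess N b l in lt *.
have dl : (d <= l)%N by apply: excess_le => //; apply: below_le.
case: (leqP p l) => pl; last first.
  by exists 0; rewrite msize0 esq_gt // addr0; split=> // y lab _ _; rewrite meval0.
pose Q := root_poly l.
have szQ : size Q = d.+1 by apply: size_root_poly.
pose r (i : nat) := ('X^i %% Q)`_(l - p).
exists ((-1) ^+ p * \sum_(d <= i < l.+1) r i *: (sq_poly F L)`_i); split.
  have ms (f : {mpoly F[n]}) : (msize ((-1) ^+ p * f) <= msize f)%N.
    by rewrite -signr_odd; case: odd; rewrite ?expr1 ?expr0 ?mulN1r ?mul1r ?msizeN.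
  apply: leq_trans (ms _) _; apply: leq_trans (msize_sum _ _ _) _.
  rewrite big_seq; apply/bigmax_leqP_seq => i; rewrite mem_index_iota => /andP[di il] _.
  apply: leq_trans (msizeZ_le _ _) _.
  by have := sq_poly_coef_msize (il : (i <= #|L|)%N); rewrite -/l => h; apply: leq_trans h _; lia.
move=> y lab yX blab.
pose A := \prod_(i in L) ('X - (y i ^+ 2)%:P).
have AE (i : nat) : ((sq_poly F L)`_i).@[y] = A`_i.
  have -> : A = map_poly (meval y) (sq_poly F L).
    rewrite /sq_poly rmorph_prod /=; apply: eq_bigr => u _.
    rewrite map_polyXsubC; congr ('X - _%:P); by rewrite /= /sqX rmorphXn /= mevalXU.
  by rewrite coef_map.
have QA : Q %| A.
  apply: root_poly_dvd blab => // i iL; apply: yX.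
  by have := fintype.subsetP LN i iL; rewrite mem_below.
have szA : size A = l.+1 by rewrite /A -big_enum /= size_prod_XsubC -cardE.
have : (A %% Q)`_(l - p) = 0 by rewrite (modp_eq0 QA) coef0.
rewrite -[A]coefK szA poly_def (big_morph (fun p => p %% Q) (modpD Q) (mod0p Q)) coef_sum.
under eq_bigr do rewrite modpZl coefZ -/(r _).
rewrite -(big_mkord xpredT (fun i : nat => A`_i * r i)) (big_cat_nat (n := d)) //=; last exact: leqW.
rewrite (big_cat_nat (n := l - p)) //=; last by rewrite leq_subLR; lia.
have rE (i : nat) : (i < d)%N -> r i = (i == l - p)%N%:R.
  by move=> id; rewrite /r modp_small ?size_polyXn ?szQ ?ltnS // coefXn eq_sym.
rewrite big1_seq ?add0r; last first.
  move=> i; rewrite mem_index_iota => /andP[_ /andP[_ il]]; rewrite rE; last by lia.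
  by rewrite ltn_eqF // mulr0.
rewrite big_ltn; last by lia.
rewrite rE ?eqxx ?mulr1; last by lia.
rewrite big1_seq ?addr0; last first.
  move=> i; rewrite mem_index_iota => /andP[_ /andP[il id]]; rewrite rE //.
  by rewrite gtn_eqF // mulr0.
rewrite mevalD /esq pl !mevalM -mulrDr AE => e; apply/eqP; rewrite mulf_eq0; apply/orP.
right; apply/eqP; rewrite -[RHS]e; congr (_ + _).
rewrite raddf_sum; apply: eq_bigr => i _ /=.
by rewrite mevalZ AE mulrC.
Qed.

End Lift.

Section Filling.
Variables (n k : nat).
Implicit Types (lab : 'I_n -> 'I_k) (col : 'I_n -> nat) (b : 'I_k -> nat) (j : 'I_k).

(* [(lab, col)] places the first [N] variables bijectively in the cells of the
   Young diagram whose row of index [j] has length [b j]. *)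
Definition filling N b lab col :=
  (forall u : 'I_n, (u < N)%N -> (col u < b (lab u))%N) /\
  (forall u v : 'I_n, (u < N)%N -> (v < N)%N -> lab u = lab v -> col u = col v -> u = v).

Lemma filling_row_le N b lab col j : filling N b lab col ->
  (#|[set u in below n N | lab u == j]| <= b j)%N.
Proof.
move=> [fb fi]; rewrite cardE -(size_map col) -[leqRHS](size_iota 0).
have E (u : 'I_n) : u \in enum [set u in below n N | lab u == j] -> (u < N)%N /\ lab u = j.
  by rewrite mem_enum finset.in_set mem_below => /andP[uN /eqP].
apply: uniq_leq_size.
  rewrite map_inj_in_uniq ?enum_uniq // => u v /E[uN uj] /E[vN vj].
  by apply: fi; rewrite ?uj ?vj.
by move=> _ /mapP[u /E[uN <-] ->]; rewrite mem_iota add0n /= fb.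
Qed.

Lemma filling_row N b lab col j : (N <= n)%N -> (\sum_j b j)%N = N -> filling N b lab col ->
  #|[set u in below n N | lab u == j]| = b j.
Proof.
move=> Nn bN fl; apply/eqP; rewrite eqn_leq (filling_row_le _ fl) /= leqNgt.
apply/negP => lt; suff : (N < N)%N by rewrite ltnn.
rewrite -{1}(card_below Nn) -{2}bN -sum1_card (partition_big lab xpredT) //=.
have E i : (\sum_(u in below n N | lab u == i) 1)%N = #|[set u in below n N | lab u == i]|.
  by rewrite -sum1dep_card.
rewrite (bigD1 j) //= [ltnRHS](bigD1 j) //= E -addSn leq_add //.
by apply: leq_sum => i _; rewrite E; apply: filling_row_le fl.
Qed.

Lemma filling_cell N b lab col j c : (N <= n)%N -> (\sum_j b j)%N = N ->
  filling N b lab col -> (c < b j)%N -> exists u : 'I_n, [/\ (u < N)%N, lab u = j & col u = c].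
Proof.
move=> Nn bN fl cb; have rE := filling_row j Nn bN fl; have [fb fi] := fl.
set R := [set u in below n N | lab u == j] in rE.
have RP (u : 'I_n) : u \in enum R -> (u < N)%N /\ lab u = j.
  by rewrite mem_enum finset.in_set mem_below => /andP[uN /eqP].
have Ru : uniq (map col (enum R)).
  rewrite map_inj_in_uniq ?enum_uniq // => u v /RP[uN uj] /RP[vN vj].
  by apply: fi; rewrite ?uj ?vj.
have Rs : {subset map col (enum R) <= iota 0 (b j)}.
  by move=> _ /mapP[u /RP[uN <-] ->]; rewrite mem_iota add0n /= fb.
have [|_ /(_ c)] := uniq_min_size Ru Rs; first by rewrite size_iota size_map -cardE rE.
rewrite mem_iota add0n cb /= => /mapP[u /RP[uN uj] ->].
by exists u.
Qed.

End Filling.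

Section Orthogonal.
Variables (F : numFieldType) (n k : nat).
Implicit Types (lab : 'I_n -> 'I_k) (col : 'I_n -> nat) (b : 'I_k -> nat) (j : 'I_k).
Implicit Types (m : 'X_{1..n}) (f g h : {mpoly F[n]}).

(* [alt_coef] is the staircase coefficient of the column-antisymmetrization. *)
Definition orth N b f := forall lab col, filling N b lab col ->
  forall m, alt_coef N col (f * 'X_[m]) = 0.

Lemma orthB N b f g : orth N b f -> orth N b g -> orth N b (f - g).
Proof. by move=> fo go lab col fl m; rewrite mulrBl linearB /= (fo _ _ fl) (go _ _ fl) subr0. Qed.

Lemma orth_mul N b f lab col h : orth N b f -> filling N b lab col ->
  alt_coef N col (f * h) = 0.
Proof.
move=> fo fl; rewrite [h]mpolyE mulr_sumr linear_sum big1 // => m _.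
by rewrite -scalerAr linearZ /= (fo _ _ fl) mulr0.
Qed.

Lemma alt_coef_msize N col h : (msize h <= stair_deg N col)%N -> alt_coef N col h = 0.
Proof.
move=> hD; apply: alt_coef_deg => m mD.
by apply/memN_msupp_eq0/msize_mdeg_ge; rewrite mD.
Qed.

Lemma msizeM_bound f g d e : (msize f <= d.+1)%N -> (msize g <= e.+1)%N ->
  (msize (f * g) <= (d + e).+1)%N.
Proof.
have [->|f0] := eqVneq f 0; first by rewrite mul0r msize0.
have [->|g0] := eqVneq g 0; first by rewrite mulr0 msize0.
rewrite msizeM // => fd ge.
by rewrite -subn1 leq_subLR add1n -addnS -addSn; apply: leq_add.
Qed.

(** Needed for every N, because the induction of [orth_tan] changes f modulo the ideal. A generator
    is corrected in lower degree so as to vanish at all signed column permutations of a point whose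
    squares are constant on the rows and distinct between rows. *)
Lemma tan_orth N b f : (N <= n)%N -> (\sum_j b j)%N = N -> tan_ideal N b f -> orth N b f.
Proof.
move=> Nn bN fT lab col fl m; move: f fT; apply: ideal_gen_ind.
- by rewrite mul0r linear0.
- by move=> f g fo go; rewrite mulrDl linearD /= fo go addr0.
move=> c _ [L [p [LN p1 lt ->]]]; rewrite mulrAC mulrC; move: (c * 'X_[m]) => h.
rewrite [h]mpolyE mulr_sumr linear_sum big1 // => {}m _.
rewrite -scalerAr linearZ /=; suff -> : alt_coef N col (esq F L p * 'X_[m]) = 0 by rewrite mulr0.
(* Any nonzero numbers with distinct squares, one for each row, would do. *)
pose x (u : 'I_n) : F := if (u < N)%N then ((lab u).+1)%:R else 0.
have [g [gs gy]] := esq_lift (fun j : 'I_k => (j.+1)%:R ^+ 2 : F) Nn LN bN lt.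
have [mD|mD] := eqVneq (2 * p + mdeg m)%N (stair_deg N col); last first.
  apply: alt_coef_deg => m' m'D; apply: (@dhomog_nemf_coeff _ _ mdeg (2 * p + mdeg m)).
    by apply: dhomogM; [apply: esq_homog | rewrite dhomogX].
  by rewrite /= m'D eq_sym.
suff : alt_coef N col ((esq F L p + g) * 'X_[m]) = 0.
  rewrite mulrDl linearD /= => <-; rewrite [X in _ + X]alt_coef_msize ?addr0 // -mD.
  have [->|g0] := eqVneq g 0; first by rewrite mul0r msize0.
  have X0 : 'X_[m] != 0 :> {mpoly F[n]} by rewrite -msize_poly_eq0 msizeX.
  by rewrite msizeM // msizeX addnS /= leq_add2r.
apply: (@alt_coef_vanish _ _ _ _ x).
- by move=> u Nu; rewrite /x ltnNge Nu.
- by move=> u uN; rewrite /x uN pnatr_eq0.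
- move=> u v uN vN cuv; rewrite /x uN vN => /eqP; rewrite eqrXn2 ?ler0n //.
  rewrite eqr_nat => /eqP[luv]; have [_ fi] := fl; apply: fi => //.
  exact/val_inj.
- rewrite -mD; apply: msizeM_bound; last by rewrite msizeX.
  apply: leq_trans (mmeasureD_le _ _ _) _; rewrite geq_max; apply/andP; split; last exact: leqW.
  exact: (msize_homog (esq_homog F L p)).
move=> s e sG; rewrite mevalM (gy _ (fun u => lab (s u))) ?mul0r //.
  move=> u uN; rewrite /signed_point exprMn -exprM mulnC exprM sqrrN expr1n expr1n mul1r.
  by rewrite /x (colperm_lt u sG) uN.
move=> j; rewrite -(filling_row j Nn bN fl) -(card_preimset _ (@perm_inj _ s)).
apply/subset_leq_card/fintype.subsetP => u.
by rewrite !finset.inE (colperm_lt u sG).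
Qed.

End Orthogonal.

(** * The last variable in the staircase coefficients *)

Section TopCoefficient.
Variables (F : numFieldType) (n N : nat) (v : 'I_n) (vN : v = N :> nat).
Implicit Types (col : 'I_n -> nat) (m : 'X_{1..n}) (f g h : {mpoly F[n]}) (s : 'S_n).

Lemma mcoeff_powerM h a m : ('X_v ^+ a * h)@_m =
  if (a <= m v)%N then h@_(m - U_(v) *+ a)%MM else 0.
Proof.
rewrite mpolyXn mulrC; case: leqP => am.
  rewrite -{1}(@submK _ (U_(v) *+ a)%MM m) 1?addmC ?mcoeffMX //.
  apply/mnm_lepP => i; rewrite mulmnE mnm1E; case: eqP => [<-|_]; first by rewrite mul1n.
  by rewrite mul0n.
apply/memN_msupp_eq0; rewrite (perm_mem (msuppMX _ _)); apply/negP => /mapP[m' _ e].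
by move: am; rewrite e mnmDE mulmnE mnm1E eqxx mul1n ltnNge leq_addr.
Qed.

(** Among the first N + 1 variables, [v] is the last of its column and has the largest [crank]
    there. *)
Lemma stair_top col s : colperm N.+1 col s ->
  stair N.+1 col (s v) = (2 * crank col (s v)).+1 /\
  ((2 * crank col v).+1 <= stair N.+1 col (s v) -> s v = v)%N.
Proof.
move=> sG; have svN : (s v < N.+1)%N by rewrite (colperm_lt _ sG) vN.
have /colpermP[_ sc] := sG.
rewrite /stair svN; split=> //; rewrite ltnS leq_pmul2l // => le.
apply/val_inj/eqP; move: svN; rewrite ltnS -vN leq_eqVlt => /orP[//|lt].
by have := crank_lt (sc v) lt; rewrite ltnNge le.
Qed.

Lemma crank_ext col col' (u : 'I_n) : (forall w : 'I_n, (w <= u)%N -> col w = col' w) ->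
  crank col u = crank col' u.
Proof.
move=> cc; apply: eq_card => w; rewrite !finset.inE; case: (ltnP w u) => //= wu.
by rewrite !cc // ltnW.
Qed.

Lemma colperm_top col col' s : (forall u : 'I_n, (u < N)%N -> col u = col' u) ->
  colperm N.+1 col s && (s v == v) = colperm N col' s.
Proof.
move=> cc; apply/andP/idP => [[sG /eqP sv]|sG'].
  have /colpermP[sN sc] := sG; have sN' (i : 'I_n) : (N <= i)%N -> s i = i.
    rewrite leq_eqVlt => /orP[/eqP Ni|]; last exact: sN.
    by have -> : i = v by apply: val_inj; rewrite /= vN.
  apply/colpermP; split=> // i; case: (ltnP i N) => iN; last by rewrite sN'.
  have siN : (s i < N)%N.
    rewrite ltnNge; apply/negP => Nsi; have /perm_inj e := sN' _ Nsi.
    by rewrite e leqNgt iN in Nsi.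
  by rewrite -!cc.
have /colpermP[sN sc] := sG'; split; last by rewrite sN ?vN.
apply/colpermP; split=> i; first by move=> /ltnW; apply: sN.
case: (ltnP i N) => iN; last by rewrite sN.
by rewrite !cc ?(colperm_lt i sG').
Qed.

(** This is the largest exponent that a column permutation of the staircase has at [v], so only the
    permutations fixing [v] contribute. *)
Lemma alt_coef_top col col' h : (forall u : 'I_n, (u < N)%N -> col u = col' u) ->
  alt_coef N.+1 col ('X_v ^+ (2 * crank col v).+1 * h) = alt_coef N col' h.
Proof.
move=> cc; rewrite /alt_coef (bigID (fun s => s v == v)) /= [X in _ + X]big1 ?addr0.
  rewrite (eq_bigl _ _ (fun s => colperm_top s cc)); apply: eq_bigr => s sG'.
  have /andP[sG /eqP sv] : colperm N.+1 col s && (s v == v) by rewrite (colperm_top s cc).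
  congr (_ * _); rewrite mcoeff_powerM mnmE; have [-> _] := stair_top sG.
  rewrite sv leqnn; congr (h@_ _); apply/mnmP => i.
  rewrite mnmBE mulmnE mnm1E !mnmE; case: eqP => [<-|/eqP iv].
    by rewrite mul1n sv /stair vN ltnSn ltnn subnn.
  rewrite mul0n subn0 /stair (colperm_lt i sG) (colperm_lt i sG').
  case: (ltngtP i N) => iN.
  - rewrite ltnW ?ltnS // (@crank_ext col col') // => w wi; apply: cc.
    by apply: leq_ltn_trans wi _; rewrite (colperm_lt i sG').
  - by rewrite ltnNge iN.
  - by case/eqP: iv; apply: val_inj; rewrite /= vN iN.
move=> s /andP[sG sv]; rewrite mcoeff_powerM mnmE; case: ifP => le; last by rewrite mulr0.
by have [_ /(_ le) e] := stair_top sG; rewrite e eqxx in sv.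
Qed.

Lemma alt_coef_above col a h : (2 * crank col v + 1 < a)%N ->
  alt_coef N.+1 col ('X_v ^+ a * h) = 0.
Proof.
move=> la; rewrite /alt_coef big1 // => s sG; rewrite mcoeff_powerM mnmE.
case: ifP => le; last by rewrite mulr0.
have [e sv] := stair_top sG; have svv : s v = v by apply: sv; lia.
by move: le; rewrite e svv; lia.
Qed.

Definition free_of h := forall m, m \in msupp h -> m v = 0%N.

(** Staircase exponents at [v] are odd, and [h] cannot change the parity of the power of y_v. *)
Lemma alt_coef_even col a h : free_of h -> ~~ odd a ->
  alt_coef N.+1 col ('X_v ^+ a * h) = 0.
Proof.
move=> hv oa; rewrite /alt_coef big1 // => s sG; rewrite mcoeff_powerM mnmE.
case: ifP => le; last by rewrite mulr0.
rewrite memN_msupp_eq0 ?mulr0 //; apply/negP => /hv.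
rewrite mnmBE mulmnE mnm1E eqxx mul1n mnmE; have [e _] := stair_top sG.
move=> sub0; have ea : stair N.+1 col (s v) = a by move: le sub0; lia.
by move: oa; rewrite -ea e /= mul2n odd_double.
Qed.

Lemma free_ofM h m : free_of h -> m v = 0%N -> free_of (h * 'X_[m]).
Proof.
move=> hv mv m'; rewrite (perm_mem (msuppMX _ _)) => /mapP[m1 /hv m1v ->].
by rewrite mnmDE mv m1v.
Qed.

Lemma alt_coef_out col h m : (N <= n)%N -> (0 < m v)%N -> alt_coef N col (h * 'X_[m]) = 0.
Proof.
move=> _ mv; rewrite /alt_coef big1 // => s /colpermP[sN _].
rewrite memN_msupp_eq0 ?mulr0 // (perm_mem (msuppMX _ _)); apply/negP => /mapP[m1 _].
move/mnmP/(_ v); rewrite !mnmE sN ?vN // /stair vN ltnn; lia.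
Qed.

End TopCoefficient.

Section Restriction.
Variables (F : numFieldType) (n : nat).
Implicit Types (f g h : {mpoly F[n]}) (m : 'X_{1..n}).

Definition vars_below N f := forall m, m \in msupp f -> forall i : 'I_n, (N <= i)%N -> m i = 0%N.

Definition restrict_vars N f := f \mPo [tuple (if (i < N)%N then 'X_i else 0) : {mpoly F[n]} | i < n].

Lemma restrictX N m : restrict_vars N 'X_[m] =
  if [forall i : 'I_n, (N <= i)%N ==> (m i == 0%N)] then 'X_[m] else 0.
Proof.
rewrite /restrict_vars comp_mpolyX; case: ifP => [/forallP mN|/negbT].
  rewrite [RHS]mpolyXE_id; apply: eq_bigr => i _; rewrite tnth_mktuple.
  case: ltnP => // iN; have := mN i; rewrite iN /= => /eqP->.
  by rewrite !expr0.
rewrite negb_forall => /existsP[u]; rewrite negb_imply => /andP[uN mu].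
rewrite (bigD1 u) //= tnth_mktuple ltnNge uN /=.
by rewrite expr0n (negPf mu) mul0r.
Qed.

Lemma vars_belowD N f g : vars_below N f -> vars_below N g -> vars_below N (f + g).
Proof. by move=> fN gN m /msuppD_le; rewrite mem_cat => /orP[/fN|/gN]. Qed.

Lemma vars_belowZ N c f : vars_below N f -> vars_below N (c *: f).
Proof. by move=> fN m /msuppZ_le; apply: fN. Qed.

Lemma vars_belowM N f g : vars_below N f -> vars_below N g -> vars_below N (f * g).
Proof.
move=> fN gN m /msuppM_le/allpairsP[[m1 m2] /= [/fN m1N /gN m2N ->]] i Ni.
by rewrite mnmDE m1N ?m2N.
Qed.

Lemma vars_below0 N : vars_below N 0.
Proof. by move=> m; rewrite msupp0. Qed.

Lemma vars_belowX N m : (forall i : 'I_n, (N <= i)%N -> m i = 0%N) -> vars_below N 'X_[m].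
Proof. by move=> mN m' /mem_msuppXP <-. Qed.

Lemma vars_below_sum N (I : eqType) (r : seq I) (f : I -> {mpoly F[n]}) :
  (forall i, i \in r -> vars_below N (f i)) -> vars_below N (\sum_(i <- r) f i).
Proof.
move=> fN; rewrite big_seq; elim/big_rec: _ => [|i g ir gN]; first exact: vars_below0.
by apply: vars_belowD => //; apply: fN.
Qed.

Lemma restrict_below N f : vars_below N (restrict_vars N f).
Proof.
rewrite [f]mpolyE /restrict_vars rmorph_sum /=; apply: vars_below_sum => m _.
rewrite comp_mpolyZ; apply: vars_belowZ; rewrite -/(restrict_vars N _) restrictX.
case: forallP => [mN|_]; last exact: vars_below0.
by apply: vars_belowX => i iN; have := mN i; rewrite iN => /eqP.
Qed.

Lemma restrict_id N f : vars_below N f -> restrict_vars N f = f.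
Proof.
move=> fN; rewrite [RHS]mpolyE {1}[f]mpolyE /restrict_vars rmorph_sum /= !big_seq.
apply: eq_bigr => m mf; rewrite comp_mpolyZ -/(restrict_vars N _) restrictX.
by case: forallP => // -[] i; apply/implyP => iN; rewrite (fN _ mf).
Qed.

Lemma sqX_below N (i : 'I_n) : (i < N)%N -> vars_below N (sqX F i).
Proof.
move=> iN; have h : vars_below N ('X_i : {mpoly F[n]}).
  by apply: vars_belowX => j Nj; rewrite mnm1E; case: eqP => // ij; rewrite -ij leqNgt iN in Nj.
exact: (vars_belowM h h).
Qed.

Lemma esq_below N (L : {set 'I_n}) p : L \subset below n N -> vars_below N (esq F L p).
Proof.
elim/finset_ind: L p => [|v L vL IH] [|p] LN.
- by rewrite esq0 -mpolyX0; apply: vars_belowX => i _; rewrite mnm0E.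
- by rewrite esq_gt ?finset.cards0 //; apply: vars_below0.
- by rewrite esq0 -mpolyX0; apply: vars_belowX => i _; rewrite mnm0E.
move: LN; rewrite finset.subUset finset.sub1set mem_below => /andP[vN LN].
rewrite esqS //; apply: vars_belowD; first exact: IH.
by apply: vars_belowM; [apply: sqX_below | apply: IH].
Qed.

Lemma restrict_tan k N (b : 'I_k -> nat) f : tan_ideal N b f -> tan_ideal N b (restrict_vars N f).
Proof.
move: f; apply: ideal_gen_ind => [|f g|c f].
- by rewrite /restrict_vars comp_mpoly0; apply: ideal_gen0.
- by rewrite /restrict_vars rmorphD; apply: ideal_genD.
move=> fG; rewrite /restrict_vars rmorphM /=; apply: ideal_genM.
rewrite -/(restrict_vars N _) restrict_id; first exact: ideal_gen_mem.
by case: fG => L [p [LN _ _ ->]]; apply: esq_below.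
Qed.

(** [g2] may still involve y_v: each stage of the induction examines two consecutive powers only. *)
Lemma split_variable N (v : 'I_n) f : v = N :> nat -> vars_below N.+1 f ->
  exists g0 g1 g2, [/\ vars_below N g0, vars_below N g1 &
     f = g0 + 'X_v * g1 + sqX F v * g2].
Proof.
move=> vN fN; rewrite [f]mpolyE big_seq; elim/big_rec: _ => [|m g mf].
  by exists 0, 0, 0; split; [exact: vars_below0 | exact: vars_below0 | rewrite !mulr0 !addr0].
move=> [g0 [g1 [g2 [h0 h1 ->]]]].
have free a : (m v <= a)%N -> vars_below N ('X_[m - U_(v) *+ a] : {mpoly F[n]}).
  move=> ma; apply: vars_belowX => i Ni; rewrite mnmBE mulmnE mnm1E.
  case: eqP => [<-|vi]; first by rewrite mul1n; lia.
  rewrite (fN _ mf) // ltn_neqAle Ni andbT; apply/eqP => e; apply: vi.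
  by apply: val_inj; rewrite /= vN.
have shift a : (a <= m v)%N -> 'X_[m] = 'X_v ^+ a * 'X_[m - U_(v) *+ a] :> {mpoly F[n]}.
  move=> am; rewrite mpolyXn -mpolyXD addmC submK //.
  apply/mnm_lepP => i; rewrite mulmnE mnm1E; case: eqP => [<-|_]; first by rewrite mul1n.
  by rewrite mul0n.
case: (ltnP (m v) 2) => mv; last first.
  exists g0, g1, (f@_m *: 'X_[m - U_(v) *+ 2] + g2); split=> //.
  by rewrite (shift 2) // /sqX -!mul_mpolyC; ring.
case: (posnP (m v)) => mv0.
  exists (f@_m *: 'X_[m - U_(v) *+ 0] + g0), g1, g2; split=> //.
    by apply/vars_belowD => //; apply/vars_belowZ/free; rewrite mv0.
  by rewrite (shift 0) // expr0 mul1r -!addrA.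
exists g0, (f@_m *: 'X_[m - U_(v) *+ 1] + g1), g2; split=> //.
  by apply/vars_belowD => //; apply/vars_belowZ/free.
by rewrite (shift 1) // expr1 -!mul_mpolyC; ring.
Qed.

End Restriction.

Section OrthTanisaki.
Variables (F : numFieldType) (n k : nat).
Implicit Types (lab : 'I_n -> 'I_k) (col : 'I_n -> nat) (b : 'I_k -> nat) (j : 'I_k).
Implicit Types (m : 'X_{1..n}) (f g h : {mpoly F[n]}).

Definition remove_cell b j : 'I_k -> nat := fun i => if i == j then (b j).-1 else b i.

Lemma sum_remove_cell N b j : (\sum_i b i)%N = N.+1 -> (0 < b j)%N ->
  (\sum_i remove_cell b j i)%N = N.
Proof.
rewrite (bigD1 j) //= [X in _ -> _ -> X = _](bigD1 j) //= {1}/remove_cell eqxx => bN bj.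
rewrite (eq_bigr b); first by lia.
by move=> i /negPf ij; rewrite /remove_cell ij.
Qed.

(** A filling of the smaller diagram extends by putting [v] into the cell removed from row [j]. More
    than t rows have length at least b j, so the column of [v] contains at least t variables before
    [v]. A multiplier can therefore raise y_v^(2t) to the even or odd exponent at which the
    staircase coefficient isolates [g1] or [g0]. *)
Lemma orth_step N b j (v : 'I_n) t g0 g1 g2 : (N.+1 <= n)%N -> v = N :> nat ->
    (\sum_i b i)%N = N.+1 -> (0 < b j)%N -> (t < #|[set i | (b j <= b i)%N]|)%N ->
    vars_below N g0 -> vars_below N g1 ->
    orth N.+1 b (sqX F v ^+ t * (g0 + 'X_v * g1 + sqX F v * g2)) ->
  orth N (remove_cell b j) g0 /\ orth N (remove_cell b j) g1.
Proof.
move=> Nn vN bN bj tj g0N g1N fo; set b' := remove_cell b j.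
have b'j : (b' j).+1 = b j by rewrite /b' /remove_cell eqxx prednK.
have b'i i : i != j -> b' i = b i by move=> /negPf ij; rewrite /b' /remove_cell ij.
have b'N : (\sum_i b' i)%N = N by apply: sum_remove_cell.
have free g : vars_below N g -> free_of v g.
  by move=> gN m mg; apply: (gN m mg); rewrite vN.
suff main lab' col' : filling N b' lab' col' -> forall m,
    alt_coef N col' (g0 * 'X_[m]) = 0 /\ alt_coef N col' (g1 * 'X_[m]) = 0.
  by split=> lab' col' fl m; have [] := main _ _ fl m.
move=> fl m; have [mv0|mv] := posnP (m v); last first.
  by rewrite !(@alt_coef_out _ _ _ v) // ltnW.
pose lab u := if u == v then j else lab' u.
pose col u := if u == v then b' j else col' u.
have ltv (u : 'I_n) : (u < N.+1)%N -> u == v \/ u != v /\ (u < N)%N.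
  rewrite ltnS leq_eqVlt -vN => /orP[uv|uv]; [left | right; split=> //].
    by apply/eqP/val_inj/eqP.
  by apply: contraTneq uv => ->; rewrite ltnn.
have [fb fi] := fl.
have fl1 : filling N.+1 b lab col.
  split=> [u /ltv[/eqP->|[uv uN]]|u w].
  - by rewrite /lab /col eqxx b'j.
  - rewrite /lab /col (negPf uv); apply: leq_trans (fb _ uN) _.
    by case: (eqVneq (lab' u) j) => [->|/b'i->//]; rewrite -b'j leqnSn.
  rewrite /lab /col => /ltv[/eqP uv|[uv uN]] /ltv[/eqP wv|[wv wN]].
  - by rewrite uv wv.
  - rewrite uv eqxx (negPf wv) => e1 e2.
    by have := fb w wN; rewrite -e2 -e1 ltnn.
  - rewrite wv eqxx (negPf uv) => e1 e2.
    by have := fb u uN; rewrite e2 e1 ltnn.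
  - by rewrite (negPf uv) (negPf wv); apply: fi.
have cc (u : 'I_n) : (u < N)%N -> col u = col' u.
  by move=> uN; rewrite /col; case: eqP => // e; rewrite e vN ltnn in uN.
have tr : (t <= crank col v)%N.
  rewrite -ltnS; apply: leq_trans tj _.
  rewrite (cardsD1 j) finset.inE leqnn add1n ltnS.
  have cellP i : i \in enum ([set i | (b j <= b i)%N] :\ j) ->
     exists u : 'I_n, [/\ (u < N)%N, lab' u = i & col' u = b' j].
    rewrite mem_enum !finset.inE => /andP[ij bji].
    apply: (filling_cell (b := b')) => //; first exact: ltnW.
    by rewrite (b'i i) // b'j.
  rewrite cardE /crank cardE -(size_map lab).
  apply: uniq_leq_size; first exact: enum_uniq.
  move=> i /cellP[u [uN ui uc]]; apply/mapP; exists u.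
    by rewrite mem_enum finset.inE vN uN cc // uc /col eqxx eqxx.
  by rewrite /lab; case: eqP => // e; rewrite e vN ltnn in uN.
have powE a : 'X_v ^+ (2 * crank col v + a) = sqX F v ^+ t * (sqX F v ^+ (crank col v - t) * 'X_v ^+ a).
  by rewrite mulrA -exprD subnKC // exprD exprM.
set r := crank col v in powE.
have addE f g : alt_coef N.+1 col f + alt_coef N.+1 col g = alt_coef N.+1 col (f + g).
  by rewrite linearD.
(* Odd multiplier: [g0] gets the top exponent 2 r + 1, and everything else lies above it and
   vanishes. *)
have e0 : alt_coef N.+1 col ('X_v ^+ (2 * r + 1) * (g0 * 'X_[m])) +
    alt_coef N.+1 col ('X_v ^+ (2 * r + 2) * ((g1 + 'X_v * g2) * 'X_[m])) = 0.
  rewrite addE -(orth_mul (sqX F v ^+ (r - t) * 'X_v * 'X_[m]) fo fl1) /sqX.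
  apply: (congr1 (alt_coef N.+1 col)); rewrite !powE /sqX; ring.
(* Even multiplier: [g0] vanishes by parity and [g2] by its exponent, so that [g1] remains. *)
have e1 : alt_coef N.+1 col ('X_v ^+ (2 * r) * (g0 * 'X_[m])) +
    (alt_coef N.+1 col ('X_v ^+ (2 * r + 1) * (g1 * 'X_[m])) +
    alt_coef N.+1 col ('X_v ^+ (2 * r + 2) * (g2 * 'X_[m]))) = 0.
  rewrite !addE -(orth_mul (sqX F v ^+ (r - t) * 'X_[m]) fo fl1) /sqX.
  have p0 : 'X_v ^+ (2 * r) = sqX F v ^+ t * sqX F v ^+ (r - t).
    by have := powE 0%N; rewrite addn0 expr0 mulr1.
  apply: (congr1 (alt_coef N.+1 col)); rewrite !powE p0 /sqX; ring.
move: e0 e1; rewrite addn1 !(alt_coef_top vN _ cc).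
rewrite [alt_coef _ _ ('X_v ^+ (2 * r) * _)](alt_coef_even vN) ?add0r; last first.
- by rewrite mul2n odd_double.
- by apply: free_ofM => //; apply: free.
by rewrite !(alt_coef_above vN) ?addr0 //; rewrite -/r; lia.
Qed.

(** [b j] is the largest length that more than [t] rows attain. *)
Lemma rank_row N b t : (\sum_i b i)%N = N -> (t < #|[set i | (0 < b i)%N]|)%N ->
  exists j, [/\ (0 < b j)%N, (#|[set i | (b j < b i)%N]| <= t)%N &
    (t < #|[set i | (b j <= b i)%N]|)%N].
Proof.
move=> bN tk; pose P x := (0 < x)%N && (t < #|[set i | (x <= b i)%N]|)%N.
have P1 : P 1%N by rewrite /P.
have ub x : P x -> (x <= N)%N.
  case/andP=> _ tx; have : (0 < #|[set i | (x <= b i)%N]|)%N by apply: leq_ltn_trans tx.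
  case/card_gt0P => i; rewrite finset.inE => /leq_trans; apply.
  by rewrite -bN (bigD1 i) //= leq_addr.
have [x /andP[x0 tx] xmax] := ex_maxnP (ex_intro P 1%N P1) ub.
have lex : (#|[set i | (x < b i)%N]| <= t)%N.
  rewrite leqNgt; apply/negP => h; have := xmax x.+1.
  by rewrite /P h ltnn => /(_ isT).
suff [j bjx] : exists j, b j = x by exists j; rewrite bjx.
have /fintype.subsetPn[j] : ~~ ([set i | (x <= b i)%N] \subset [set i | (x < b i)%N]).
  by apply: contraL tx => /subset_leq_card h; rewrite -leqNgt (leq_trans h).
by rewrite !finset.inE => xb bx; exists j; apply/eqP; rewrite eqn_leq xb andbT leqNgt.
Qed.

Theorem orth_tan N b f : (0 < k)%N -> (N <= n)%N -> (\sum_i b i)%N = N ->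
  vars_below N f -> orth N b f -> tan_ideal N b f.
Proof.
move=> k0; elim: N b f => [|N IH] b f Nn bN fN fo.
  (* For N = 0 the polynomial is constant, and the only functional is its constant coefficient. *)
  suff -> : f = 0 by apply: ideal_gen0.
  pose lab (u : 'I_n) : 'I_k := Ordinal k0; pose col (u : 'I_n) := 0%N.
  have fl : filling 0 b lab col by split.
  have := fo _ _ fl 0%MM; rewrite mpolyX0 mulr1 /alt_coef (bigD1 1%g) ?colperm1 //=.
  rewrite big1 ?addr0 => [|s /andP[/colpermP[s1 _] /eqP s0]]; last first.
    by case: s0; apply/permP => i; rewrite perm1 s1.
  rewrite odd_perm1 mul1r => f0; apply/mpolyP => m; rewrite mcoeff0.
  apply/eqP; rewrite mcoeff_eq0; apply/negP => mf.
  have m0 : m = stair_mnm 0 col 1%g.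
    by apply/mnmP => i; rewrite (fN _ mf) // mnmE.
  by move: mf; rewrite m0 mcoeff_msupp f0 eqxx.
pose v : 'I_n := Ordinal Nn; have vN : v = N :> nat by [].
pose K := #|[set i | (0 < b i)%N]|.
suff [g [gN fg]] : exists g, vars_below N.+1 g /\ tan_ideal N.+1 b (f - sqX F v ^+ K * g).
  rewrite -(subrK (sqX F v ^+ K * g) f); apply: ideal_genD => //.
  by rewrite mulrC; apply/ideal_genM/sqX_tan.
(* Inner induction: modulo the ideal, [f] is divisible by growing powers of y_v^2, until the power
   itself belongs to the ideal. *)
suff: forall t, (t <= K)%N ->
    exists g, vars_below N.+1 g /\ tan_ideal N.+1 b (f - sqX F v ^+ t * g) by apply.
elim=> [|t IHt] tK; first by exists f; rewrite mul1r subrr; split=> //; apply: ideal_gen0.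
have [g [gN fg]] := IHt (ltnW tK).
have [g0 [g1 [g2 [g0N g1N gE]]]] := split_variable vN gN.
have [j [bj le_t lt_t]] := rank_row bN tK.
have go : orth N.+1 b (sqX F v ^+ t * g).
  rewrite -[X in orth _ _ X](subKr f); apply: orthB => //.
  exact: tan_orth.
rewrite gE in go; have [o0 o1] := orth_step Nn vN bN bj lt_t g0N g1N go.
have b'N := sum_remove_cell bN bj.
have T0 := IH _ _ (ltnW Nn) b'N g0N o0; have T1 := IH _ _ (ltnW Nn) b'N g1N o1.
have b'j : b j = (remove_cell b j j).+1 by rewrite /remove_cell eqxx prednK.
have b'i i : i != j -> b i = remove_cell b j i by move=> /negPf ij; rewrite /remove_cell ij.
have [q0 h0] := tan_step Nn bN vN b'j b'i le_t T0.
have [q1 h1] := tan_step Nn bN vN b'j b'i le_t T1.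
have := ideal_genD (ideal_genD fg h0) (ideal_genM 'X_v h1).
set h := (X in ideal_gen _ X); have -> : h = f - sqX F v ^+ t.+1 * (q0 + 'X_v * q1 + g2).
  by rewrite /h gE exprS; ring.
(* The quotients given by [tan_step] may involve later variables; setting these to 0 preserves the
   ideal and fixes [f]. *)
set q := _ + g2 => /restrict_tan.
have -> : restrict_vars N.+1 (f - sqX F v ^+ t.+1 * q) =
    f - sqX F v ^+ t.+1 * restrict_vars N.+1 q.
  rewrite -[f in RHS](restrict_id fN) -[sqX F v in RHS](restrict_id (sqX_below (ltnSn N : (v < N.+1)%N))).
  by rewrite /restrict_vars rmorphB rmorphM rmorphXn.
by move=> hT; exists (restrict_vars N.+1 q); split; [apply: restrict_below | apply: hT].
Qed.

End OrthTanisaki.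

(** * Pfaffian equations of the orbit closure *)

Section SignStar.
Variables (R : comNzRingType) (l : nat).
Implicit Types (s : 'S_(l + l)) (p q : 'I_(l + l)) (i j : 'I_l).

Definition star_index p : 'I_l := match split p with inl i => i | inr i => i end.

Lemma star_index_l i : star_index (lshift l i) = i.
Proof. by rewrite /star_index -[lshift l i]/(unsplit (inl i)) unsplitK. Qed.

Lemma star_index_r i : star_index (rshift l i) = i.
Proof. by rewrite /star_index -[rshift l i]/(unsplit (inr i)) unsplitK. Qed.

Lemma star_index_eq p q : star_index p = star_index q -> p = q \/ p = star q.
Proof.
case: (split_ordP p) => i ->; case: (split_ordP q) => j ->;
  rewrite ?(star_index_l, star_index_r) ?(star_l, star_r) => ->; by [left | right].
Qed.

Definition star_perm s := [forall i, s (rshift l i) == star (s (lshift l i))].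

Lemma star_permP s : reflect (forall p, s (star p) = star (s p)) (star_perm s).
Proof.
apply: (iffP forallP) => [sS p|sS i]; last by rewrite -star_l sS.
case: (split_ordP p) => i ->; rewrite ?(star_l, star_r) (eqP (sS i)) //.
by rewrite starK.
Qed.

Lemma star_perm_index_inj s : star_perm s -> injective (fun i => star_index (s (lshift l i))).
Proof.
move=> /star_permP sS i j /star_index_eq[/perm_inj/lshift_inj //|].
by rewrite -sS => /perm_inj; rewrite star_l => /eqP; rewrite eq_lrshift.
Qed.

(* A signed permutation of [l] letters acts on the two eigenspaces of the
   involution [star] by matrices [A + B] and [A - B], which differ by the signs. *)
Lemma sign_star_perm s : star_perm s ->
  (-1) ^+ s = \prod_i sg (s (lshift l i)) :> R.
Proof.
move=> sS; pose P : 'M[R]_(l + l) := perm_mx s.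
pose A : 'M[R]_l := \matrix_(i, j) (s (lshift l i) == lshift l j)%:R.
pose B : 'M[R]_l := \matrix_(i, j) (s (lshift l i) == rshift l j)%:R.
pose t := perm (star_perm_index_inj sS).
have /star_permP sS' := sS.
have PE : P = block_mx A B B A.
  apply/matrixP => p q; rewrite /P [LHS]mxE [LHS]mxE.
  case: (split_ordP p) => i ->; case: (split_ordP q) => j ->.
  - by rewrite block_mxEul mxE.
  - by rewrite block_mxEur mxE.
  - by rewrite block_mxEdl mxE -star_l sS' eq_star star_l.
  - by rewrite block_mxEdr mxE -star_l sS' eq_star star_r.
have Ap : A + B = perm_mx t.
  apply/matrixP => i j; rewrite !mxE permE.
  case: (split_ordP (s (lshift l i))) => u ->; rewrite ?(star_index_l, star_index_r)
    ?eq_lshift ?eq_rshift ?eq_lrshift ?eq_rlshift ?addr0 ?add0r //.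
have Am : A - B = diag_mx (\row_i sg (s (lshift l i))) *m perm_mx t.
  apply/matrixP => i j; rewrite mul_diag_mx !mxE permE.
  case: (split_ordP (s (lshift l i))) => u ->; rewrite ?(star_index_l, star_index_r)
    ?eq_lshift ?eq_rshift ?eq_lrshift ?eq_rlshift ?subr0 ?sub0r ?sg_l ?sg_r ?mul1r ?mulN1r //.
have eP : block_mx 1%:M 1%:M 0 1%:M *m P *m block_mx 1%:M (- 1%:M) 0 1%:M =
   block_mx (A + B) 0 B (A - B).
  rewrite PE !mulmx_block !mul1mx !mul0mx !mulmx1 !mulmx0 !add0r !addr0 !mulmxN !mulmx1.
  by rewrite [B + A]addrC addNr [- B + A]addrC.
have : \det P = \det (A + B) * \det (A - B).
  have := congr1 determinant eP; rewrite det_lblock !det_mulmx !det_ublock !det1 !mul1r.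
  by rewrite !mulr1.
rewrite Ap Am det_mulmx !det_perm det_diag mulrCA -signr_addb addbb mulr1 => ->.
by apply: eq_bigr => i _; rewrite mxE.
Qed.

(** For an alternating matrix, 2^l l! times the Pfaffian. The sum over all permutations makes sense
    for any matrix and commutes with ring morphisms. *)
Definition alt_pf (A : 'M[R]_(l + l)) : R :=
  \sum_(s : 'S_(l + l)) (-1) ^+ s * \prod_i A (s (lshift l i)) (s (rshift l i)).

(** Only the permutations respecting the pairs survive; for these the product of the entry signs
    cancels the sign of the permutation. *)
Lemma alt_pf_standard (D : 'I_l -> R) :
  alt_pf (\matrix_(p, q) (sg p * (q == star p)%:R * D (star_index p))) =
  #|[set s | star_perm s]|%:R * \prod_i D i.
Proof.
rewrite /alt_pf (bigID star_perm) /= [X in _ + X]big1 ?addr0.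
  rewrite -sum1dep_card natr_sum mulr_suml; apply: eq_bigr => s sS.
  have /star_permP sS' := sS.
  under eq_bigr => i _ do rewrite mxE -star_l sS' eqxx mulr1.
  rewrite big_split /= sign_star_perm // mulrA -big_split /=.
  rewrite big1 => [|i _]; last by rewrite sgM.
  by rewrite !mul1r [RHS](reindex_inj (star_perm_index_inj sS)).
move=> s /forallPn[i si]; rewrite (bigD1 i) //= mxE (negPf si).
by rewrite !(mulr0, mul0r).
Qed.

Lemma card_star_perm : (0 < #|[set s | star_perm s]|)%N.
Proof.
by apply/card_gt0P; exists 1%g; rewrite finset.inE; apply/star_permP => p; rewrite !perm1.
Qed.

Definition half_fun T (f g : 'I_l -> T) (p : 'I_(l + l)) : T :=
  match split p with inl i => f i | inr i => g i end.

Lemma half_fun_l T (f g : 'I_l -> T) i : half_fun f g (lshift l i) = f i.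
Proof. by rewrite /half_fun -[lshift l i]/(unsplit (inl i)) unsplitK. Qed.

Lemma half_fun_r T (f g : 'I_l -> T) i : half_fun f g (rshift l i) = g i.
Proof. by rewrite /half_fun -[rshift l i]/(unsplit (inr i)) unsplitK. Qed.

(** A Cauchy-Binet expansion: [f] and [g] choose rows of [B] for the two ends of every pair, and the
    alternating sum becomes the determinant of the chosen rows. *)
Lemma alt_pf_congr N (B : 'M[R]_(N, l + l)) (K : 'M[R]_N) :
  alt_pf (B^T *m K *m B) =
  \sum_(f : {ffun 'I_l -> 'I_N}) \sum_(g : {ffun 'I_l -> 'I_N})
    (\prod_i K (f i) (g i)) * \det (\matrix_(p, q) B (half_fun f g p) q).
Proof.
have E u v : (B^T *m K *m B) u v = \sum_p \sum_q K p q * (B p u * B q v).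
  rewrite mxE exchange_big; apply: eq_bigr => q _; rewrite mxE mulr_suml.
  by apply: eq_bigr => p _; rewrite !mxE -mulrA mulrCA.
rewrite /alt_pf.
under eq_bigr => s _.
  under eq_bigr => i _ do rewrite E.
  rewrite bigA_distr_bigA /=.
  under eq_bigr => f _ do rewrite bigA_distr_bigA /=.
  rewrite mulr_sumr.
  under eq_bigr => f _ do rewrite mulr_sumr.
  over.
rewrite exchange_big; apply: eq_bigr => f _; rewrite exchange_big; apply: eq_bigr => g _ /=.
rewrite /determinant mulr_sumr; apply: eq_bigr => s _.
rewrite big_split /= mulrCA; congr (_ * (_ * _)).
rewrite big_split_ord big_split /=; congr (_ * _); apply: eq_bigr => i _;
  by rewrite mxE ?half_fun_l ?half_fun_r.
Qed.

End SignStar.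

Section AltPfDvd.
Variables (F : numFieldType) (n N l k : nat) (b : 'I_k -> nat) (X : 'I_k -> F).
Variables (K0 : 'M[F]_N) (cls : 'I_N -> 'I_k) (B : 'M[F]_(N, l + l)).
Hypotheses (bn : (\sum_j b j)%N = n).
Hypothesis cls_card : forall j, (#|[set p | cls p == j]| <= 2 * b j)%N.
Hypothesis K0_cls : forall p q, K0 p q != 0 -> cls p = cls q.

(** In a nonzero term the chosen rows are distinct and both ends of a pair have the same class, so
    class j holds at most b_j of the l pairs. The other classes hold at most n - b_j pairs, which
    leaves at least b_j - (n - l) factors t - X_j. *)
Lemma alt_pf_dvd :
  root_poly n b X l %| alt_pf ((map_mx polyC B)^T *m
    (\matrix_(p, q) ((K0 p q)%:P * ('X - (X (cls q))%:P))) *m map_mx polyC B).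
Proof.
rewrite alt_pf_congr.
apply: (big_ind (fun p => root_poly n b X l %| p)) => [|p q|f _]; [exact: dvdp0 | exact: dvdp_add |].
apply: (big_ind (fun p => root_poly n b X l %| p)) => [|p q|g _]; [exact: dvdp0 | exact: dvdp_add |].
have [/injectiveP fg_inj|/injectivePn[p [q pq e]]] := boolP (injectiveb (half_fun f g)); last first.
  rewrite (determinant_alternate pq) ?mulr0 ?dvdp0 // => u.
  by rewrite !mxE e.
apply: dvdp_mulr.
have [/forallP K_neq0|/forallPn[u Ku]] := boolP [forall i, K0 (f i) (g i) != 0]; last first.
  rewrite (bigD1 u) //= mxE; move: Ku; rewrite negbK => /eqP->.
  by rewrite !mul0r dvdp0.
under eq_bigr => i _ do rewrite mxE.
rewrite big_split /=; apply: dvdp_mull.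
pose a j := #|[set i | cls (g i) == j]|.
have a_le j : (a j <= b j)%N.
  rewrite -(leq_pmul2l (isT : 0 < 2)%N); apply: leq_trans (cls_card j).
  pose S := [set p | cls (half_fun f g p) == j].
  have -> : (2 * a j)%N = #|S|.
    rewrite /a /S -!sum1dep_card ![in RHS]big_mkcond big_split_ord /= mul2n -addnn.
    congr (_ + _)%N; rewrite big_mkcond; apply: eq_bigr => i _.
      by rewrite half_fun_l (K0_cls (K_neq0 i)).
    by rewrite half_fun_r.
  rewrite -(card_imset _ fg_inj); apply/subset_leq_card/fintype.subsetP => q.
  by case/imsetP => p; rewrite !finset.inE => pj ->.
have a_sum : (\sum_j a j)%N = l.
  rewrite -[RHS]card_ord -sum1_card (partition_big (fun i => cls (g i)) xpredT) //=.
  by apply: eq_bigr => j _; rewrite /a -sum1dep_card.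
rewrite (partition_big (fun i => cls (g i)) xpredT) //=.
apply: (big_ind2 (fun p q : {poly F} => p %| q)) => //.
  by move=> p1 q1 p2 q2; apply: dvdp_mul.
move=> j _; rewrite (eq_bigr (fun=> 'X - (X j)%:P)); last first.
  by move=> i /eqP <-.
rewrite prodr_const; apply: dvdp_exp2l.
have -> : #|[pred i | cls (g i) == j]| = a j by apply: eq_card => i; rewrite finset.inE.
have le_ab : (\sum_(i | i != j) a i <= \sum_(i | i != j) b i)%N by apply: leq_sum.
have := bn; rewrite (bigD1 j) //=; have := a_sum; rewrite (bigD1 j) //=.
move: le_ab; move: (\sum_(i | _) _)%N (\sum_(i | _) _)%N => x y; lia.
Qed.

End AltPfDvd.

Section Pfaffian.
Variables (n : nat) (L : {set 'I_n}).
Local Notation l := #|L|.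

Definition pair_index (s : 'I_(l + l)) : 'I_(n + n) :=
  match split s with inl i => lshift n (enum_val i) | inr i => rshift n (enum_val i) end.

Lemma pair_index_l i : pair_index (lshift l i) = lshift n (enum_val i).
Proof. by rewrite /pair_index -[lshift l i]/(unsplit (inl i)) unsplitK. Qed.

Lemma pair_index_r i : pair_index (rshift l i) = rshift n (enum_val i).
Proof. by rewrite /pair_index -[rshift l i]/(unsplit (inr i)) unsplitK. Qed.

Definition gen_J (R : comNzRingType) : 'M[R]_(n + n) :=
  \matrix_(p, q) (sg p * (q == star p)%:R).

(* [(2 l)!! pf(J (t - X^2))] restricted to the rows and columns in [L] and
   [star L]; the form is alternating because [X] is in [sp]. *)
Definition sq_pf (R : comNzRingType) (X : 'M[R]_(n + n)) : {poly R} :=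
  alt_pf (mxsub pair_index pair_index
    (gen_J {poly R} *m ('X%:M - map_mx polyC (X *m X)))).

Lemma rmorph_sg (R S : comNzRingType) (f : {rmorphism R -> S}) m (p : 'I_(m + m)) :
  f (sg p) = sg p.
Proof. by case: (split_ordP p) => i ->; rewrite ?sg_l ?sg_r ?rmorphN ?rmorph1. Qed.

Lemma map_gen_J (R S : comNzRingType) (f : {rmorphism R -> S}) :
  map_mx f (gen_J R) = gen_J S.
Proof. by apply/matrixP => p q; rewrite !mxE rmorphM rmorph_sg rmorph_nat. Qed.

Lemma map_alt_pf (R S : comNzRingType) (f : {rmorphism R -> S}) m (A : 'M[R]_(m + m)) :
  f (alt_pf A) = alt_pf (map_mx f A).
Proof.
rewrite /alt_pf rmorph_sum; apply: eq_bigr => s _; rewrite rmorphM rmorph_sign rmorph_prod.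
by congr (_ * _); apply: eq_bigr => i _; rewrite mxE.
Qed.

Lemma map_sq_pf (R S : comNzRingType) (f : {rmorphism R -> S}) (X : 'M[R]_(n + n)) :
  map_poly f (sq_pf X) = sq_pf (map_mx f X).
Proof.
rewrite /sq_pf map_alt_pf map_mxsub map_mxM map_gen_J; congr (alt_pf (mxsub _ _ (_ *m _))).
rewrite map_mxB map_scalar_mx /= map_polyX -map_mxM -!map_mx_comp; congr (_ - _).
by apply/matrixP => p q; rewrite !mxE /= map_polyC.
Qed.

Lemma sq_pf_cartan (R : comNzRingType) (y : 'rV[R]_n) :
  sq_pf (cartan_mx y) = #|[set s | @star_perm l s]|%:R * \prod_(i in L) ('X - (y 0 i ^+ 2)%:P).
Proof.
rewrite big_enum_val -alt_pf_standard /sq_pf; congr alt_pf.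
pose d (p : 'I_(n + n)) := row_mx y (- y) 0 p.
have dE p : d p * d p = y 0 (star_index p) ^+ 2.
  rewrite /d; case: (split_ordP p) => i ->;
    by rewrite ?row_mxEl ?row_mxEr ?(star_index_l, star_index_r) ?mxE ?mulrNN.
have sq : 'X%:M - map_mx polyC (cartan_mx y *m cartan_mx y) =
    diag_mx (\row_p ('X - (y 0 (star_index p) ^+ 2)%:P)) :> 'M[{poly R}]_(n + n).
  rewrite /cartan_mx mulmx_diag (_ : \row_j _ = \row_p (y 0 (star_index p) ^+ 2)); last first.
    by apply/rowP => p; rewrite mxE [RHS]mxE -/(d p) dE.
  apply/matrixP => p q; rewrite !mxE.
  by case: (p == q); rewrite ?mulr1n // !mulr0n polyC0 subr0.
apply/matrixP => u v; rewrite sq mul_mx_diag !mxE.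
by case: (split_ordP u) => i ->; case: (split_ordP v) => j ->;
  rewrite ?(pair_index_l, pair_index_r) ?(star_l, star_r) ?(star_index_l, star_index_r)
    ?sg_l ?sg_r ?eq_lshift ?eq_rshift ?eq_lrshift ?eq_rlshift ?(inj_eq enum_val_inj)
    ?mulr0 ?mul0r //; case: eqP => [->|_]; rewrite ?mulr0 ?mul0r.
Qed.

End Pfaffian.

(** * Semisimple deformation of the nilradical *)

Section Diagonalize.
Variables (F : numFieldType) (N : nat) (rho : 'I_N -> int) (d : 'I_N -> F) (u : 'M[F]_N).
Hypothesis u_upper : forall p q, u p q != 0 -> rho p < rho q.
Hypothesis d_inj : forall p q, rho p < rho q -> d p != d q.

(* [V = 1 + M] conjugates [diag d + u] to [diag d] if and only if [M] is a fixed
   point of [step]; iterating [step] from [0] reaches a fixed point because the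
   successive differences lie higher and higher above the diagonal. *)
Let step (M : 'M[F]_N) : 'M[F]_N := \matrix_(p, q) ((u + u *m M) p q / (d q - d p)).

Lemma upper_diagonalize : exists2 V, V \in unitmx & (diag_mx (\row_p d p) + u) *m V =
  V *m diag_mx (\row_p d p).
Proof.
have stepE C p q : step C p q = (u p q + (u *m C) p q) / (d q - d p).
  by rewrite mxE [X in X / _]mxE.
have step_diff m p q : (iter m.+1 step 0 - iter m step 0) p q != 0 ->
    rho p + m.+1%:Z <= rho q.
  elim: m p q => [|m IH] p q.
    rewrite /= subr0 mxE mulmx0 addr0 mulf_eq0 negb_or => /andP[/u_upper h _].
    by move: h; lia.
  rewrite [iter m.+2 _ _]iterS [X in _ - X]iterS.
  set A := iter m.+1 step 0 in IH *; set B := iter m step 0 in IH *.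
  have -> : (step A - step B) p q = (u *m (A - B)) p q / (d q - d p).
    have subE (C D : 'M[F]_N) : (C - D) p q = C p q - D p q by rewrite !mxE.
    by rewrite mulmxBr !subE !stepE -mulrBl; congr (_ / _); ring.
  rewrite mulf_eq0 negb_or => /andP[uAB _].
  have [t /andP[ut ABt]] : exists t, (u p t != 0) && ((A - B) t q != 0).
    apply/existsP; apply: contraNT uAB => /existsPn h; rewrite mxE big1 // => t _.
    by apply/eqP; rewrite mulf_eq0; have := h t; rewrite negb_and !negbK.
  by have := IH _ _ ABt; have := u_upper ut; lia.
have iter_upper m p q : iter m step 0 p q != 0 -> rho p < rho q.
  elim: m p q => [|m IH] p q; first by rewrite mxE eqxx.
  rewrite iterS stepE mulf_eq0 negb_or => /andP[uM _].
  have [/u_upper //|/negPn/eqP up] := boolP (u p q != 0).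
  have [t /andP[ut Mt]] : exists t, (u p t != 0) && (iter m step 0 t q != 0).
    apply/existsP; apply: contraNT uM => /existsPn h; rewrite up add0r mxE big1 // => t _.
    by apply/eqP; rewrite mulf_eq0; have := h t; rewrite negb_and !negbK.
  exact: lt_trans (u_upper ut) (IH _ _ Mt).
pose S : int := \sum_p `|rho p|.
have hS p : `|rho p| <= S by rewrite /S (bigD1 p) //= lerDl sumr_ge0.
pose m := absz (2 * S); pose M := iter m step 0.
have Mfix : step M = M.
  apply/eqP; rewrite -subr_eq0; apply/eqP/matrixP => p q; rewrite [RHS]mxE.
  apply/eqP; apply: contraT => /(step_diff m p q).
  by have := hS p; have := hS q; rewrite /m; lia.
have M_upper p q : M p q != 0 -> rho p < rho q by apply: iter_upper.
exists (1%:M + M).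
  apply: (ranked_triangular_unit (rho := rho)) => [p|p q].
    rewrite !mxE eqxx; have -> : M p p = 0; last by rewrite addr0 oner_neq0.
    by apply/eqP; apply: contraT => /M_upper; rewrite ltxx.
  by rewrite !mxE => h /negPf pq; apply: M_upper; rewrite pq add0r in h.
rewrite mulmxDl !mulmxDr mulmxDl !mulmx1 mul1mx -addrA; congr (_ + _).
have E p q : M p q * (d q - d p) = u p q + (u *m M) p q.
  case: (ltP (rho p) (rho q)) => pq.
    rewrite -{1}Mfix stepE mulfVK // subr_eq0 eq_sym; exact: d_inj.
  have u0 : u p q = 0 by apply/eqP; apply: contraTT pq => /u_upper; rewrite -ltNge.
  have M0 : M p q = 0 by apply/eqP; apply: contraTT pq => /M_upper; rewrite -ltNge.
  rewrite u0 M0 mul0r add0r mxE big1 // => t _.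
  case: (eqVneq (u p t) 0) => [->|ut]; first by rewrite mul0r.
  case: (eqVneq (M t q) 0) => [->|Mt]; first by rewrite mulr0.
  by move: pq; rewrite leNgt (lt_trans (u_upper ut) (M_upper _ _ Mt)).
apply/matrixP => p q; rewrite mul_diag_mx mul_mx_diag.
rewrite mxE [(u + _) p q]mxE -E !mxE; ring.
Qed.

End Diagonalize.

Lemma poly_eq0_punctured (F : numFieldType) (p : {poly F}) :
  (forall s, s != 0 -> p.[s] = 0) -> p = 0.
Proof.
move=> p0; apply/eqP; apply: contraT => pn0.
pose rs := [seq (i.+1)%:R : F | i <- iota 0 (size p)].
have : (size rs < size p)%N.
  apply: max_poly_roots => //.
    by apply/allP => _ /mapP[i _ ->]; apply/eqP/p0; rewrite pnatr_eq0.
  rewrite map_inj_uniq ?iota_uniq // => i j /eqP; rewrite eqr_nat => /eqP[].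
  by [].
by rewrite size_map size_iota ltnn.
Qed.

Section SqPfUpper.
Variables (F : numFieldType) (n k : nat) (b : 'I_k -> nat) (L : {set 'I_n}).
Variables (ht : 'I_(n + n) -> int) (lab : 'I_n -> 'I_k).
Hypothesis ht_star : forall p, ht (star p) = - ht p.
Hypothesis ht_neq0 : forall p, ht p != 0.
Hypothesis ht_lab : forall p q, lab (star_index p) = lab (star_index q) <->
  ht p = ht q \/ ht p = - ht q.
Hypothesis lab_card : forall j, #|[set i | lab i == j]| = b j.
Implicit Types (p q : 'I_(n + n)).

Let bn : (\sum_j b j)%N = n.
Proof.
rewrite -[RHS]card_ord -sum1_card (partition_big lab xpredT) //=.
by apply: eq_bigr => j _; rewrite -lab_card -sum1dep_card.
Qed.

Let cls p := lab (star_index p).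

Let cls_card j : (#|[set p | cls p == j]| <= 2 * b j)%N.
Proof.
rewrite -sum1dep_card big_mkcond big_split_ord /= mul2n -addnn -lab_card.
rewrite -sum1dep_card [in leqRHS]big_mkcond; apply/eq_leq.
by congr (_ + _)%N; apply: eq_bigr => i _; rewrite /cls ?star_index_l ?star_index_r.
Qed.

(** Entries of a generic element of the center of l: odd under [star], constant on heights, with
    squares that distinguish the classes. *)
Let dval p : F := (if 0 < ht p then 1 else -1) * ((cls p).+1)%:R.

Lemma map_sympJ (K : fieldType) : @gen_J n K = sympJ.
Proof. by apply/matrixP => p q; rewrite mxE sympJE. Qed.

(** The matrix [V] that conjugates D + u to D need not be symplectic, so the form J turns into [K0].
    As X is in sp, [K0] pairs only eigenvectors with opposite eigenvalues, that is, indices of the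
    same class, which is what [alt_pf_dvd] requires. *)
Lemma sq_pf_dvd s g u : s != 0 -> Sp g -> u \in upper F ht ->
  root_poly n b (fun j => (s * (j.+1)%:R) ^+ 2) #|L| %|
    sq_pf L (g *m (diag_mx (\row_p (s * dval p)) + u) *m invmx g).
Proof.
move=> s0 gS /mem_upper[us uu]; set D := diag_mx _.
have gu := Sp_unit gS.
have ht_cls p q : ht p != ht q -> dval p != dval q.
  move=> pq; rewrite /dval; have [/ht_lab[e|e]|npq] := eqVneq (cls p) (cls q).
  - by rewrite e eqxx in pq.
  - have e' : cls p = cls q by apply/ht_lab; right.
    rewrite e e'; have := ht_neq0 q; case: (ltgtP (ht q) 0) => // hq _.
      rewrite oppr_gt0 hq mul1r mulN1r -subr_eq0 opprK -mulr2n mulrn_eq0 /=.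
      by rewrite pnatr_eq0.
    rewrite oppr_gt0 lt_gtF // mul1r mulN1r eq_sym -subr_eq0 opprK -mulr2n mulrn_eq0 /=.
    by rewrite pnatr_eq0.
  apply: contraNneq npq => e; apply/eqP/val_inj/eq_add_S/eqP.
  rewrite -(eqr_nat F); move/(congr1 Num.norm): e; rewrite !normrM !normr_nat.
  by case: ifP => _; case: ifP => _; rewrite ?normrN !normr1 !mul1r => ->.
have [V Vu VD] : exists2 V, V \in unitmx & (D + u) *m V = V *m D.
  apply: (upper_diagonalize (rho := ht)) => // p q lt; rewrite (inj_eq (mulfI s0)).
  by apply: ht_cls; rewrite lt_eqF.
pose W := g *m V; have Wu : W \in unitmx by rewrite unitmx_mul gu.
set X := g *m (D + u) *m invmx g.
have XW : X *m W = W *m D by rewrite /X /W -!mulmxA (mulKmx gu) VD.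
have dstar p : dval (star p) = - dval p.
  rewrite /dval ht_star; have -> : cls (star p) = cls p.
    by apply/ht_lab; right; rewrite ht_star.
  have := ht_neq0 p; rewrite oppr_gt0; case: (ltgtP (ht p) 0) => // _ _.
    by rewrite mul1r mulN1r opprK.
  by rewrite mul1r mulN1r.
have Xs : X \in sp.
  apply: conj_sp => //; apply: memvD => //; apply/spP => p q; rewrite !mxE.
  rewrite (inj_eq (@star_inj n)) eq_sym; case: eqP => [->|_]; last by rewrite !mulr0n mulr0.
  by rewrite !mulr1n dstar sgM mulN1r mulrN.
clearbody X W.
have JX : sympJ *m X = - (X^T *m sympJ).
  by move: Xs; rewrite mem_sp addrC addr_eq0 => /eqP.
pose K0 := W^T *m sympJ *m W.
have KD : K0 *m D = - (D *m K0).
  rewrite /K0 -!mulmxA -XW [sympJ *m (X *m W)]mulmxA JX mulNmx mulmxN !mulmxA.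
  by rewrite -trmx_mul XW trmx_mul tr_diag_mx.
have K0E : K0 = W^T *m sympJ *m W by [].
clearbody K0; have K0_cls p q : K0 p q != 0 -> cls p = cls q.
  move=> Kpq; have := congr1 (fun A : 'M_(n + n) => A p q) KD.
  rewrite mul_mx_diag [RHS]mxE mul_diag_mx !mxE => /eqP.
  rewrite -subr_eq0 opprK mulrC -mulrDl mulf_eq0 (negPf Kpq) orbF -mulrDr mulf_eq0 (negPf s0) /=.
  rewrite -[dval p]opprK -dstar subr_eq0 => /eqP e.
  have : ht q = ht (star p) by apply/eqP; apply: contraT => /ht_cls; rewrite e eqxx.
  by rewrite ht_star => e'; apply/ht_lab; right; rewrite e' opprK.
have XE : X = W *m D *m invmx W by rewrite -XW mulmxK.
have XX : X *m X = W *m (D *m D) *m invmx W.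
  by rewrite {2}XE !mulmxA XW.
pose B := colsub (@pair_index n L) (invmx W).
suff -> : sq_pf L X = alt_pf ((map_mx polyC B)^T *m
    (\matrix_(p, q) ((K0 p q)%:P * ('X - ((s * ((cls q).+1)%:R) ^+ 2)%:P))) *m map_mx polyC B).
  exact: alt_pf_dvd.
rewrite /sq_pf; congr alt_pf.
have -> : gen_J n {poly F} *m ('X%:M - map_mx polyC (X *m X)) =
  (map_mx polyC (invmx W))^T *m
  (\matrix_(p, q) ((K0 p q)%:P * ('X - ((s * ((cls q).+1)%:R) ^+ 2)%:P))) *m
  map_mx polyC (invmx W).
  set K := matrix_of_fun _ _.
  have -> : K = map_mx polyC K0 *m ('X%:M - map_mx polyC (D *m D)).
    rewrite /D mulmx_diag map_diag_mx -diag_const_mx -linearB mul_mx_diag.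
    apply/matrixP => p q; rewrite !mxE; congr (_ * ('X - _%:P)).
    rewrite /dval; case: ifP => _; rewrite ?mul1r ?mulN1r; ring.
  rewrite map_trmx K0E XX !map_mxM.
  have mWV : map_mx polyC W *m map_mx polyC (invmx W) = 1%:M.
    by rewrite -map_mxM mulmxV // map_mx1.
  have mWVt : (map_mx polyC (invmx W^T)) *m map_mx polyC W^T = 1%:M.
    by rewrite -map_mxM mulVmx ?unitmx_tr // map_mx1.
  rewrite trmx_inv !mulmxA mWVt mul1mx -(map_gen_J _ polyC) map_sympJ -!mulmxA; congr (_ *m _).
  rewrite mulmxBl mulmxBr [in RHS]mul_scalar_mx -scalemxAr mWV scalemx1.
  by rewrite !mulmxA.
apply/matrixP => i j; rewrite !mxE; apply: eq_bigr => q _; rewrite !mxE.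
by congr (_ * _); apply: eq_bigr => p _; rewrite !mxE.
Qed.

(** Specialization from s != 0 to s = 0: division by the monic [Q] over the polynomials in s leaves
    a remainder that vanishes at every nonzero s, hence is 0. At s = 0, [Q] becomes the power of t
    in the statement. *)
Lemma sq_pf_upper g u : Sp g -> u \in upper F ht ->
  'X^(excess n b #|L|) %| sq_pf L (g *m u *m invmx g).
Proof.
move=> gS uU; set D := diag_mx (\row_p dval p).
pose XX : 'M[{poly F}]_(n + n) := map_mx polyC (g *m u *m invmx g) +
  'X *: map_mx polyC (g *m D *m invmx g).
pose Q : {poly {poly F}} :=
  \prod_(j < k) ('X - ((j.+1)%:R ^+ 2 *: 'X^2)%:P) ^+ (b j - (n - #|L|)).
have Qm : Q \is monic by apply: monic_prod => j _; apply/monic_exp/monicXsubC.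
have evX s : map_mx (horner_eval s) XX = g *m (diag_mx (\row_p (s * dval p)) + u) *m invmx g.
  have -> : diag_mx (\row_p (s * dval p)) = s *: D.
    by apply/matrixP => p q; rewrite !mxE; case: (p == q); rewrite ?mulr1n // !mulr0n mulr0.
  rewrite mulmxDr mulmxDl -scalemxAr -scalemxAl addrC /XX.
  move: (g *m u *m invmx g) (g *m D *m invmx g) => A B; apply/matrixP => p q.
  by rewrite !mxE /horner_eval hornerD hornerM hornerX !hornerC.
have evQ s : map_poly (horner_eval s) Q = root_poly n b (fun j => (s * (j.+1)%:R) ^+ 2) #|L|.
  rewrite /Q rmorph_prod; apply: eq_bigr => j _; rewrite rmorphXn /= map_polyXsubC.
  congr (('X - _%:P) ^+ _); rewrite /= /horner_eval hornerZ hornerXn; ring.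
have evR s : map_poly (horner_eval s) (sq_pf L XX) =
    sq_pf L (g *m (diag_mx (\row_p (s * dval p)) + u) *m invmx g).
  by rewrite map_sq_pf evX.
have divE := Pdiv.RingMonic.rdivp_eq Qm (sq_pf L XX).
set R := Pdiv.Ring.rmodp _ _ in divE; set M := Pdiv.Ring.rdivp _ _ in divE.
have R0 : R = 0.
  apply/polyP => i; rewrite coef0; apply: poly_eq0_punctured => s s0.
  have := congr1 (map_poly (horner_eval s)) divE; rewrite evR rmorphD rmorphM /= evQ => e.
  have dQ : root_poly n b (fun j => (s * (j.+1)%:R) ^+ 2) #|L| %| map_poly (horner_eval s) R.
    rewrite -(dvdp_addr _ (dvdp_mull (map_poly (horner_eval s) M) (dvdpp _))) -e.
    exact: sq_pf_dvd.
  have sR : (size (map_poly (horner_eval s) R) <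
       size (root_poly n b (fun j => (s * (j.+1)%:R) ^+ 2) #|L|))%N.
    apply: leq_ltn_trans (size_poly _ _) _.
    have := Pdiv.Ring.ltn_rmodpN0 (sq_pf L XX) (monic_neq0 Qm); rewrite -/R -(evQ s).
    have -> : size (map_poly (horner_eval s) Q) = size Q.
      by rewrite size_map_poly_id0 // (monicP Qm) rmorph1 oner_neq0.
    by [].
  have : map_poly (horner_eval s) R = 0.
    by apply/eqP; apply: contraT => Rs0; have := dvdp_leq Rs0 dQ; rewrite leqNgt sR.
  by move/polyP/(_ i); rewrite coef_map coef0.
have := congr1 (map_poly (horner_eval 0)) divE; rewrite evR R0 addr0 rmorphM /= evQ.
have -> : diag_mx (\row_p (0 * dval p)) = 0.
  by apply/matrixP => p q; rewrite !mxE mul0r mul0rn.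
rewrite add0r => ->; apply: dvdp_mull.
rewrite (_ : root_poly _ _ _ _ = 'X^(excess n b #|L|)) ?dvdpp //.
rewrite /root_poly /excess -prodrXr; apply: eq_bigr => j _.
by rewrite mul0r expr0n subr0.
Qed.

End SqPfUpper.

Section ClosureEquations.
Variables (F : numFieldType) (n k : nat) (b : 'I_k -> nat).
Variables (ht : 'I_(n + n) -> int) (lab : 'I_n -> 'I_k).
Hypothesis ht_star : forall p, ht (star p) = - ht p.
Hypothesis ht_neq0 : forall p, ht p != 0.
Hypothesis ht_lab : forall p q, lab (star_index p) = lab (star_index q) <->
  ht p = ht q \/ ht p = - ht q.
Hypothesis lab_card : forall j, #|[set i | lab i == j]| = b j.

Lemma map_generic_mx m (M : 'M[{mpoly F[m]}]_(n + n)) :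
  map_mx (comp_mpoly [tuple mxvec M 0 j | j < (n + n) * (n + n)]) (generic_mx F (n + n)) = M.
Proof.
apply/matrixP => i j; rewrite !mxE comp_mpolyXU -tnth_nth tnth_mktuple.
by rewrite mxvecE.
Qed.

(** The Pfaffian of the generic matrix is used: its coefficient of index |L| - p < excess vanishes
    on the saturation and restricts to e_p up to a sign and the factor [c]. *)
Lemma esq_restriction (L : {set 'I_n}) p : (p <= #|L|)%N ->
    (#|L| < p + excess n b #|L|)%N ->
  exists f : {mpoly F[(n + n) * (n + n)]},
    (forall X, upper_conj ht X -> mxeval f X = 0) /\ restrict_to_cartan f = esq F L p.
Proof.
move=> pL lt; pose Phi := sq_pf L (generic_mx F (n + n)).
pose c : F := #|[set s | @star_perm #|L| s]|%:R.
have c0 : c != 0 by rewrite pnatr_eq0 -lt0n card_star_perm.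
exists ((c^-1)%:MP * ((-1) ^+ p * Phi`_(#|L| - p))); split.
  move=> X [g [u [gS uU ->]]]; rewrite /mxeval !mevalM.
  suff -> : (Phi`_(#|L| - p)).@[mxvec (g *m u *m invmx g) 0] = 0 by rewrite !mulr0.
  have -> : (Phi`_(#|L| - p)).@[mxvec (g *m u *m invmx g) 0] =
      (map_poly (meval (mxvec (g *m u *m invmx g) 0)) Phi)`_(#|L| - p).
    by rewrite coef_map.
  rewrite map_sq_pf meval_generic_mx.
  have /dvdpP[q ->] := sq_pf_upper L ht_star ht_neq0 ht_lab lab_card gS uU.
  by rewrite coefMXn ifT //; lia.
rewrite /restrict_to_cartan rmorphM rmorphM /= comp_mpolyC.
set tp := [tuple _ | _ < _].
have -> : Phi`_(#|L| - p) \mPo tp = (map_poly (comp_mpoly tp) Phi)`_(#|L| - p).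
  by rewrite coef_map.
rewrite map_sq_pf map_generic_mx sq_pf_cartan.
have -> : \prod_(i in L) ('X - ((\row_i 'X_i : 'rV[{mpoly F[n]}]_n) 0 i ^+ 2)%:P) = sq_poly F L.
  by apply: eq_bigr => i _; rewrite mxE.
rewrite -(rmorph_nat polyC) coefCM rmorphXn rmorphN1 /= /esq pL mulrCA; congr (_ * _).
by rewrite mulrA -mpolyC_nat -mpolyCM mulVf // mpolyC1 mul1r.
Qed.

End ClosureEquations.

(** * Cyclic matrices in the orbit closure *)

Section Lagrangian.
Variables (F : numFieldType) (n : nat).
Implicit Types (W Z : 'M[F]_(n + n, n)) (X : 'M[F]_(n + n)).
Local Notation J := (@sympJ F n).

(** First [Z] is normalized to be dual to [W]; adding W times half of its Gram matrix then makes it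
    isotropic without changing the pairing with [W]. *)
Lemma lagrangian_completion W Z : W^T *m J *m W = 0 -> W^T *m J *m Z \in unitmx ->
  exists W', Sp (row_mx W W').
Proof.
move=> WW WZu; pose Z' := Z *m invmx (W^T *m J *m Z).
have WZ' : W^T *m J *m Z' = 1%:M by rewrite mulmxA mulmxV.
clearbody Z'; have Z'W : Z'^T *m J *m W = - 1%:M.
  by rewrite -[1%:M]trmx1 -WZ' !trmx_mul trmxK trmx_sympJ mulNmx mulmxN mulmxA opprK.
pose S := Z'^T *m J *m Z'.
have ST : S^T = - S.
  by rewrite /S !trmx_mul trmxK trmx_sympJ mulNmx mulmxN mulmxA.
exists (Z' + W *m (2^-1 *: S)).
set T := 2^-1 *: S.
have TT : T^T = - T by rewrite /T linearZ /= ST scalerN.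
have STT : S - T - T = 0.
  have h : (2^-1 + 2^-1 : F) = 1 by field.
  by rewrite -addrA -opprD /T -scalerDl h scale1r subrr.
clearbody T; rewrite /Sp /= tr_row_mx mul_col_mx mul_col_row WW.
have -> : W^T *m J *m (Z' + W *m T) = 1%:M by rewrite mulmxDr WZ' mulmxA WW mul0mx addr0.
have -> : (Z' + W *m T)^T *m J *m W = - 1%:M.
  by rewrite linearD /= !mulmxDl Z'W trmx_mul -!mulmxA (mulmxA W^T) WW mulmx0 addr0.
rewrite (_ : _ *m (Z' + _) = 0) //.
have e1 : (W *m T)^T *m J *m Z' = - T.
  by rewrite trmx_mul -!mulmxA (mulmxA W^T) WZ' mulmx1.
have e2 : Z'^T *m J *m (W *m T) = - T by rewrite mulmxA Z'W mulNmx mul1mx.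
have e3 : (W *m T)^T *m J *m (W *m T) = 0.
  by rewrite mulmxA trmx_mul -!mulmxA (mulmxA J) (mulmxA W^T) (mulmxA W^T) WW mul0mx mulmx0.
by rewrite mulmxDr linearD /= !mulmxDl e1 e2 e3 addr0.
Qed.

(** In a symplectic basis starting with [W], the matrix of X has upper left block [A] and lower left
    block 0. The lower right block is determined by [A], and the upper right one is unconstrained
    because heights are negative on the first half and positive on the second. *)
Lemma lagrangian_upper W Z X (A : 'M[F]_n) (ht : 'I_(n + n) -> int) :
    X \in sp -> W^T *m J *m W = 0 -> W^T *m J *m Z \in unitmx -> X *m W = W *m A ->
    (forall p, ht (star p) = - ht p) -> (forall i, ht (lshift n i) < 0) ->
    (forall i j, A i j != 0 -> ht (lshift n i) < ht (lshift n j)) ->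
  upper_conj ht X.
Proof.
move=> Xs WW WZ XW ht_star ht_neg hA.
have [W' gS] := lagrangian_completion WW WZ; pose g := row_mx W W'; rewrite -/g in gS.
have gu := Sp_unit gS; pose Y := invmx g *m X *m g.
have Ys : Y \in sp by rewrite /Y -{2}[g]invmxK; apply: conj_sp => //; apply: Sp_inv.
have XE : X = g *m Y *m invmx g.
  by rewrite /Y !mulmxA mulmxV // mul1mx mulmxK.
exists g, Y; split=> //; apply/mem_upper; split=> //.
have YE : lsubmx Y = col_mx A 0.
  apply: (can_inj (mulKmx gu)); rewrite mulmx_lsub.
  have -> : g *m Y = row_mx (X *m W) (X *m W').
    by rewrite /Y !mulmxA mulmxV // mul1mx /g mul_mx_row.
  by rewrite row_mxKl /g mul_row_col mulmx0 addr0.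
clearbody Y.
have Yl i j : Y (lshift n i) (lshift n j) = A i j.
  by have := congr1 (fun M : 'M_(n + n, n) => M (lshift n i) j) YE; rewrite mxE col_mxEu.
have Yr i j : Y (rshift n i) (lshift n j) = 0.
  by have := congr1 (fun M : 'M_(n + n, n) => M (rshift n i) j) YE; rewrite mxE col_mxEd mxE.
move=> p q; case: (split_ordP p) => i ->; case: (split_ordP q) => j ->.
- by rewrite Yl; apply: hA.
- by move=> _; rewrite -star_l ht_star; have := ht_neg i; have := ht_neg j; lia.
- by rewrite Yr eqxx.
rewrite -2!star_l; move/spP: Ys => ->; rewrite Yl mulf_eq0 negb_or => /andP[_ /hA].
by rewrite !ht_star; lia.
Qed.

End Lagrangian.

Section PolyAction.
Variables (F : fieldType) (N : nat) (X : 'M[F]_N) (v : 'cV[F]_N).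

Definition powv i : 'cV[F]_N := iter i (mulmx X) v.

(** The vector P(X) v, expressed by the Krylov vectors [powv]. *)
Definition actv (P : {poly F}) : 'cV[F]_N := \sum_(i < size P) P`_i *: powv i.

Lemma actvE m (P : {poly F}) : (size P <= m)%N -> actv P = \sum_(i < m) P`_i *: powv i.
Proof.
move=> sP; rewrite /actv (big_ord_widen m (fun i => P`_i *: powv i) sP) big_mkcond.
by apply: eq_bigr => i _; case: ltnP => // h; rewrite nth_default // scale0r.
Qed.

Lemma powvS i : powv i.+1 = X *m powv i.
Proof. by []. Qed.

Lemma powvD i j : iter i (mulmx X) (powv j) = powv (i + j).
Proof. by rewrite /powv iterD. Qed.

Lemma actv_sum I (r : seq I) (f : I -> {poly F}) : actv (\sum_(i <- r) f i) =
  \sum_(i <- r) actv (f i).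
Proof.
have addv p q : actv (p + q) = actv p + actv q.
  have h1 : (size p <= maxn (size p) (size q))%N by apply: leq_maxl.
  have h2 : (size q <= maxn (size p) (size q))%N by apply: leq_maxr.
  rewrite (actvE h1) (actvE h2) (actvE (size_polyD p q)) -big_split.
  by apply: eq_bigr => i _; rewrite coefD scalerDl.
elim: r => [|i r IH]; last by rewrite !big_cons addv IH.
by rewrite !big_nil /actv size_poly0 big_ord0.
Qed.

Lemma actvZXn c i : actv (c *: 'X^i) = c *: powv i.
Proof.
have h : (size (c *: 'X^i : {poly F}) <= i.+1)%N.
  by apply: leq_trans (size_scale_leq _ _) _; rewrite size_polyXn.
rewrite (actvE h) (bigD1 ord_max) //= coefZ coefXn eqxx mulr1 big1 ?addr0 // => j.
rewrite -val_eqE /= => /negPf ji; by rewrite coefZ coefXn ji mulr0 scale0r.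
Qed.

Lemma actv_XsubC d P : actv (('X - d%:P) * P) = X *m actv P - d *: actv P.
Proof.
rewrite -[P]coefK poly_def mulr_sumr !actv_sum mulmx_sumr scaler_sumr -sumrB.
apply: eq_bigr => i _; rewrite mulrBl -scalerAr -exprS -mul_polyC -mul_polyC.
have -> : (P`_i)%:P * 'X^(i.+1) - d%:P * ((P`_i)%:P * 'X^i) =
   \sum_(Q <- [:: P`_i *: 'X^(i.+1); (- (d * P`_i)) *: 'X^i]) Q.
  by rewrite !big_cons big_nil addr0 -!mul_polyC polyCN polyCM mulNr mulrA.
rewrite actv_sum !big_cons big_nil addr0 mul_polyC !actvZXn powvS -scalemxAr.
by rewrite scaleNr scalerA.
Qed.

End PolyAction.

Section Positions.
Variables (n : nat) (col : 'I_n -> nat).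
Implicit Types (p q : 'I_(n + n)) (u w : 'I_n).

Lemma star_index_star p : star_index (star p) = star_index p.
Proof.
by case: (split_ordP p) => i ->; rewrite ?(star_l, star_r) ?(star_index_l, star_index_r).
Qed.

Definition colp p := col (star_index p).
Definition csize c := #|column n col c|.

(* The chain of each column: its variables in increasing order, followed by
   their duals in decreasing order. *)
Definition pos p : nat :=
  match split p with
  | inl i => crank col i
  | inr i => (2 * csize (col i)).-1 - crank col i
  end.

Lemma pos_l i : pos (lshift n i) = crank col i.
Proof. by rewrite /pos -[lshift n i]/(unsplit (inl i)) unsplitK. Qed.

Lemma pos_r i : pos (rshift n i) = ((2 * csize (col i)).-1 - crank col i)%N.
Proof. by rewrite /pos -[rshift n i]/(unsplit (inr i)) unsplitK. Qed.

Lemma colp_l i : colp (lshift n i) = col i.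
Proof. by rewrite /colp star_index_l. Qed.

Lemma colp_r i : colp (rshift n i) = col i.
Proof. by rewrite /colp star_index_r. Qed.

Lemma colp_star p : colp (star p) = colp p.
Proof. by rewrite /colp star_index_star. Qed.

Lemma crank_csize u : (crank col u < csize (col u))%N.
Proof. exact: crank_column. Qed.

Lemma pos_lt p : (pos p < 2 * csize (colp p))%N.
Proof.
by case: (split_ordP p) => i ->; rewrite ?(pos_l, pos_r) ?(colp_l, colp_r);
  have := crank_csize i; lia.
Qed.

Lemma pos_star p : (pos (star p) + pos p).+1 = (2 * csize (colp p))%N.
Proof.
by case: (split_ordP p) => i ->; rewrite ?(star_l, star_r) ?(pos_l, pos_r) ?(colp_l, colp_r);
  have := crank_csize i; lia.
Qed.

Lemma pos_inj p q : colp p = colp q -> pos p = pos q -> p = q.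
Proof.
case: (split_ordP p) => i ->; case: (split_ordP q) => j ->;
  rewrite ?(pos_l, pos_r) ?(colp_l, colp_r) => cij;
  have := crank_csize i; have := crank_csize j; rewrite cij => hj hi e.
- by rewrite (crank_inj cij e).
- by exfalso; move: hi hj e; lia.
- by exfalso; move: hi hj e; lia.
- by rewrite (crank_inj cij) //; move: hi hj e; lia.
Qed.

Lemma card_colp c : #|[set p | colp p == c]| = (2 * csize c)%N.
Proof.
rewrite -sum1dep_card big_mkcond big_split_ord /= mul2n -addnn /csize /column.
rewrite -sum1dep_card [in RHS]big_mkcond.
by congr (_ + _)%N; apply: eq_bigr => i _; rewrite ?(colp_l, colp_r) ltn_ord.
Qed.

Lemma pos_surj c i : (i < 2 * csize c)%N -> exists p, colp p = c /\ pos p = i.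
Proof.
move=> ic; have h1 : {in [set p | colp p == c] &, injective pos}.
  by move=> p q; rewrite !inE => /eqP pc /eqP qc; apply: pos_inj; rewrite pc qc.
have h2 : {in [set p | colp p == c], forall p, (pos p < #|[set p | colp p == c]|)%N}.
  by move=> p; rewrite inE card_colp => /eqP <-; apply: pos_lt.
rewrite -card_colp in ic; have [p pc pi] := inj_lt_surj h1 h2 ic; exists p.
by split=> //; move: pc; rewrite inE => /eqP.
Qed.

Lemma sg_pos (R : comNzRingType) p : sg p = (if (pos p < csize (colp p))%N then 1 else -1) :> R.
Proof.
case: (split_ordP p) => i ->; rewrite ?(pos_l, pos_r) ?(colp_l, colp_r) ?(sg_l, sg_r);
  have h := crank_csize i; case: ltnP => // h'; exfalso; move: h h'; lia.
Qed.

End Positions.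

Section Cyclic.
Variables (F : numFieldType) (n : nat) (col : 'I_n -> nat) (y : 'rV[F]_n).
Implicit Types (p q t : 'I_(n + n)) (u w : 'I_n).
Local Notation colp := (colp col).
Local Notation csize := (csize col).
Local Notation pos := (pos col).

(** The signs [sg p] put the shift into sp. For a chain of length 2m they multiply to (-1)^(m-1)
    over the steps before the last one; the closing entry (-1)^m makes the product around the chain
    -1, which is to cancel the constant term of t^(2m) - 1. *)
Definition cyclic_mx : 'M[F]_(n + n) := \matrix_(q, p)
  if colp q == colp p then
    if pos q == (pos p).+1 then sg p
    else if (pos q == 0%N) && ((pos p).+1 == 2 * csize (colp p))%N
    then (-1) ^+ csize (colp p) else 0
  else 0.

Lemma cyclic_sp : cyclic_mx \in sp.
Proof.
apply/spP => p q; rewrite !mxE !colp_star eq_sym; case: eqP => [cpq|_]; last by rewrite mulr0.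
have := pos_star col p; have := pos_star col q.
have := pos_lt col p; have := pos_lt col q; rewrite -cpq => q_lt p_lt qs ps.
have -> : (pos (star q) == (pos (star p)).+1) = (pos p == (pos q).+1).
  by apply/eqP/eqP; lia.
have -> : (pos (star q) == 0%N) = ((pos q).+1 == 2 * csize (colp p))%N.
  by apply/eqP/eqP; lia.
have -> : ((pos (star p)).+1 == 2 * csize (colp p))%N = (pos p == 0%N).
  by apply/eqP/eqP; lia.
rewrite sg_star; case: eqP => pq; first by rewrite mulNr -mulrA sgM mulr1.
rewrite andbC; case: (boolP (_ && _)) => [/andP[/eqP p0 /eqP ql]|_]; last by rewrite mulr0.
have -> : sg p = 1 :> F by rewrite (sg_pos col) p0; case: ltnP => //; lia.
have -> : sg q = -1 :> F by rewrite (sg_pos col) -cpq; case: ltnP => //; lia.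
by rewrite mul1r opprK mul1r.
Qed.

Definition dval p : F := row_mx y (- y) 0 p.

Lemma dval_star p : dval (star p) = - dval p.
Proof.
by case: (split_ordP p) => i ->; rewrite ?(star_l, star_r) /dval ?(row_mxEl, row_mxEr) !mxE ?opprK.
Qed.

Lemma cartan_sp : cartan_mx y \in sp.
Proof.
apply/spP => p q; rewrite /cartan_mx [LHS]mxE [in RHS]mxE (inj_eq (@star_inj n)) eq_sym.
case: eqP => [->|_]; last by rewrite !mulr0n mulr0.
by rewrite !mulr1n -/(dval _) -/(dval _) dval_star sgM mulN1r.
Qed.

Definition cyclic_cartan : 'M[F]_(n + n) := cartan_mx y + cyclic_mx.
Local Notation X := cyclic_cartan.
Local Notation delta p := (delta_mx p 0 : 'cV[F]_(n + n)).

Lemma cyclic_cartan_sp : X \in sp.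
Proof. by apply: memvD; [apply: cartan_sp | apply: cyclic_sp]. Qed.

Lemma cyclic_cartanE t p : X t p = (if t == p then dval p else 0) + cyclic_mx t p.
Proof.
rewrite mxE /cartan_mx [X in X + _ = _]mxE -/(dval t).
by case: eqP => [->|_]; rewrite ?mulr1n ?mulr0n.
Qed.

Lemma cyclic_delta p : X *m delta p - dval p *: delta p = \col_t cyclic_mx t p.
Proof.
apply/matrixP => t j; rewrite ord1 -colE mxE [X in _ + X]mxE [X in - X]mxE.
rewrite [matrix.col _ _ _ _]mxE [in RHS]mxE cyclic_cartanE [delta_mx _ _ _ _]mxE eqxx andbT.
by case: eqP => _ /=; rewrite ?mulr1 ?mulr0 ?subr0 ?add0r // addrC addKr.
Qed.

Lemma cyclic_next p q : colp q = colp p -> pos q = (pos p).+1 ->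
  X *m delta p - dval p *: delta p = sg p *: delta q.
Proof.
move=> cqp pq; rewrite cyclic_delta; apply/matrixP => t j; rewrite ord1 [RHS]mxE !mxE eqxx andbT.
case: (eqVneq t q) => [->|tq]; first by rewrite cqp pq !eqxx mulr1.
rewrite mulr0; case: eqP => // ct.
case: eqP => [pt|_]; first by case/eqP: tq; apply: (pos_inj (col := col)); rewrite ?ct ?pt.
case: andP => // -[_ /eqP pl]; exfalso.
by have := pos_lt col q; rewrite pq cqp pl ltnn.
Qed.

Lemma cyclic_last p q : colp q = colp p -> pos q = 0%N -> ((pos p).+1 = 2 * csize (colp p))%N ->
  X *m delta p - dval p *: delta p = (-1) ^+ csize (colp p) *: delta q.
Proof.
move=> cqp pq pl; rewrite cyclic_delta; apply/matrixP => t j; rewrite ord1 [RHS]mxE !mxE eqxx andbT.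
case: (eqVneq t q) => [->|tq]; last first.
  rewrite mulr0; case: eqP => // ct.
  case: eqP => [pt|_]; first by have := pos_lt col t; rewrite pt ct pl ltnn.
  by case: andP => // -[/eqP pt _]; case/eqP: tq; apply: (pos_inj (col := col)); rewrite ?ct ?pt.
have e0 : (0%N == (pos p).+1) = false by [].
by rewrite cqp pq e0 pl !eqxx mulr1.
Qed.

Variable c : nat.
Hypothesis c_gt0 : (0 < csize c)%N.
Hypothesis char_col : \prod_(p | colp p == c) ('X - (dval p)%:P) = 'X^(2 * csize c) - 1.
Variable p0 : 'I_(n + n).
Hypotheses (p0c : colp p0 = c) (p0_pos : pos p0 = 0%N).
Local Notation pw i := (powv X (delta p0) i).

Lemma pw_supp i t : pw i t 0 != 0 -> colp t = c /\ (pos t <= i)%N.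
Proof.
elim: i t => [|i IH] t.
  by rewrite /= !mxE andbT; case: (eqVneq t p0) => [-> _|_]; rewrite ?eqxx // p0_pos.
rewrite powvS mxE => h; have [p] : exists p, (X t p != 0) && (pw i p 0 != 0).
  apply/existsP; apply: contraNT h => /existsPn h; rewrite big1 // => p _.
  by apply/eqP; rewrite mulf_eq0; have := h p; rewrite negb_and !negbK.
case/andP=> Xtp /IH[pc pi]; move: Xtp; rewrite cyclic_cartanE.
case: (eqVneq t p) => [-> _|_]; first by split=> //; apply: leqW.
rewrite add0r mxE; case: (eqVneq (colp t) (colp p)) => [ct|_]; last by rewrite eqxx.
case: (eqVneq (pos t) (pos p).+1) => [pt _|_]; first by rewrite ct pc pt.
by case: andP => [[/eqP pt _] _|_]; rewrite ?eqxx // ct pc pt.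
Qed.

Lemma pw_lead i t : (i < 2 * csize c)%N -> colp t = c -> pos t = i -> pw i t 0 != 0.
Proof.
elim: i t => [|i IH] t ic tc tp.
  have -> : t = p0 by apply: (pos_inj (col := col)); rewrite ?p0c ?p0_pos.
  by rewrite /= mxE !eqxx oner_neq0.
have [p [pc pp]] := pos_surj (ltnW ic).
rewrite powvS mxE (bigD1 p) //= big1 ?addr0; last first.
  move=> q qp; case: (eqVneq (pw i q 0) 0) => [->|/pw_supp[qc qi]]; first by rewrite mulr0.
  rewrite cyclic_cartanE; case: (eqVneq t q) => [tq|_]; first by move: qi; rewrite -tq tp ltnn.
  rewrite mxE; case: (colp t == colp q); last by rewrite addr0 mul0r.
  rewrite tp; case: (eqVneq i.+1 (pos q).+1) => [[e]|_]; last by rewrite /= addr0 mul0r.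
  by case/eqP: qp; apply: (pos_inj (col := col)); rewrite ?qc ?pc ?pp.
rewrite mulf_neq0 ?IH ?(ltnW ic) // cyclic_cartanE mxE tc pc tp pp !eqxx.
case: (eqVneq t p) => [e|_]; first by move: tp; rewrite e pp => /eqP; rewrite ltn_eqF.
rewrite add0r; apply/eqP => s0; have := sgM F p; rewrite s0 mul0r => /esym/eqP.
by rewrite oner_eq0.
Qed.

(** Each factor X - d_p moves the unit vector one step along the chain; the sign collects the steps
    in the second half. *)
Lemma actv_partial i q : (i < 2 * csize c)%N -> colp q = c -> pos q = i ->
  actv X (delta p0) (\prod_(p | (colp p == c) && (pos p < i)%N) ('X - (dval p)%:P)) =
    (-1) ^+ (i - csize c) *: delta q.
Proof.
elim: i q => [|i IH] q ic qc qi.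
  rewrite big_pred0 => [|p]; last by rewrite andbF.
  rewrite sub0n expr0 scale1r -(_ : p0 = q); last first.
    by apply: (pos_inj (col := col)); rewrite ?p0c ?qc ?p0_pos.
  by rewrite -[1](scale1r 'X^0) actvZXn scale1r.
have [p [pc pp]] := pos_surj (ltnW ic).
rewrite (bigD1 p) /=; last by rewrite pc eqxx pp ltnSn.
rewrite (eq_bigl (fun t => (colp t == c) && (pos t < i)%N)); last first.
  move=> t; rewrite ltnS -andbA; case: eqP => //= ct; rewrite ltn_neqAle andbC; congr (_ && _).
  apply/idP/idP; apply: contraNN => /eqP e; apply/eqP; last by rewrite e.
  by apply: (pos_inj (col := col)); rewrite ?ct ?pc ?pp.
rewrite actv_XsubC (IH p) ?(ltnW ic) // -scalemxAr scalerA mulrC -scalerA -scalerBr.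
rewrite (@cyclic_next p q) ?pc ?pp // scalerA; congr (_ *: _).
rewrite (sg_pos col) pc pp; case: ltnP => h.
  by rewrite mulr1; congr (_ ^+ _); lia.
by rewrite subSn // exprSr.
Qed.

(** Once around the chain, prod (X - d_p) sends the start vector to its negative; by [char_col] this
    product is X^(2m) - 1 with m = csize c, so X^(2m) kills the start vector. *)
Lemma pw_last : pw (2 * csize c) = 0.
Proof.
have s2 : ((2 * csize c).-1 < 2 * csize c)%N by lia.
have [q [qc qp]] := pos_surj s2.
have := actv_partial s2 qc qp.
have : actv X (delta p0) ('X^(2 * csize c) - 1) = - delta p0.
  rewrite -char_col (bigD1 q) ?qc //= (eq_bigl (fun t => (colp t == c) && (pos t < (2 * csize c).-1)%N)).
    rewrite actv_XsubC (actv_partial s2 qc qp) -scalemxAr scalerA mulrC -scalerA -scalerBr.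
    rewrite (@cyclic_last q p0) ?qc ?qp ?p0c //; last by lia.
    rewrite scalerA -exprD (_ : ((2 * csize c).-1 - csize c + csize c = (csize c).-1 * 2 + 1)%N); last by lia.
    by rewrite exprD mulnC exprM sqrrN !expr1n mul1r expr1 scaleN1r.
  move=> t; case: eqP => //= ct; apply/idP/idP => [tq|lt].
    rewrite ltn_neqAle; apply/andP; split; last by have := pos_lt col t; rewrite ct; lia.
    by apply: contraNN tq => /eqP e; apply/eqP/(pos_inj (col := col)); rewrite ?ct ?qc ?qp.
  by apply: contraTneq lt => ->; rewrite qp ltnn.
have -> : 'X^(2 * csize c) - 1 = \sum_(Q <- [:: 1 *: 'X^(2 * csize c); (-1) *: 'X^0]) Q :> {poly F}.
  by rewrite !big_cons big_nil addr0 scale1r scaleN1r.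
rewrite actv_sum !big_cons big_nil addr0 !actvZXn scale1r scaleN1r => /eqP.
by rewrite -subr_eq0 opprK subrK => /eqP.
Qed.

Lemma pw_ge i : (2 * csize c <= i)%N -> pw i = 0.
Proof.
move=> h; rewrite -(subnK h) -powvD pw_last; elim: (_ - _)%N => //= m ->.
by rewrite mulmx0.
Qed.

(** [star p0] is the last position of the chain: it is first reached by the power of exponent 2m -
    1, and all later powers are 0. *)
Lemma pw_dual i : (pw i (star p0) 0 != 0) = (i == (2 * csize c).-1)%N.
Proof.
have ps := pos_star col p0; rewrite p0_pos p0c addn0 in ps.
apply/idP/eqP => [h|->]; last by apply: pw_lead; rewrite ?colp_star //; lia.
have [_ le] := pw_supp h; case: (leqP (2 * csize c) i) => [/pw_ge e|]; last by lia.
by rewrite e mxE eqxx in h.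
Qed.

End Cyclic.

Section CyclicUpper.
Variables (F : numFieldType) (n : nat) (col : 'I_n -> nat) (y : 'rV[F]_n).
Variable ht : 'I_(n + n) -> int.
Implicit Types (p q t : 'I_(n + n)) (u w : 'I_n).
Local Notation colp := (colp col).
Local Notation csize := (csize col).
Local Notation pos := (pos col).
Local Notation X := (cyclic_cartan col y).
Local Notation delta p := (delta_mx p 0 : 'cV[F]_(n + n)).
Local Notation l u := (ht (lshift n u)).
Hypothesis ht_star : forall p, ht (star p) = - ht p.
Hypothesis ht_neg : forall u, l u < 0.
Hypothesis ht_inj : forall u w, col u = col w -> l u = l w -> u = w.
Hypothesis char_col : forall u,
  \prod_(p | colp p == col u) ('X - (dval y p)%:P) = 'X^(2 * csize (col u)) - 1.

Lemma csize_gt0 u : (0 < csize (col u))%N.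
Proof. exact: leq_trans (crank_csize col u). Qed.

Definition chain_start u :=
  odflt (lshift n u) [pick p | (colp p == col u) && (pos p == 0%N)].

Lemma chain_startP u : colp (chain_start u) = col u /\ pos (chain_start u) = 0%N.
Proof.
rewrite /chain_start; case: pickP => [p /andP[/eqP -> /eqP ->] //|h].
have h0 : (0 < 2 * csize (col u))%N by rewrite muln_gt0 csize_gt0.
by have [p [pc pp]] := pos_surj h0; have := h p; rewrite pc pp !eqxx.
Qed.

Lemma chain_start_col u w : col u = col w -> chain_start u = chain_start w.
Proof.
move=> e; have [cu pu] := chain_startP u; have [cw pw] := chain_startP w.
by apply: (pos_inj (col := col)); rewrite ?cu ?cw ?pu.
Qed.

Local Notation pw u i := (powv X (delta (chain_start u)) i).

Definition hrank u := #|[set w | (col w == col u) && (l w < l u)]|.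

Lemma hrank_lt u w : col u = col w -> (hrank u < hrank w)%N = (l u < l w).
Proof.
have half u' w' : col u' = col w' -> l u' < l w' -> (hrank u' < hrank w')%N.
  move=> c lt; apply: proper_card; apply/fintype.properP; split.
    by apply/fintype.subsetP => v; rewrite !finset.inE c => /andP[-> /= /lt_trans]; apply.
  by exists u'; rewrite !finset.inE c eqxx //= ltxx.
move=> c; case: (ltgtP (l u) (l w)) => [|h|/(ht_inj c) ->]; last by rewrite ltnn.
  exact: half.
by apply/negbTE; rewrite -leqNgt ltnW // half.
Qed.

Lemma hrank_inj u w : col u = col w -> hrank u = hrank w -> u = w.
Proof.
move=> c e; apply: (ht_inj c); apply/eqP; rewrite eq_le !leNgt -!hrank_lt // ?e ?ltnn //.
Qed.

Lemma hrank_csize u : (hrank u < csize (col u))%N.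
Proof.
apply: proper_card; apply/fintype.properP; split.
  by apply/fintype.subsetP => w; rewrite !finset.inE ltn_ord => /andP[].
by exists u; rewrite !finset.inE ?ltn_ord eqxx //= ltxx.
Qed.

Lemma hrank_surj u i : (i < csize (col u))%N -> exists w, col w = col u /\ hrank w = i.
Proof.
move=> ic; have h1 : {in column n col (col u) &, injective hrank}.
  move=> v w; rewrite !finset.inE => /andP[_ /eqP vc] /andP[_ /eqP wc].
  by apply: hrank_inj; rewrite vc wc.
have h2 : {in column n col (col u), forall w, (hrank w < #|column n col (col u)|)%N}.
  by move=> w; rewrite !finset.inE => /andP[_ /eqP <-]; apply: hrank_csize.
have [w wc wi] := inj_lt_surj h1 h2 ic; exists w; split=> //.
by move: wc; rewrite finset.inE => /andP[_ /eqP].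
Qed.

(** X is skew for the symplectic form, so its powers move across with a sign. *)
Lemma gram_pw u w i j :
  ((pw u i)^T *m sympJ *m pw w j) 0 0 =
  (-1) ^+ i * sg (chain_start u) * pw w (i + j) (star (chain_start u)) 0.
Proof.
elim: i j => [|i IH] j.
  rewrite /= -mulmxA trmx_delta -rowE mxE mulJmx expr0 mul1r; congr (_ * _).
have XJ : X^T *m sympJ = - (sympJ *m X).
  by have := cyclic_cartan_sp col y; rewrite mem_sp addr_eq0 => /eqP.
rewrite powvS trmx_mul -(mulmxA _ X^T) XJ mulmxN mulNmx mulmxA -(mulmxA _ X) -powvS mxE IH exprS.
by rewrite -!mulrA mulN1r addnS addSn.
Qed.

Lemma gram_pw_neq0 u w i j :
  (((pw u i)^T *m sympJ *m pw w j) 0 0 != 0) =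
  (col u == col w) && ((i + j).+1 == 2 * csize (col u))%N.
Proof.
rewrite gram_pw mulf_eq0 negb_or mulf_neq0 ?signr_eq0 //=; last first.
  by apply/eqP => s0; have := sgM F (chain_start u); rewrite s0 mul0r => /esym/eqP; rewrite oner_eq0.
have [cu pu] := chain_startP u; have [cw pw0] := chain_startP w.
case: (eqVneq (col u) (col w)) => [e|ne] /=.
  rewrite (chain_start_col e) (pw_dual (csize_gt0 w) (char_col w) cw pw0) e.
  by have := csize_gt0 w; move=> ?; apply/eqP/eqP; lia.
apply/negbTE; rewrite negbK; apply: contraNT ne => h.
have [c _] := pw_supp cw pw0 h.
by rewrite colp_star cu in c; apply/eqP.
Qed.

(** The second half of the powers of X on each start vector spans an X-stable Lagrangian, since the
    form pairs the exponents i and j only if i + j = 2m - 1; the first half gives the transversal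
    [Z]. The vectors are numbered by [hrank] so that X lowers the rank within the column, hence the
    height. *)
Lemma cyclic_upper : upper_conj ht X.
Proof.
pose ex u := ((2 * csize (col u)).-1 - hrank u)%N.
pose W : 'M[F]_(n + n, n) := \matrix_(p, u) pw u (ex u) p 0.
pose Z : 'M[F]_(n + n, n) := \matrix_(p, u) pw u (hrank u) p 0.
pose A : 'M[F]_n := \matrix_(u, w) ((col u == col w) && (hrank w == (hrank u).+1))%:R.
have colW u : matrix.col u W = pw u (ex u) by apply/matrixP => p j; rewrite !mxE ord1.
have colZ u : matrix.col u Z = pw u (hrank u) by apply/matrixP => p j; rewrite !mxE ord1.
have gram (U V : 'M[F]_(n + n, n)) u w : (U^T *m sympJ *m V) u w =
    ((matrix.col u U)^T *m sympJ *m matrix.col w V) 0 0.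
  by rewrite [LHS]mxE [RHS]mxE; apply: eq_bigr => p _; rewrite !mulmxJ !mxE.
have exE u : (ex u + hrank u).+1 = (2 * csize (col u))%N.
  by rewrite /ex; have := hrank_csize u; lia.
apply: (@lagrangian_upper F n W Z X A) => //.
- exact: cyclic_cartan_sp.
- apply/matrixP => u w; rewrite gram !colW [RHS]mxE; apply/eqP/negPn; rewrite gram_pw_neq0.
  apply/negP => /andP[/eqP c /eqP h]; have := exE u; have := exE w.
  have := hrank_csize u; have := hrank_csize w; rewrite -c; move: h; lia.
- apply: (@ranked_triangular_unit _ _ (fun=> 0)).
    by move=> u; rewrite gram colW colZ gram_pw_neq0 eqxx exE eqxx.
  move=> u w; rewrite gram colW colZ gram_pw_neq0 => /andP[/eqP c /eqP h] /eqP[].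
  by apply: (hrank_inj c); have := exE u; lia.
- apply/matrixP => p u; rewrite !mxE.
  rewrite (_ : (\sum_j _) = pw u (ex u).+1 p 0); last first.
    by rewrite powvS [RHS]mxE; apply: eq_bigr => q _; rewrite !mxE.
  case: (posnP (hrank u)) => [r0|rp].
    rewrite (_ : (ex u).+1 = 2 * csize (col u))%N; last by rewrite -exE r0 addn0.
    have [cu pu] := chain_startP u.
    rewrite (pw_last (csize_gt0 u) (char_col u) cu pu) mxE big1 // => w _.
    by rewrite !mxE r0 andbF mulr0.
  have rc : ((hrank u).-1 < csize (col u))%N by have := hrank_csize u; lia.
  have [w [wc wr]] := hrank_surj rc.
  rewrite (bigD1 w) //= big1 ?addr0 => [|v vw]; last first.
    rewrite !mxE; case: andP => [[/eqP vc /eqP vr]|_]; last by rewrite mulr0.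
    by case/eqP: vw; apply: hrank_inj; rewrite ?vc ?wc // wr vr.
  rewrite !mxE wc wr prednK // !eqxx mulr1 (chain_start_col wc) (_ : ex w = (ex u).+1).
    by rewrite powvS mxE.
  by have := exE u; have := exE w; rewrite wc wr; lia.
move=> u w; rewrite mxE; case: andP => [[/eqP c /eqP h] _|_]; last by rewrite eqxx.
by rewrite -hrank_lt // h.
Qed.

End CyclicUpper.

(** * Homogeneous components and equality in top degree *)

Section HomogeneousComponents.
Variable F : numFieldType.

Lemma meval_scale_homog m d (f : {mpoly F[m]}) t (v : 'I_m -> F) : f \is d.-homog ->
  f.@[fun i => t * v i] = t ^+ d * f.@[v].
Proof.
move=> /dhomogP fd; rewrite !mevalE mulr_sumr !big_seq; apply: eq_bigr => mm /fd <-.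
rewrite mulrCA; congr (_ * _); under eq_bigr do rewrite exprMn.
by rewrite big_split /= -expr_sum -mdegE.
Qed.

(** f(t v) is a polynomial in t whose coefficients are the values at v of the homogeneous
    components. *)
Lemma pihomog_vanish m d (f : {mpoly F[m]}) (v : 'I_m -> F) :
    (forall t, t != 0 -> f.@[fun i => t * v i] = 0) ->
  (pihomog mdeg d f).@[v] = 0.
Proof.
move=> f0; pose P : {poly F} := \poly_(e < (maxn (msize f) d.+1)) (pihomog mdeg e f).@[v].
suff P0 : P = 0.
  by have := congr1 (fun Q : {poly F} => Q`_d) P0; rewrite coef_poly coef0 leq_maxr.
apply: poly_eq0_punctured => t t0; rewrite horner_poly -[RHS](f0 t t0).
rewrite [in RHS](pihomog_partitionE (leq_maxl (msize f) d.+1)) raddf_sum.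
by apply: eq_bigr => e _ /=; rewrite (meval_scale_homog _ _ (pihomogP mdeg e f)) mulrC.
Qed.

End HomogeneousComponents.

Section LeadingTerm.
Variables (F : numFieldType) (n : nat).
Implicit Types (f g h : {mpoly F[n]}).

(** Equality of the degree d parts, phrased by sizes so as to include the case where they vanish. *)
Definition same_top d f g :=
  [/\ (msize f <= d.+1)%N, (msize g <= d.+1)%N & (msize (f - g) <= d)%N].

Lemma msize_sum_le I (r : seq I) (P : pred I) (f : I -> {mpoly F[n]}) d :
  (forall i, P i -> (msize (f i) <= d)%N) -> (msize (\sum_(i <- r | P i) f i) <= d)%N.
Proof.
move=> fd; apply: (big_ind (fun g : {mpoly F[n]} => (msize g <= d)%N)) => //.
  by rewrite msize0.
by move=> g h gd hd; apply: leq_trans (msizeD_le _ _) _; rewrite geq_max gd.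
Qed.

Lemma msizeM_bound0 f g d e : (msize f <= d)%N -> (msize g <= e.+1)%N -> (msize (f * g) <= d + e)%N.
Proof.
case: d => [|d] fd ge; last by rewrite addSn; apply: msizeM_bound.
by move: fd; rewrite leqn0 msize_poly_eq0 => /eqP ->; rewrite mul0r msize0.
Qed.

Lemma same_top_mul d e f f' g g' : same_top d f f' -> same_top e g g' ->
  same_top (d + e) (f * g) (f' * g').
Proof.
move=> [f1 f2 f3] [g1 g2 g3]; split; try exact: msizeM_bound.
have -> : f * g - f' * g' = (f - f') * g + (g - g') * f'.
  by rewrite !mulrBl [g * f']mulrC [g' * f']mulrC addrA subrK.
apply: leq_trans (msizeD_le _ _) _; rewrite geq_max msizeM_bound0 //=.
by rewrite addnC msizeM_bound0.
Qed.

Lemma same_top1 : same_top 0 1 1.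
Proof. by split; rewrite ?subrr ?msize0 // msize1. Qed.

Lemma same_top_exp d f f' i : same_top d f f' -> same_top (d * i) (f ^+ i) (f' ^+ i).
Proof.
move=> ff; elim: i => [|i IH]; first by rewrite muln0 !expr0; apply: same_top1.
by rewrite !exprS mulnS; apply: same_top_mul.
Qed.

Lemma same_top_prod (I : finType) (d : I -> nat) (f f' : I -> {mpoly F[n]}) :
  (forall i, same_top (d i) (f i) (f' i)) -> same_top (\sum_i d i) (\prod_i f i) (\prod_i f' i).
Proof.
move=> ff; elim: (index_enum I) => [|i r IH]; first by rewrite !big_nil; apply: same_top1.
by rewrite !big_cons; apply: same_top_mul.
Qed.

Lemma same_top_comp m (h : {mpoly F[m]}) d (t t' : m.-tuple {mpoly F[n]}) :
    h \is d.-homog -> (forall i, same_top 1 (tnth t i) (tnth t' i)) ->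
  same_top d (h \mPo t) (h \mPo t').
Proof.
move=> /dhomogP hd tt; have E (mm : 'X_{1..m}) : mm \in msupp h ->
    same_top d (\prod_i tnth t i ^+ mm i) (\prod_i tnth t' i ^+ mm i).
  move/hd => /= <-; rewrite mdegE; under eq_bigr do rewrite -[mm _]mul1n.
  by apply: same_top_prod => i; apply: same_top_exp.
rewrite !comp_mpolyE !big_seq; split.
- by apply: msize_sum_le => mm /E[h1 _ _]; apply: leq_trans (msizeZ_le _ _) h1.
- by apply: msize_sum_le => mm /E[_ h1 _]; apply: leq_trans (msizeZ_le _ _) h1.
rewrite -sumrB; apply: msize_sum_le => mm /E[_ _ h1].
by rewrite -scalerBr; apply: leq_trans (msizeZ_le _ _) h1.
Qed.

Lemma homog_comp m (h : {mpoly F[m]}) d (t : m.-tuple {mpoly F[n]}) :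
  h \is d.-homog -> (forall i, tnth t i \is 1.-homog) -> h \mPo t \is d.-homog.
Proof.
move=> /dhomogP hd t1; have tX i e : tnth t i ^+ e \is e.-homog.
  elim: e => [|e IH]; first by rewrite expr0 dhomog1.
  by rewrite exprS -add1n; apply: dhomogM.
rewrite comp_mpolyE big_seq; apply: rpred_sum => mm /hd /= <-; apply: rpredZ; rewrite mdegE.
elim: (index_enum _) => [|i r IH]; first by rewrite !big_nil dhomog1.
by rewrite !big_cons; apply: dhomogM.
Qed.

End LeadingTerm.

Lemma restrict_homog (F : numFieldType) n d (f : {mpoly F[(n + n) * (n + n)]}) :
  f \is d.-homog -> restrict_to_cartan f \is d.-homog.
Proof.
move=> fh; apply: homog_comp fh _ => i; rewrite tnth_mktuple; case/mxvec_indexP: i => p q.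
rewrite mxvecE mxE; case: (p == q); last by rewrite mulr0n rpred0.
by rewrite mulr1n mxE; case: split => i; rewrite !mxE ?rpredN dhomogX /= mdeg1.
Qed.

Lemma restrict_pihomog (F : numFieldType) n d (f : {mpoly F[(n + n) * (n + n)]}) :
  restrict_to_cartan (pihomog mdeg d f) = pihomog mdeg d (restrict_to_cartan f).
Proof.
have fE := pihomog_partitionE (leq_maxl (msize f) d.+1).
have -> : restrict_to_cartan f = \sum_(e < maxn (msize f) d.+1) restrict_to_cartan (pihomog mdeg e f).
  by rewrite [in LHS]fE /restrict_to_cartan raddf_sum.
have rh e := restrict_homog (pihomogP mdeg e f).
rewrite linear_sum (bigD1 (Ordinal (leq_maxr (msize f) d.+1))) //= (pihomog_dE (rh d)).
by rewrite big1 ?addr0 // => e ed; apply: pihomog_ne0 (rh e).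
Qed.

(** * Diagonal entries with prescribed characteristic polynomial *)

Section RootsOfUnity.
Variables (F : numClosedFieldType) (n : nat) (col : 'I_n -> nat).
Implicit Types (u w : 'I_n).

Definition unity_roots c : seq F := sval (closed_field_poly_normal ('X^c - 1 : {poly F})).

Lemma unity_roots_prod c : (0 < c)%N -> \prod_(z <- unity_roots c) ('X - z%:P) = 'X^c - 1.
Proof.
move=> c0; rewrite /unity_roots; case: closed_field_poly_normal => rs /= e; rewrite [RHS]e.
by rewrite -[1]/(1%:P) lead_coefXnsubC // scale1r.
Qed.

Lemma unity_roots_uniq c : (0 < c)%N -> uniq (unity_roots c).
Proof.
move=> c0; rewrite -separable_prod_XsubC unity_roots_prod //.
by apply: separable_Xn_sub_1; rewrite pnatr_eq0 -lt0n.
Qed.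

Lemma size_unity_roots c : (0 < c)%N -> size (unity_roots c) = c.
Proof.
move=> c0; apply: succn_inj; rewrite -(size_prod_XsubC (unity_roots c) id) unity_roots_prod //.
by rewrite -[1]/(1%:P) size_XnsubC.
Qed.

Lemma unity_root_neq0 c z : (0 < c)%N -> z \in unity_roots c -> z != 0.
Proof.
move=> c0; rewrite -root_prod_XsubC unity_roots_prod // rootE !hornerE.
by apply: contraTneq => ->; rewrite expr0n gtn_eqF // sub0r oppr_eq0 oner_eq0.
Qed.

(** Square roots are taken because both y and -y occur on the chain: a column of length m then has
    prod (t^2 - y^2) = t^(2m) - 1, as the cyclic construction requires, and its squares are nonzero
    and distinct. *)
Definition chain_value u : F := sqrtC (unity_roots (csize col (col u)))`_(crank col u).

Let csize0 u : (0 < csize col (col u))%N := leq_trans (ltn0Sn _) (crank_csize col u).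

Lemma chain_value_neq0 u : chain_value u != 0.
Proof.
rewrite sqrtC_eq0; apply: (unity_root_neq0 (csize0 u)); apply: mem_nth.
by rewrite size_unity_roots ?csize0 ?crank_csize.
Qed.

Lemma chain_value_inj u w : col u = col w ->
  chain_value u ^+ 2 = chain_value w ^+ 2 -> u = w.
Proof.
move=> c; rewrite !sqrtCK c => /eqP; rewrite nth_uniq ?size_unity_roots ?unity_roots_uniq ?csize0 //.
- by move/eqP/(crank_inj c).
- by rewrite -c crank_csize.
- by rewrite crank_csize.
Qed.

(** The factors of an index and its dual combine to t^2 - y^2, which ignores signs; a column
    permutation only reorders them. *)
Lemma chain_value_char (e : {ffun 'I_n -> bool}) (s : 'S_n) u : colperm n col s ->
  \prod_(p | colp col p == col u)
     ('X - (dval (\row_i signed_point chain_value e s i) p)%:P) =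
  'X^(2 * csize col (col u)) - 1.
Proof.
move=> /colpermP[_ sc]; set c := col u; pose rs := unity_roots (csize col c).
have sq (t : 'I_n) : signed_point chain_value e s t ^+ 2 = chain_value (s t) ^+ 2.
  by rewrite /signed_point exprMn -exprM mulnC exprM sqrrN !expr1n mul1r.
rewrite big_mkcond big_split_ord /=.
under eq_bigr do rewrite colp_l /dval row_mxEl mxE.
under [X in _ * X]eq_bigr do rewrite colp_r /dval row_mxEr !mxE.
rewrite -!big_mkcond -big_split /=.
transitivity (\prod_(i | col i == c) ('X^2 - (rs`_(crank col i))%:P)).
  rewrite [RHS](reindex_inj (@perm_inj _ s)) /=; apply: eq_big => [i|i /eqP ic]; first by rewrite sc.
  rewrite polyCN opprK -subr_sqr -polyC_exp sq sqrtCK sc ic //.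
have p1 : perm_eq [seq crank col i | i <- enum (column n col c)] (iota 0 (csize col c)).
  have mc i : i \in enum (column n col c) -> col i = c.
    by rewrite mem_enum finset.inE => /andP[_ /eqP].
  apply: uniq_perm; rewrite ?iota_uniq //.
    by rewrite map_inj_in_uniq ?enum_uniq // => i j /mc ic /mc jc; apply: crank_inj; rewrite ic jc.
  move=> r; rewrite mem_iota add0n /=; apply/mapP/idP => [[i /mc ic ->]|/crank_surj[i ic <-]].
    by rewrite -ic crank_csize.
  by exists i => //; rewrite mem_enum.
transitivity (\prod_(z <- rs) ('X^2 - z%:P)).
  rewrite -[rs in RHS](mkseq_nth 0) size_unity_roots ?csize0 // /mkseq big_map.
  rewrite -(perm_big _ p1) big_map big_enum; apply: eq_bigl => i /=.
  by rewrite finset.inE ltn_ord.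
have -> : \prod_(z <- rs) ('X^2 - z%:P) = (\prod_(z <- rs) ('X - z%:P)) \Po 'X^2 :> {poly F}.
  rewrite rmorph_prod /=; apply: eq_bigr => z _.
  by rewrite rmorphB /= comp_polyX comp_polyC.
by rewrite unity_roots_prod ?csize0 // rmorphB /= rmorph1 comp_Xn_poly -exprM.
Qed.

End RootsOfUnity.

Section ClosureOrthogonal.
Variables (F : numClosedFieldType) (n : nat) (col : 'I_n -> nat).
Variable ht : 'I_(n + n) -> int.
Hypothesis ht_star : forall p, ht (star p) = - ht p.
Hypothesis ht_neg : forall u, ht (lshift n u) < 0.
Hypothesis ht_inj : forall u w : 'I_n,
  col u = col w -> ht (lshift n u) = ht (lshift n w) -> u = w.

Lemma upper_conj_scale (t : F) X : upper_conj ht X -> upper_conj ht (t *: X).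
Proof.
move=> [g [Y [gS YU ->]]]; exists g, (t *: Y); split=> //; first exact: memvZ.
by rewrite -scalemxAr -scalemxAl.
Qed.

(** The saturation is a cone, so its vanishing ideal contains the homogeneous components of its
    elements. *)
Lemma upper_conj_pihomog d (f : {mpoly F[(n + n) * (n + n)]}) :
    (forall X, upper_conj ht X -> mxeval f X = 0) ->
  forall X, upper_conj ht X -> mxeval (pihomog mdeg d f) X = 0.
Proof.
move=> f0 X XU; apply: pihomog_vanish => t _; rewrite -[RHS](f0 _ (upper_conj_scale t XU)).
by apply: meval_eq => i; rewrite linearZ !mxE.
Qed.

Lemma cartan_generic_map (v : 'I_n -> F) :
  map_mx (meval v) (cartan_mx (\row_i 'X_i)) = cartan_mx (\row_i v i).
Proof.
apply/matrixP => p q; rewrite !mxE /=; case: (p == q); last by rewrite !mulr0n meval0.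
by rewrite !mulr1n; case: split => i; rewrite !mxE ?mevalN mevalXU.
Qed.

Lemma restrict_same_top d (f : {mpoly F[(n + n) * (n + n)]}) (C : 'M[F]_(n + n)) :
  f \is d.-homog ->
  same_top d (mxpoly_comp f (cartan_mx (\row_i 'X_i) + map_mx (@mpolyC n F) C))
    (restrict_to_cartan f).
Proof.
move=> fd; apply: same_top_comp fd _ => i; rewrite !tnth_mktuple.
case/mxvec_indexP: i => p q; rewrite !mxvecE [X in same_top _ X _]mxE [X in _ + X]mxE.
have h1 : (msize ((C p q)%:MP : {mpoly F[n]}) <= 1)%N by rewrite msizeC; case: (_ != 0).
have h2 : (msize (cartan_mx (\row_i 'X_i : 'rV[{mpoly F[n]}]_n) p q) <= 2)%N.
  rewrite mxE; case: (p == q); last by rewrite mulr0n msize0.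
  by rewrite mulr1n mxE; case: split => i; rewrite !mxE ?msizeN msizeX mdeg1.
split=> //; last by rewrite addrAC subrr add0r.
apply: leq_trans (msizeD_le _ _) _; rewrite geq_max h2 /=; exact: leq_trans h1 _.
Qed.

(* The top-degree part of [f (diag y + C)], with [C] the cyclic matrix, is the
   restriction of [f] to the Cartan subalgebra, while [f (diag y + C) = 0] for
   all signed column permutations [y] of the chain values. *)
Lemma closure_alt_coef (f : {mpoly F[(n + n) * (n + n)]}) m :
    (forall X, upper_conj ht X -> mxeval f X = 0) ->
  alt_coef n col (restrict_to_cartan f * 'X_[m]) = 0.
Proof.
move=> f0; rewrite (pihomog_partitionE (leqnn (msize f))).
rewrite /restrict_to_cartan raddf_sum mulr_suml linear_sum big1 //= => d _.
set fd := pihomog mdeg d f.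
have fd0 : forall X, upper_conj ht X -> mxeval fd X = 0 by apply: upper_conj_pihomog.
have fdh : fd \is d.-homog by apply: pihomogP.
have := restrict_same_top (cyclic_mx F col) fdh.
set g := mxpoly_comp _ _; rewrite -/(restrict_to_cartan fd); set r := restrict_to_cartan fd.
move=> [gd rd grd].
(* Away from the exact degree of the staircase the coefficient is 0 for reasons of degree. *)
have [mD|mD] := eqVneq (d + mdeg m)%N (stair_deg n col); last first.
  have [lt|gt|/eqP e] := ltngtP (d + mdeg m)%N (stair_deg n col); last by rewrite (negPf mD) in e.
    apply: alt_coef_msize; apply: leq_trans (msizeM_bound rd (_ : (_ <= (mdeg m).+1)%N)) _ => //.
    by rewrite msizeX.
  have rh : r \is d.-homog.
    exact: restrict_homog fdh.
  apply: alt_coef_deg => m' m'D; apply: (@dhomog_nemf_coeff _ _ mdeg (d + mdeg m)).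
    by apply: dhomogM => //; rewrite dhomogX.
  by rewrite /= m'D eq_sym.
have -> : r * 'X_[m] = g * 'X_[m] - (g - r) * 'X_[m] by rewrite -mulrBl opprB addrC subrK.
rewrite linearB /= [X in _ - X]alt_coef_msize ?subr0; last first.
  by rewrite -mD; apply: msizeM_bound0; rewrite ?msizeX.
apply: (@alt_coef_vanish _ _ _ _ (chain_value F col)).
- by move=> i; rewrite leqNgt ltn_ord.
- by move=> i _; apply: chain_value_neq0.
- by move=> i j _ _; apply: chain_value_inj.
- by rewrite -mD; apply: msizeM_bound; rewrite ?msizeX.
move=> s e sG; rewrite mevalM meval_mxpoly_comp map_mxD cartan_generic_map.
set y := \row_i _.
have -> : map_mx (meval (signed_point (chain_value F col) e s)) (map_mx (@mpolyC n F) (cyclic_mx F col)) = cyclic_mx F col.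
  by apply/matrixP => p q; rewrite !mxE mevalC.
rewrite fd0 ?mul0r //; apply: cyclic_upper => // u.
exact: chain_value_char.
Qed.

End ClosureOrthogonal.

Lemma equal_fibers_perm n (T : finType) (lab lab' : 'I_n -> T) :
    (forall j, #|[set i | lab i == j]| = #|[set i | lab' i == j]|) ->
  exists s : 'S_n, forall i, lab' (s i) = lab i.
Proof.
move=> E; have : perm_eq [tuple lab i | i < n] [tuple lab' i | i < n].
  apply/allP => j _ /=; have cE (l : 'I_n -> T) :
      count_mem j [tuple l i | i < n] = #|[set i | l i == j]|.
    rewrite -sum1dep_card -sum1_count big_map big_mkcond [RHS]big_mkcond /=.
    by rewrite big_enum.
  by rewrite !cE E.
case/tuple_permP => s e; exists s => i.
have := congr1 (fun r => nth (lab i) r i) e.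
by rewrite -!tnth_nth !tnth_mktuple.
Qed.

Section ClosureOrth.
Variables (F : numClosedFieldType) (n k : nat) (b : 'I_k -> nat).
Variables (ht : 'I_(n + n) -> int) (lab : 'I_n -> 'I_k).
Hypothesis ht_star : forall p, ht (star p) = - ht p.
Hypothesis ht_neq0 : forall p, ht p != 0.
Hypothesis ht_lab : forall p q, lab (star_index p) = lab (star_index q) <->
  ht p = ht q \/ ht p = - ht q.
Hypothesis lab_card : forall j, #|[set i | lab i == j]| = b j.

Lemma sum_lab_card : (\sum_j b j)%N = n.
Proof.
rewrite -[RHS](card_ord n) -sum1_card (partition_big lab xpredT) //=.
by apply: eq_bigr => j _; rewrite -lab_card -sum1dep_card.
Qed.

(** The filling and the height index the rows differently and the signs of the heights are
    arbitrary; a Weyl group element [theta] matches the rows and makes the heights negative on the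
    first half, after which [closure_alt_coef] applies. *)
Lemma closure_orth (f : {mpoly F[(n + n) * (n + n)]}) :
  (forall X, upper_conj ht X -> mxeval f X = 0) -> orth n b (restrict_to_cartan f).
Proof.
move=> f0 lab' col fl m.
have [j|s sE] := @equal_fibers_perm n _ lab' lab.
  rewrite lab_card -(filling_row j (leqnn n) sum_lab_card fl); apply: eq_card => i.
  by rewrite !finset.inE ltn_ord.
(* The member of the dual pair of [i] whose height is negative. *)
pose neg i := if ht (lshift n i) < 0 then lshift n i else rshift n i.
have neg_idx i : star_index (neg i) = i.
  by rewrite /neg; case: ifP => _; rewrite ?star_index_l ?star_index_r.
have ht_nE i : ht (neg i) < 0.
  rewrite /neg; case: ifP => // /negbT; rewrite -leNgt => h.
  by rewrite -star_l ht_star oppr_lt0 lt_neqAle eq_sym ht_neq0.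
pose theta p := match split p with inl i => neg (s i) | inr i => star (neg (s i)) end.
have thetaL i : theta (lshift n i) = neg (s i) by rewrite /theta -[lshift n i]/(unsplit (inl i)) unsplitK.
have thetaR i : theta (rshift n i) = star (neg (s i)) by rewrite /theta -[rshift n i]/(unsplit (inr i)) unsplitK.
clearbody theta.
have theta_star : {morph theta : p / star p}.
  move=> p; case: (split_ordP p) => i ->; rewrite ?(star_l, star_r) thetaL thetaR //.
  by rewrite starK.
have theta_idx p : star_index (theta p) = s (star_index p).
  case: (split_ordP p) => i ->; rewrite ?thetaL ?thetaR ?star_index_star neg_idx.
    by rewrite star_index_l.
  by rewrite star_index_r.
have theta_inj : injective theta.
  move=> p q e; have /perm_inj/star_index_eq[//|pq] : s (star_index p) = s (star_index q).
    by rewrite -!theta_idx e.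
  by have := star_neq (theta q); rewrite -theta_star -pq e eqxx.
have ht_lE i : (ht \o theta) (lshift n i) = ht (neg (s i)) by rewrite /= thetaL.
apply: (@closure_alt_coef _ _ col (ht \o theta)).
- by move=> p; rewrite /= theta_star ht_star.
- by move=> i; rewrite ht_lE.
- move=> u w c; rewrite !ht_lE => e; have [_ fi] := fl; apply: fi => //.
  rewrite -!sE -(neg_idx (s u)) -(neg_idx (s w)); apply/ht_lab; by left.
by move=> X XU; apply: f0; apply: upper_conj_perm theta_inj theta_star _ XU.
Qed.

End ClosureOrth.

(** * The associated graded ideal *)

Section TopComponent.
Variables (F : numFieldType) (n : nat).
Implicit Types (f g : {mpoly F[n]}).

Lemma pihomog_same_top d g : (msize g <= d.+1)%N -> same_top d g (pihomog mdeg d g).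
Proof.
move=> gd; split=> //; first exact: msize_homog (pihomogP _ _ _).
rewrite {1}(pihomog_partitionE gd) big_ord_recr /= addrK.
by apply: msize_sum_le => e _; apply: leq_trans (msize_homog (pihomogP _ _ _)) _.
Qed.

Lemma pihomog_small d g : (msize g <= d)%N -> pihomog mdeg d g = 0.
Proof.
move=> gd; rewrite pihomogE big_seq_cond big1 // => m /andP[/msize_mdeg_lt lt /eqP e].
by move: (leq_trans lt gd); rewrite -e ltnn.
Qed.

Lemma top_component_add d f g : f != 0 -> f \is d.-homog -> (msize g <= d)%N ->
  top_component (f + g) = f.
Proof.
move=> f0 fh gd; have E : pihomog mdeg d (f + g) = f.
  by rewrite pihomogD (pihomog_dE fh) pihomog_small // addr0.
have le : (msize (f + g) <= d.+1)%N.
  apply: leq_trans (msizeD_le _ _) _; rewrite geq_max msize_homog //=; exact: leqW.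
rewrite /top_component (_ : (msize (f + g)).-1 = d) //; apply/eqP; rewrite -eqSS; case: (leqP (msize (f + g)) d) => [/pihomog_small e|ge].
  by move: f0; rewrite -E e eqxx.
by rewrite prednK ?eqn_leq ?le // (leq_trans _ ge).
Qed.

End TopComponent.

Section GradedIdeal.
Variables (F : numFieldType) (n k : nat) (b : 'I_k -> nat).
Variables (lab : 'I_n -> 'I_k) (X : 'I_k -> F) (x : 'rV[F]_n).
Hypothesis lab_card : forall j, #|[set i | lab i == j]| = b j.
Hypothesis X_neq0 : forall j, X j != 0.
Hypothesis X_inj : injective X.
Hypothesis x_sq : forall i, x 0 i ^+ 2 = X (lab i).

Lemma gr_orth f : gr_ideal (orbit_ideal x) f -> orth n b f.
Proof.
move: f; apply: ideal_gen_ind.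
- by move=> lab' col _ m; rewrite mul0r linear0.
- by move=> f g fo go lab' col fl m; rewrite mulrDl linearD /= (fo _ _ fl) (go _ _ fl) addr0.
move=> c f [g gI <-] lab' col fl m.
suff : orth n b (top_component g) by move=> o; rewrite mulrAC mulrC; apply: orth_mul fl.
move=> {}lab' {}col {}fl {}m {c f}; rewrite /top_component.
have [->|g0] := eqVneq g 0; first by rewrite pihomog0 mul0r linear0.
set d := (msize g).-1; have gd : (msize g <= d.+1)%N by rewrite /d; case: (msize g).
have [_ td gtd] := pihomog_same_top gd; have th := pihomogP mdeg d g.
set t := pihomog mdeg d g in td gtd th *.
have [mD|mD] := eqVneq (d + mdeg m)%N (stair_deg n col); last first.
  apply: alt_coef_deg => m' m'D; apply: (@dhomog_nemf_coeff _ _ mdeg (d + mdeg m)).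
    by apply: dhomogM => //; rewrite dhomogX.
  by rewrite /= m'D eq_sym.
have -> : t * 'X_[m] = g * 'X_[m] - (g - t) * 'X_[m] by rewrite -mulrBl opprB addrC subrK.
rewrite linearB /= [X in _ - X]alt_coef_msize ?subr0; last first.
  by rewrite -mD; apply: msizeM_bound0; rewrite ?msizeX.
(* A point of W.x is chosen whose rows are those of the filling; two variables of a column then lie
   in different rows and have different squares. *)
have [j|s sE] := @equal_fibers_perm n _ lab' lab.
  rewrite lab_card -(filling_row j (leqnn n) (sum_lab_card lab_card) fl); apply: eq_card => i.
  by rewrite !finset.inE ltn_ord.
apply: (@alt_coef_vanish _ _ _ _ (fun i => x 0 (s i))).
- by move=> i; rewrite leqNgt ltn_ord.
- by move=> i _; rewrite -sqrf_eq0 x_sq X_neq0.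
- move=> i j _ _ cij; rewrite !x_sq !sE => /X_inj e; have [_ fi] := fl; exact: fi.
- by rewrite -mD; apply: msizeM_bound; rewrite ?msizeX.
move=> s' e _; rewrite mevalM -[X in X * _](_ : g.@[(\row_i ((-1) ^+ e i * x 0 ((s' * s)%g i))) 0] = _).
  by rewrite gI ?mul0r //; exists (s' * s)%g, e.
by apply: meval_eq => i; rewrite mxE permM.
Qed.

Lemma tan_gr f : tan_ideal n b f -> gr_ideal (orbit_ideal x) f.
Proof.
move: f; apply: ideal_gen_ind; [exact: ideal_gen0 | exact: ideal_genD |].
move=> c _ [L [p [LN p1 lt ->]]]; apply: ideal_genM.
have [->|e0] := eqVneq (esq F L p) 0; first exact: ideal_gen0.
have [g [gs gy]] := esq_lift X (leqnn n) LN (sum_lab_card lab_card) lt.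
apply: ideal_gen_mem; exists (esq F L p + g).
  move=> _ [s [e ->]]; apply: (gy _ (fun i => lab (s i))).
    by move=> i _; rewrite mxE exprMn -exprM mulnC exprM sqrrN !expr1n mul1r x_sq.
  move=> j; rewrite -lab_card -(card_preimset [set i | lab i == j] (@perm_inj _ s)).
  by apply/subset_leq_card/fintype.subsetP => i; rewrite !finset.inE ltn_ord.
exact: top_component_add e0 (esq_homog F L p) gs.
Qed.

End GradedIdeal.

(** * Partitions and labels *)

Lemma sumn_drop_conj (s : seq nat) q : sumn (drop q (conj_part s)) = (\sum_(m <- s) (m - q))%N.
Proof.
(* A fixed bound [M] replaces the maximum, which would change along the induction on [s]. *)
have conjE M : all (fun m => m <= M)%N s ->
    sumn (drop q (mkseq (fun j => count (fun m => j < m)%N s) M)) = (\sum_(m <- s) (m - q))%N.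
  elim: s => [_|m s IH /= /andP[mM sM]].
    by rewrite big_nil sumnE; apply: big1_seq => i /andP[_ /mem_drop/mapP[j _ ->]].
  rewrite big_cons -IH // /mkseq -!map_drop drop_iota add0n !sumnE !big_map.
  rewrite big_split /=; congr (_ + _)%N.
  rewrite -big_mkcond sum1_count.
  have -> : (m - q = size (iota q (m - q)))%N by rewrite size_iota.
  have -> : (M - q = (m - q) + (M - m - (q - m)))%N by lia.
  rewrite iotaD count_cat (eq_in_count (a2 := xpredT)) ?count_predT.
    rewrite -[RHS]addn0; congr (_ + _)%N; apply/eqP; rewrite -leqn0 leqNgt -has_count.
    by apply/hasPn => j; rewrite mem_iota; lia.
  by move=> j; rewrite mem_iota; lia.
by apply: conjE; apply/allP => m ms; exact: (@leq_bigmax_seq nat s xpredT id m ms isT).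
Qed.

Lemma sumn_drop_double k (b : k.-tuple nat) q :
  sumn (drop q (conj_part (double_parts b))) = (2 * \sum_j (tnth b j - q))%N.
Proof.
rewrite sumn_drop_conj /double_parts big_flatten big_map /= big_tuple big_distrr /=.
by apply: eq_bigr => j _; rewrite !big_cons big_nil addn0 mul2n addnn.
Qed.

(** Doubling the parts doubles every part of the transpose, so d_l is twice the excess and 2 p >= 2
    l - d_l + 1 becomes l < p + excess. *)
Lemma tanisaki_tan (F : numFieldType) n k (b : k.-tuple nat) (f : {mpoly F[n]}) :
  tanisaki_ideal (conj_part (double_parts b)) f <-> tan_ideal n (tnth b) f.
Proof.
have dE l : dpart n l (conj_part (double_parts b)) = (2 * excess n (tnth b) l)%N.
  exact: sumn_drop_double.
split; move: f; apply: ideal_gen_ind; try exact: ideal_gen0; try exact: ideal_genD.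
- move=> c _ [L [p [_ /andP[p1 pL] lt ->]]]; apply/ideal_genM/ideal_gen_mem.
  exists L, p; split=> //; last exact: esym_sqE.
    by apply/fintype.subsetP => i _; rewrite mem_below ltn_ord.
  by move: lt; rewrite dE; lia.
move=> c _ [L [p [_ p1 lt ->]]]; apply: ideal_genM.
case: (leqP p #|L|) => [pL|/esq_gt->]; last exact: ideal_gen0.
apply: ideal_gen_mem; exists L, p; rewrite p1 pL esym_sqE // dE; split=> //; last lia.
exact: leq_trans p1 pL.
Qed.

Section Labels.
Variables (n a : nat) (b : seq nat).
Hypothesis hn : (a + sumn b)%N = n.
Local Notation row i := (reshape_index (a :: b) (i : nat)).

Lemma row_size (i : 'I_n) : (row i < (size b).+1)%N.
Proof. by apply: (@reshape_indexP (a :: b)); rewrite /= hn. Qed.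

Lemma card_row j : #|[set i : 'I_n | row i == j]| = nth 0%N (a :: b) j.
Proof.
set m := nth _ _ _; have ok (c : 'I_m) : (flatten_index (a :: b) j c < n)%N.
  by rewrite -hn; apply: (@flatten_indexP (a :: b)); apply: ltn_ord.
have -> : [set i : 'I_n | row i == j] = [set Ordinal (ok c) | c in [set: 'I_m]].
  apply/setP => i; rewrite finset.inE; apply/eqP/imsetP => [e|[c _ ->]]; last first.
    exact: flatten_indexKl (ltn_ord c).
  have iS : (i < sumn (a :: b))%N by rewrite /= hn.
  have := reshape_offsetP iS; rewrite e => h; exists (Ordinal h); rewrite ?finset.in_setT //.
  by apply: val_inj; rewrite /= -{1}(reshape_indexK (a :: b) i) e.
rewrite card_imset ?finset.cardsT ?card_ord // => c d [e]; apply: val_inj.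
by rewrite /= -(flatten_indexKr (ltn_ord c)) e flatten_indexKr.
Qed.

Lemma row_lt (i : 'I_n) : (0 < nth 0%N (a :: b) (row i))%N.
Proof.
have iS : (i < sumn (a :: b))%N by rewrite /= hn.
by apply: leq_ltn_trans (reshape_offsetP iS).
Qed.

Local Notation label := (@levi_label n a b).

Lemma levi_label_row p q : (label p).1 = (label q).1 <-> label p = label q \/ label p = label (star q).
Proof.
case: (split_ordP p) => i ->; case: (split_ordP q) => j ->;
  rewrite ?(star_l, star_r) ?(levi_label_l, levi_label_r) /=; (split=> [->|[[-> //]|[-> //]]]);
  by [left | right].
Qed.

Lemma label_star_index p : (label p).1 = row (star_index p).
Proof.
by case: (split_ordP p) => i ->; rewrite ?(levi_label_l, levi_label_r) ?(star_index_l, star_index_r).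
Qed.

Section Height.
Variable ht : 'I_(n + n) -> int.
Hypothesis ht_star : forall p, ht (star p) = - ht p.
Hypothesis ht_label : forall p q, ht p = ht q <-> label p = label q.

Lemma ht_row p q : row (star_index p) = row (star_index q) <-> ht p = ht q \/ ht p = - ht q.
Proof. by rewrite -!label_star_index levi_label_row -ht_star !ht_label. Qed.

(** An odd height separating labels is 0 exactly where the label is self-dual, that is, on the sp_2a
    summand. *)
Lemma ht_eq0 p : (ht p == 0) = (row (star_index p) == 0%N).
Proof.
have -> : (ht p == 0) = (label p == label (star p)).
  apply/eqP/eqP; rewrite -ht_label ht_star; [by move=> ->; rewrite oppr0 |].
  by move/eqP; rewrite -addr_eq0 -mulr2n mulrn_eq0 => /eqP.
rewrite levi_label_star /dual_label -label_star_index; case: (split_ordP p) => i ->;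
  by rewrite ?(levi_label_l, levi_label_r) xpair_eqE /= eqxx; case: (row i).
Qed.

End Height.

Section GenericPoint.
Variables (F : numFieldType) (x : 'rV[F]_n).
Hypothesis x_gen : generic_central sp (levi n a b) (cartan_mx x).

Lemma lie_cartan_root p q : lie (cartan_mx x) (root_mx F p q) = (dval x p - dval x q) *: root_mx F p q.
Proof.
have := @root_mx_supp F n p q; move: (root_mx F p q) => Z supp.
apply/matrixP => s t; rewrite /lie /cartan_mx !mxE.
rewrite (bigD1 s) //= big1 ?addr0 => [|u us]; last by rewrite [diag_mx _ _ _]mxE eq_sym (negPf us) mulr0n mul0r.
rewrite (bigD1 t) //= big1 ?addr0 => [|u us]; last by rewrite [diag_mx _ _ _]mxE (negPf us) mulr0n mulr0.
rewrite ![diag_mx _ _ _]mxE !eqxx !mulr1n -/(dval x s) -/(dval x t).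
have [->|h] := eqVneq (Z s t) 0; first by rewrite !mulr0 mul0r subr0.
have -> : dval x p - dval x q = dval x s - dval x t.
  have [[-> ->]|[-> ->]] := supp _ _ h; first by [].
  by rewrite !dval_star opprK addrC.
by rewrite mulrBl [_ * dval x t]mulrC.
Qed.

(** The centralizer condition is tested on a root vector: it commutes with x if and only if its root
    vanishes at x, and lies in l if and only if its two labels agree. *)
Lemma generic_label p q : p != q -> dval x p = dval x q <-> label p = label q.
Proof.
move=> pq; have [_ _ /(_ _ (root_mx_sp F p q)) C] := x_gen; split=> [e|e].
  have /C/mem_levi[_ h] : lie (cartan_mx x) (root_mx F p q) = 0.
    by rewrite lie_cartan_root e subrr scale0r.
  by apply/eqP; apply: contraNT (root_mx_neq0 F pq) => /h ->.
have /C/matrixP/(_ p q) : root_mx F p q \in levi n a b by apply: root_mx_levi.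
rewrite lie_cartan_root !mxE => /eqP; rewrite mulf_eq0 => /orP[|h]; first by rewrite subr_eq0 => /eqP.
by have := root_mx_neq0 F pq; rewrite !mxE h.
Qed.

Lemma generic_eq0 i : (x 0 i == 0) = (row i == 0%N).
Proof.
have pq : lshift n i != rshift n i by rewrite eq_lrshift.
have := generic_label pq; rewrite /dval row_mxEl row_mxEr mxE levi_label_l levi_label_r => C.
apply/eqP/eqP => [e|e].
  have /(congr1 snd)/esym/negbFE/eqP// : (row i, false) = (row i, row i != 0%N).
  by apply/C; rewrite e oppr0.
have /eqP : x 0 i = - x 0 i by apply/C; rewrite e.
by rewrite -addr_eq0 -mulr2n mulrn_eq0 => /eqP.
Qed.

Lemma generic_sq i j : x 0 i ^+ 2 = x 0 j ^+ 2 <-> row i = row j.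
Proof.
split=> [/eqP|e].
  rewrite eqf_sqr => /orP[] /eqP e.
    have [->//|ij] := eqVneq i j.
    have /generic_label : lshift n i != lshift n j by rewrite (inj_eq (@lshift_inj _ _)).
    by rewrite /dval !row_mxEl !levi_label_l => C; have /C[] := e.
  have /generic_label : lshift n i != rshift n j by rewrite eq_lrshift.
  by rewrite /dval row_mxEl row_mxEr mxE levi_label_l levi_label_r => C; have /C[] := e.
have [->//|ij] := eqVneq i j.
have /generic_label : lshift n i != lshift n j by rewrite (inj_eq (@lshift_inj _ _)).
by rewrite /dval !row_mxEl !levi_label_l e => -[_ ->].
Qed.

End GenericPoint.
End Labels.

(** * The case [a = 0] *)

Section RestrictedIdeal.
Variables (F : numFieldType) (n : nat) (O : set 'M[F]_(n + n)).

Lemma closure_cartan_idealP f : closure_cartan_ideal O f <->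
  exists2 g, (forall X, O X -> mxeval g X = 0) & restrict_to_cartan g = f.
Proof.
split=> -[g gO gf]; exists g => //.
  by move=> X OX; apply: gO => h hO; apply: hO.
by move=> X; apply; apply: gO.
Qed.

(** Surjectivity makes the image of the vanishing ideal an ideal; the coordinates of h lift to the
    diagonal entries of the first half. *)
Lemma restrict_to_cartan_surj f : exists g : {mpoly F[(n + n) * (n + n)]},
  restrict_to_cartan g = f.
Proof.
exists (f \mPo [tuple 'X_(mxvec_index (lshift n i) (lshift n i)) | i < n]).
rewrite /restrict_to_cartan [X in comp_mpoly _ X]comp_mpolyE raddf_sum [RHS]mpolyE /=.
apply: eq_bigr => m _; rewrite comp_mpolyZ; congr (_ *: _).
rewrite rmorph_prod mpolyXE_id; apply: eq_bigr => i _ /=.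
rewrite rmorphXn /= tnth_mktuple comp_mpolyXU -tnth_nth tnth_mktuple mxvecE; congr (_ ^+ _).
by rewrite /cartan_mx mxE eqxx mulr1n row_mxEl mxE.
Qed.

Lemma closure_cartan_ideal0 : closure_cartan_ideal O 0.
Proof.
apply/closure_cartan_idealP; exists 0; last by rewrite /restrict_to_cartan raddf0.
by move=> X _; rewrite /mxeval meval0.
Qed.

Lemma closure_cartan_idealD f g : closure_cartan_ideal O f ->
  closure_cartan_ideal O g -> closure_cartan_ideal O (f + g).
Proof.
move=> /closure_cartan_idealP[f' f0 <-] /closure_cartan_idealP[g' g0 <-].
apply/closure_cartan_idealP; exists (f' + g'); last by rewrite /restrict_to_cartan raddfD.
by move=> X OX; rewrite /mxeval mevalD [X in X + _]f0 // [X in _ + X]g0 // addr0.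
Qed.

Lemma closure_cartan_idealM c f : closure_cartan_ideal O f ->
  closure_cartan_ideal O (c * f).
Proof.
move=> /closure_cartan_idealP[f' f0 <-]; have [c' <-] := restrict_to_cartan_surj c.
apply/closure_cartan_idealP; exists (c' * f'); last by rewrite /restrict_to_cartan rmorphM.
by move=> X OX; rewrite /mxeval mevalM [X in _ * X]f0 // mulr0.
Qed.

End RestrictedIdeal.

Section FlatCase.
Variables (F : numClosedFieldType) (n k : nat) (b : k.-tuple nat) (O : set 'M[F]_(n + n)).
Hypotheses (hk : (0 < k)%N) (b_pos : all (leq 1) b) (hn : sumn b = n).
Hypothesis hO : induced_zero_orbit (levi n 0 b) O.

(** For a = 0 the row of index 0 is empty, so the indices in use start at 1. *)
Lemma row_gl : exists lab : 'I_n -> 'I_k,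
  forall i : 'I_n, reshape_index (0%N :: b) i = (lab i).+1.
Proof.
apply: (@fin_all_exists _ (fun=> 'I_k) (fun (i : 'I_n) (j : 'I_k) =>
  reshape_index (0%N :: b) i = j.+1)) => i.
have := @row_size n 0 b hn i; have := @row_lt n 0 b hn i.
case: reshape_index => [|r] // _; rewrite ltnS size_tuple => rk.
by exists (Ordinal rk).
Qed.

Lemma card_row_gl (lab : 'I_n -> 'I_k) : (forall i : 'I_n, reshape_index (0%N :: b) i = (lab i).+1) ->
  forall j, #|[set i | lab i == j]| = tnth b j.
Proof.
move=> labE j; rewrite (tnth_nth 0%N) -[RHS](@card_row n 0 b hn j.+1); apply: eq_card => i.
by rewrite !finset.inE labE eqSS.
Qed.

Lemma closure_cartan_tan : closure_cartan_ideal O = tanisaki_ideal (conj_part (double_parts b)).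
Proof.
have [lab labE] := row_gl; have labC := card_row_gl labE.
have [ht [ht_star ht_label htO]] := induced_zero_orbit_upper hO.
have ht_neq0 p : ht p != 0 by rewrite (ht_eq0 ht_star ht_label) labE.
have ht_lab p q : lab (star_index p) = lab (star_index q) <-> ht p = ht q \/ ht p = - ht q.
  rewrite -(ht_row ht_star ht_label) !labE; split=> [->//|[]]; exact: val_inj.
apply/seteqP; split=> f.
  move=> /closure_cartan_idealP[g /htO g0 <-]; apply/tanisaki_tan.
  have go := closure_orth ht_star ht_neq0 ht_lab labC g0.
  apply: orth_tan => //; first exact: (sum_lab_card labC).
  by move=> m _ i; rewrite leqNgt ltn_ord.
move/tanisaki_tan; move: f; apply: ideal_gen_ind.
- exact: closure_cartan_ideal0.
- exact: closure_cartan_idealD.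
move=> c f [L [p [_ p1 lt ->]]]; apply: closure_cartan_idealM; case: (leqP p #|L|) => pL; last first.
  by rewrite esq_gt //; apply: closure_cartan_ideal0.
have [g [/htO g0 ge]] := esq_restriction F ht_star ht_neq0 ht_lab labC pL lt.
by apply/closure_cartan_idealP; exists g.
Qed.

Lemma gr_orbit_tan (x : 'rV[F]_n) : generic_central sp (levi n 0 b) (cartan_mx x) ->
  gr_ideal (orbit_ideal x) = tanisaki_ideal (conj_part (double_parts b)).
Proof.
move=> xg; have [lab labE] := row_gl; have labC := card_row_gl labE.
have [c cE] : exists c : 'I_k -> 'I_n, forall j, lab (c j) = j.
  apply: (@fin_all_exists _ (fun=> 'I_n) (fun j i => lab i = j)) => j; have : (0 < #|[set i | lab i == j]|)%N.
    by rewrite labC; apply: (allP b_pos); apply: mem_tnth.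
  by case/card_gt0P => i; rewrite finset.inE => /eqP; exists i.
pose X j := x 0 (c j) ^+ 2.
have xE i : x 0 i ^+ 2 = X (lab i).
  by apply/(generic_sq xg); rewrite !labE cE.
have X0 j : X j != 0 by rewrite expf_eq0 /= (generic_eq0 xg) labE.
have Xi : injective X.
  by move=> i j /(generic_sq xg); rewrite !labE !cE => -[] /val_inj.
apply/seteqP; split=> f => [/(gr_orth labC X0 Xi xE) fo|/tanisaki_tan ft].
  apply/tanisaki_tan; apply: orth_tan => //; first exact: (sum_lab_card labC).
  by move=> m _ i; rewrite leqNgt ltn_ord.
exact: tan_gr labC xE _ ft.
Qed.

End FlatCase.

(** * The case [a > 0] *)

Section SignSums.
Variables (F : numFieldType) (n : nat) (S : {set 'I_n}).

Definition sign_point (e : {ffun 'I_n -> bool}) : 'I_n -> F :=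
  fun i => if i \in S then (-1) ^+ e i else 0.

(** A monomial of degree below |S| omits a variable of [S], and the terms for the two signs at it
    cancel. *)
Lemma sign_sum_small (h : {mpoly F[n]}) : (msize h <= #|S|)%N ->
  \sum_(e : {ffun 'I_n -> bool}) (\prod_(i in S) (-1) ^+ e i) * h.@[sign_point e] = 0.
Proof.
move=> hS; under eq_bigr do rewrite mevalE mulr_sumr.
rewrite exchange_big /= big_seq big1 // => m /msize_mdeg_lt mh.
under eq_bigr do rewrite mulrCA; rewrite -mulr_sumr.
have [i iS mi] : exists2 i, i \in S & m i = 0%N.
  case: (boolP [exists u in S, m u == 0%N]) => [/exists_inP[u uS /eqP]|]; first by exists u.
  rewrite negb_exists_in => /forall_inP h0.
  suff : (#|S| <= mdeg m)%N by rewrite leqNgt (leq_trans mh hS).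
  rewrite mdegE -sum1_card [leqRHS](bigID (mem S)) /= -[leqLHS]addn0 leq_add //.
  by apply: leq_sum => i /h0; rewrite lt0n.
pose c (i : 'I_n) (s : bool) : F :=
  if i \in S then (-1) ^+ s * ((-1) ^+ s) ^+ m i else 0 ^+ m i.
have cE : forall e : {ffun 'I_n -> bool},
    (\prod_(i in S) (-1) ^+ e i) * (\prod_i sign_point e i ^+ m i) = \prod_i c i (e i).
  move=> e; rewrite big_mkcond -big_split; apply: eq_bigr => u _ /=.
  by rewrite /c /sign_point; case: ifP => _; rewrite ?mul1r.
under eq_bigr do rewrite cE.
rewrite -bigA_distr_bigA (bigD1 i) //= (_ : \sum_s c i s = 0) ?mul0r ?mulr0 //.
by rewrite big_bool /c iS mi /= !expr0 !mulr1 expr1 addNr.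
Qed.

Definition set_monomial : {mpoly F[n]} := 'X_[[multinom nat_of_bool (i \in S) | i < n]].

Lemma sign_sum_monomial :
  \sum_(e : {ffun 'I_n -> bool}) (\prod_(i in S) (-1) ^+ e i) * set_monomial.@[sign_point e] = 2 ^+ n.
Proof.
rewrite (eq_bigr (fun=> 1)) => [|e _].
  by rewrite sumr_const card_ffun card_bool card_ord natrX.
rewrite /set_monomial mevalX big_mkcond -big_split big1 // => i _ /=.
rewrite mnmE /sign_point; case: ifP => _; last by rewrite mul1r /= expr0.
by rewrite expr1 -exprD addnn -mul2n exprM sqrrN !expr1n.
Qed.

Lemma set_monomial_homog : set_monomial \is #|S|.-homog.
Proof.
rewrite dhomogX /= mdegE -sum1_card [eqbRHS]big_mkcond; apply/eqP/eq_bigr => i _.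
by rewrite mnmE; case: ifP.
Qed.

Lemma set_monomial_neq0 : set_monomial != 0.
Proof. by rewrite -msize_poly_eq0 msizeX. Qed.

End SignSums.

Section SiegelConjugation.
Variables (F : numFieldType) (n : nat) (ht : 'I_(n + n) -> int).
Implicit Types (M N D T S : 'M[F]_n) (g X Y : 'M[F]_(n + n)).

Lemma upper_conj_intertwine g X Y : Sp g -> Y *m g = g *m X ->
  upper_conj ht X -> upper_conj ht Y.
Proof.
move=> gS YX XU; rewrite -[Y](mulmxK (Sp_unit gS)) YX; exact: upper_conjJ.
Qed.

Lemma block_diag_Sp N M : N *m M = 1%:M -> Sp (block_mx N 0 0 M^T).
Proof.
move=> NM; have MN := mulmx1C NM.
rewrite /Sp /= /sympJ tr_block_mx !trmx0 trmxK !mulmx_block.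
rewrite !(mulmx0, mul0mx, mulmx1, mul1mx, mulmxN, mulNmx, addr0, add0r, oppr0).
by rewrite -trmx_mul MN trmx1.
Qed.

Lemma block_unipotent_Sp T : T^T = T -> Sp (block_mx 1%:M 0 T 1%:M).
Proof.
move=> TT; rewrite /Sp /= /sympJ tr_block_mx !trmx0 trmx1 TT !mulmx_block.
by rewrite !(mulmx0, mul0mx, mulmx1, mul1mx, mulmxN, mulNmx, addr0, add0r, oppr0, mulmx1, addNr).
Qed.

Lemma block_nil_sp D : D^T = D -> block_mx 0 D 0 0 \in @sp F n.
Proof.
move=> DT; rewrite mem_sp /sympJ tr_block_mx !trmx0 DT !mulmx_block.
rewrite !(mulmx0, mul0mx, mulmx1, mul1mx, mulmxN, mulNmx, addr0, add0r, oppr0).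
by rewrite add_block_mx !addr0 subrr block_mx0.
Qed.

(** [N] is the inverse of [M], so the second hypothesis says S = M D M^T. The block diagonal element
    replaces S by D, and the lower unipotent element given by [T] fills the other blocks. *)
Lemma siegel_conj N M S D T : N *m M = 1%:M -> N *m S = D *m M^T ->
    S^T = S -> T^T = T ->
    (forall i j, S i j != 0 -> ht (lshift n i) < ht (rshift n j)) ->
  upper_conj ht (block_mx (- (D *m T)) D (- (T *m D *m T)) (T *m D)).
Proof.
move=> NM NS ST TT hS.
have SU : upper_conj ht (block_mx 0 S 0 0).
  exists 1%:M, (block_mx 0 S 0 0); split; [exact: Sp1 | | by rewrite invmx1 mulmx1 mul1mx].
  apply/mem_upper; split; first exact: block_nil_sp.
  move=> p q; case: (split_ordP p) => i ->; case: (split_ordP q) => j ->;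
    rewrite ?(block_mxEul, block_mxEur, block_mxEdl, block_mxEdr) ?mxE ?eqxx //.
  exact: hS.
have DU : upper_conj ht (block_mx 0 D 0 0).
  apply: (upper_conj_intertwine (block_diag_Sp NM)) SU.
  by rewrite !mulmx_block !(mulmx0, mul0mx, addr0, add0r) NS.
apply: (upper_conj_intertwine (block_unipotent_Sp TT)) DU.
by rewrite !mulmx_block !(mulmx0, mul0mx, mulmx1, mul1mx, mulNmx, addr0, add0r) !addNr.
Qed.

End SiegelConjugation.

(* The upper right block [S = E_R + E_01 + E_10] has the required support, and
   [S = M D M^T] with [D = E_R - E_00] and [M = 1 + E_01]; hence
   [[0, S], [0, 0]] is conjugate to [[0, D], [0, 0]], and the latter to
   [[eps_S, D], [- D, - eps_S]] by the unipotent matrix with lower left block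
   [- D eps]. *)
Section SignedCartan.
Variables (F : numFieldType) (n : nat) (ht : 'I_(n + n) -> int).
Variables (R : {set 'I_n}) (i0 i1 : 'I_n).
Hypotheses (i0R : i0 \notin R) (i1R : i1 \in R).
Hypothesis ht_star : forall p, ht (star p) = - ht p.
Hypothesis ht_R : forall i, i \in R -> ht (lshift n i) < 0.
Hypothesis ht_i0 : ht (lshift n i0) <= 0.

Definition corner_row : 'rV[F]_n := \row_i ((i \in R)%:R - (i == i0)%:R).
Local Notation d := corner_row.
Definition corner_mx : 'M[F]_(n + n) := block_mx 0 (diag_mx d) (- diag_mx d) 0.

Lemma signed_cartan_upper (e : {ffun 'I_n -> bool}) :
  upper_conj ht (cartan_mx (\row_i sign_point F (i0 |: R) e i) + corner_mx).
Proof.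
have i01 : i1 == i0 = false by apply: contraNF i0R => /eqP <-.
have i10 : i0 == i1 = false by rewrite eq_sym.
pose E : 'M[F]_n := diag_mx (\row_i (i \in R)%:R).
have dE : diag_mx d = E - delta_mx i0 i0.
  apply/matrixP => i j; rewrite !mxE; case: (eqVneq i j) => [->|ij].
    by rewrite !mulr1n andbb.
  have -> : (i == i0) && (j == i0) = false by apply: contraNF ij => /andP[/eqP-> /eqP->].
  by rewrite !mulr0n oppr0 addr0.
have sq i : d 0 i * d 0 i = (i \in i0 |: R)%:R.
  rewrite mxE in_setU1; case: (eqVneq i i0) => [->|_] /=; last first.
    by rewrite subr0; case: (_ \in _); rewrite ?mulr1 ?mulr0.
  by rewrite (negPf i0R) sub0r mulrNN mulr1.
have dd i : d 0 i * d 0 i * d 0 i = d 0 i.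
  rewrite sq mxE in_setU1; case: (eqVneq i i0) => [->|_] /=; rewrite ?mul1r //.
  by case: (_ \in _); rewrite ?mul1r ?mul0r ?subr0.
rewrite /corner_mx; move: d dE sq dd => d dE sq dd.
have EL : delta_mx i0 i1 *m E = delta_mx i0 i1.
  apply/matrixP => i j; rewrite mul_mx_diag !mxE; case: (eqVneq j i1) => [->|]; rewrite ?andbF ?mul0r //.
  by rewrite i1R mulr1.
have ER : E *m delta_mx i1 i0 = delta_mx i1 i0.
  apply/matrixP => i j; rewrite mul_diag_mx !mxE; case: (eqVneq i i1) => [->|]; rewrite ?mulr0 //.
  by rewrite i1R mul1r.
have EO : E *m delta_mx i0 i0 = 0.
  apply/matrixP => i j; rewrite mul_diag_mx !mxE; case: (eqVneq i i0) => [->|]; rewrite ?mulr0 //.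
  by rewrite (negPf i0R) mul0r.
have Eij i j : E i j = ((i == j) && (i \in R))%:R.
  by rewrite !mxE; case: eqP => [->|]; rewrite ?mulr1n.
have ET : E^T = E by apply: tr_diag_mx.
(* Chosen so that - d t is eps on i0 + R and t d t = d. *)
clearbody E; pose t : 'rV[F]_n := \row_i (- (d 0 i * (-1) ^+ e i)).
have tE i : t 0 i = - (d 0 i * (-1) ^+ e i) by rewrite mxE.
(* On the plane of i0 and i1, S is a nondegenerate form with i0 isotropic, since the height of i0
   may be 0 and then forbids a diagonal entry there. Completing the square splits this form into the
   values -1 at i0 and 1 at i1 of [d]. *)
have := @siegel_conj F n ht (1%:M - delta_mx i0 i1) (1%:M + delta_mx i0 i1)
  (E + delta_mx i0 i1 + delta_mx i1 i0) (diag_mx d) (diag_mx t).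
have -> : cartan_mx (\row_i sign_point F (i0 |: R) e i) + block_mx 0 (diag_mx d) (- diag_mx d) 0 =
    block_mx (- (diag_mx d *m diag_mx t)) (diag_mx d)
      (- (diag_mx t *m diag_mx d *m diag_mx t)) (diag_mx t *m diag_mx d).
  have sE i : sign_point F (i0 |: R) e i = d 0 i * d 0 i * (-1) ^+ e i.
    by rewrite sq /sign_point; case: (_ \in _); rewrite ?mul1r ?mul0r.
  have e1 i : (-1) ^+ e i * (-1) ^+ e i = 1 :> F by rewrite -exprD addnn -mul2n exprM sqrrN !expr1n.
  clearbody t; rewrite /cartan_mx diag_mx_row add_block_mx !(addr0, add0r) !mulmx_diag -!raddfN.
  congr block_mx; congr diag_mx; apply/rowP => i; rewrite !mxE ?tE ?sE.
  - ring.
  - rewrite -[in LHS](dd i); have := e1 i; move: (_ ^+ _) (d 0 i) => u v uu.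
    transitivity (- (v * v * v * (u * u))); first by rewrite uu mulr1.
    ring.
  - ring.
apply.
- by rewrite mulmxBl mul1mx mulmxDr mulmx1 mul_delta_mx_cond i01 mulr0n addr0 addrK.
- have -> : (1%:M + delta_mx i0 i1)^T = 1%:M + delta_mx i1 i0 :> 'M[F]_n.
    by rewrite linearD /= trmx1 trmx_delta.
  rewrite dE !mulmxBl mul1mx !mulmxDr !mulmx1 EL ER.
  rewrite !mul_delta_mx_cond i01 i10 eqxx !mulr0n !mulr1n.
  by apply/matrixP => i j; rewrite !mxE; ring.
- by rewrite !linearD /= !trmx_delta ET addrAC.
- exact: tr_diag_mx.
move=> i j; rewrite -star_l ht_star !mxE Eij => h.
have : [|| (i == j) && (i \in R), (i == i0) && (j == i1) | (i == i1) && (j == i0)].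
  by apply: contraNT h; rewrite !negb_or => /and3P[/negPf-> /negPf-> /negPf->]; rewrite !addr0.
case/or3P => /andP[/eqP ei].
- by move=> iR; have := ht_R iR; rewrite -ei; lia.
- by move=> /eqP ej; rewrite ei ej; have := ht_R i1R; move: ht_i0; lia.
by move=> /eqP ej; rewrite ei ej; have := ht_R i1R; move: ht_i0; lia.
Qed.

End SignedCartan.

(** Exchanging an index with its dual wherever the height is positive is a Weyl group element. *)
Lemma flip_heights n (ht : 'I_(n + n) -> int) :
    (forall p, ht (star p) = - ht p) ->
  exists theta : 'I_(n + n) -> 'I_(n + n), [/\ injective theta, {morph theta : p / star p}
    & forall i, ht (theta (lshift n i)) = - `|ht (lshift n i)|].
Proof.
move=> ht_star; pose theta p := if ht (lshift n (star_index p)) <= 0 then p else star p.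
have idx p : star_index (theta p) = star_index p.
  by rewrite /theta; case: ifP; rewrite ?star_index_star.
exists theta; split.
- move=> p q e; have := congr1 (@star_index n) e; rewrite !idx => pq.
  by move: e; rewrite /theta pq; case: ifP => // _ /star_inj.
- by move=> p; rewrite /theta star_index_star; case: ifP.
move=> i; rewrite /theta star_index_l; case: ifP => h; first by rewrite ler0_norm ?opprK.
by rewrite ht_star gtr0_norm // ltNge h.
Qed.

Section NonFlatCase.
Variables (F : numClosedFieldType) (n a : nat) (b : seq nat) (O : set 'M[F]_(n + n)).
Hypotheses (hn : (a + sumn b)%N = n) (a_gt0 : (0 < a)%N) (b_gt0 : (0 < sumn b)%N).
Hypothesis hO : induced_zero_orbit (levi n a b) O.
Local Notation row i := (reshape_index (a :: b) (i : nat)).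

Definition gl_rows : {set 'I_n} := [set i : 'I_n | row i != 0%N].

Lemma exists_sp_row : exists i : 'I_n, row i = 0%N.
Proof.
have : (0 < #|[set i : 'I_n | row i == 0%N]|)%N by rewrite (card_row hn).
by case/card_gt0P => i; rewrite finset.inE => /eqP; exists i.
Qed.

Lemma exists_gl_row : exists i : 'I_n, i \in gl_rows.
Proof.
apply/card_gt0P; have := cardsC [set i : 'I_n | row i == 0%N].
rewrite (card_row hn) /= card_ord => e; have an : (a < n)%N by lia.
have : (0 < #|~: [set i : 'I_n | row i == 0%N]|)%N by rewrite -(ltn_add2l a) addn0 e.
by congr (_ < _)%N; apply: eq_card => i; rewrite !finset.inE.
Qed.

Lemma set_monomial_gr (x : 'rV[F]_n) (S : {set 'I_n}) :
    generic_central sp (levi n a b) (cartan_mx x) -> (#|gl_rows| < #|S|)%N ->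
  gr_ideal (orbit_ideal x) (set_monomial F S).
Proof.
move=> xg lt; apply: ideal_gen_mem; exists (set_monomial F S); last first.
  by rewrite -[X in top_component X]addr0 (top_component_add _ (set_monomial_homog F S)) ?set_monomial_neq0 // msize0.
move=> _ [s [e ->]]; have [i iS si] : exists2 i, i \in S & row (s i) = 0%N.
  case: (boolP [exists u in S, row (s u) == 0%N]) => [/exists_inP[u uS /eqP]|]; first by exists u.
  rewrite negb_exists_in => /forall_inP h; suff : (#|S| <= #|gl_rows|)%N by rewrite leqNgt lt.
  rewrite -(card_imset _ (@perm_inj _ s)); apply/subset_leq_card/fintype.subsetP => _ /imsetP[u uS ->].
  by rewrite finset.inE h.
rewrite mevalX (bigD1 i) //= mnmE iS mxE.
have /eqP -> : x 0 (s i) == 0 by rewrite (generic_eq0 xg) si.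
by rewrite mulr0 expr1 mul0r.
Qed.

Lemma set_monomial_not_closure (i0 : 'I_n) : i0 \notin gl_rows ->
  ~ closure_cartan_ideal O (set_monomial F (i0 |: gl_rows)).
Proof.
move=> i0R /closure_cartan_idealP[f].
have [ht [ht_star ht_label htO]] := induced_zero_orbit_upper hO.
move/htO => f0 fE; set S := i0 |: gl_rows in fE; have [i1 i1R] := exists_gl_row.
have [theta [ti ts th]] := flip_heights ht_star.
have ht_row0 i : (ht (lshift n i) == 0) = (i \notin gl_rows).
  by rewrite (ht_eq0 ht_star ht_label) star_index_l finset.inE negbK.
(* It suffices to treat the component of degree |S| of [f], which also vanishes on the saturation
   and restricts to y_S. *)
have zero e : mxeval (pihomog mdeg #|S| f) (cartan_mx (\row_i sign_point F S e i) + corner_mx F gl_rows i0) = 0.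
  apply: (@upper_conj_pihomog _ _ (ht \o theta)).
    by move=> X XU; apply: f0; apply: upper_conj_perm ti ts _ XU.
  apply: (@signed_cartan_upper _ _ (ht \o theta) _ i0 i1) => //.
  - by move=> p; rewrite /= ts ht_star.
  - by move=> i iR; rewrite /= th oppr_lt0 normr_gt0 ht_row0 iR.
  by rewrite /= th oppr_le0 normr_ge0.
have fdh := pihomogP mdeg #|S| f; set fd := pihomog mdeg #|S| f in zero fdh.
have [_ _] := restrict_same_top (corner_mx F gl_rows i0) fdh; set g := mxpoly_comp _ _.
have -> : restrict_to_cartan fd = set_monomial F S.
  have := congr1 (pihomog mdeg #|S|) fE; rewrite (pihomog_dE (set_monomial_homog F S)) => <-.
  exact: restrict_pihomog.
(* The difference of [g] and y_S has degree below |S|, so its signed sum is 0; but [g] vanishes at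
   all the sign points, while y_S contributes 2^n. *)
move/sign_sum_small; under eq_bigr do rewrite mevalB mulrBr.
rewrite sumrB sign_sum_monomial big1 ?sub0r => [|e _].
  by move/eqP; rewrite oppr_eq0 expf_eq0 pnatr_eq0 andbF.
rewrite meval_mxpoly_comp map_mxD cartan_generic_map.
have -> : map_mx (meval (sign_point F S e)) (map_mx (@mpolyC n F) (corner_mx F gl_rows i0)) = corner_mx F gl_rows i0.
  by apply/matrixP => p q; rewrite !mxE mevalC.
by rewrite zero mulr0.
Qed.

Lemma closure_neq_gr (x : 'rV[F]_n) : generic_central sp (levi n a b) (cartan_mx x) ->
  closure_cartan_ideal O <> gr_ideal (orbit_ideal x).
Proof.
move=> xg e; have [i0 i0r] := exists_sp_row.
have i0R : i0 \notin gl_rows by rewrite finset.inE i0r.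
apply: (set_monomial_not_closure i0R); rewrite e; apply: set_monomial_gr => //.
by rewrite cardsU1 i0R.
Qed.

End NonFlatCase.

Theorem theorem1p3 (R : realType) (n a k : nat) (b : k.-tuple nat)
    (O : set 'M[R[i]]_(n + n))
    (hk : (1 <= k)%N)
    (hb_sorted : sorted geq b)
    (hb_pos : all (leq 1) b)
    (hn : (a + sumn b)%N = n)
    (hO : induced_zero_orbit (levi n a b) O) :
  (forall x : 'rV[R[i]]_n,
     generic_central sp (levi n a b) (cartan_mx x) ->
     (closure_cartan_ideal O = gr_ideal (orbit_ideal x) <-> a = 0%N)) /\
  (a = 0%N ->
     closure_cartan_ideal O = tanisaki_ideal (conj_part (double_parts b))).
Proof.
split=> [x xg|a0]; last by subst a; apply: (@closure_cartan_tan R[i]).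
have sb : (0 < sumn b)%N.
  have /allP/(_ _ (mem_tnth (Ordinal hk) b)) h := hb_pos.
  by apply: leq_trans h _; rewrite sumnE big_tuple (bigD1 (Ordinal hk)) //= leq_addr.
split=> [e|a0]; last first.
  by subst a; rewrite (closure_cartan_tan hk hn hO) (gr_orbit_tan hk hb_pos hn xg).
apply/eqP; rewrite -leqn0 leqNgt; apply/negP => a_gt0.
exact: (closure_neq_gr hn a_gt0 sb hO xg) e.
Qed.
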